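(* Let $\lambda,\nu\in\mathbb{C}$, $N\in\mathbb{N}$ and $m\in\mathbb{Z}$, and suppose that $|m|>N$. Then any symmetry breaking operator from $C^\infty(S^3,\mathcal{V}_\lambda^{2N+1})$ to $C^\infty(S^2,\mathcal{L}_{m,\nu})$ is given by a differential operator. In other words, $$\mathrm{Hom}_{SO_0(3,1)}\left(C^\infty(S^3,\mathcal{V}_\lambda^{2N+1}),C^\infty(S^2,\mathcal{L}_{m,\nu})\right)=\mathrm{Diff}_{SO_0(3,1)}\left(C^\infty(S^3,\mathcal{V}_\lambda^{2N+1}),C^\infty(S^2,\mathcal{L}_{m,\nu})\right).$$
   Context: $\mathbb{N}$ denotes the integers $\ge 0$. Groups. On $\mathbb{R}^5$ with coordinates ${}^t(x_0,\dots,x_4)$ let $Q_{4,1}(x)=x_0^2+x_1^2+x_2^2+x_3^2-x_4^2$. $G=SO_0(4,1)$ is the identity component of the group $O(4,1)\subset GL(5,\mathbb{R})$ preserving $Q_{4,1}$, with Lie algebra $\mathfrak{g}(\mathbb{R})$. $G'=SO_0(3,1)$ is realized as the stabilizer in $G$ of ${}^t(0,0,0,1,0)$. With $E_{p,q}$ the elementary $5\times5$ matrices, let $H_0=E_{1,5}+E_{5,1}$, $\mathfrak{n}_+(\mathbb{R})=\ker(\mathrm{ad}(H_0)-\mathrm{id})\subset\mathfrak{g}(\mathbb{R})$, $N_+=\exp\mathfrak{n}_+(\mathbb{R})\simeq\mathbb{R}^3$, $A=\exp(\mathbb{R}H_0)$, $M=\{\mathrm{diag}(1,g,1):g\in SO(3)\}\simeq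 SO(3)$. Then $P=MAN_+$ is the stabilizer in $G$ of the line $(1:0:0:0:1)$, and $G/P\simeq S^3$. Also $P'=P\cap G'=M'AN'_+$, where $M'=\{\mathrm{diag}(1,g',1,1):g'\in SO(2)\}\simeq SO(2)$ and $N'_+=N_+\cap G'\simeq\mathbb{R}^2$; $G'/P'\simeq S^2=\{y\in S^3:y_3=0\}\subset S^3$ (the inclusion being the natural map $G'/P'\to G/P$). Principal series. $(\sigma^{2N+1},V^{2N+1})$ is the irreducible complex representation of $M\simeq SO(3)$ of dimension $2N+1$. For $\lambda\in\mathbb{C}$ let $\sigma_\lambda^{2N+1}$ be the representation of $P$ on $V_\lambda^{2N+1}=V^{2N+1}$ in which $m\in M$ acts by $\sigma^{2N+1}(m)$, $e^{tH_0}\in A$ by $e^{\lambda t}$ and $N_+$ trivially; $\mathcal{V}_\lambda^{2N+1}=G\times_P V_\lambda^{2N+1}$. $C^\infty(S^3,\mathcal{V}_\lambda^{2N+1})$ is the (Fréchet) $G$-module of smooth sections, identified with smooth $f:G\to V^{2N+1}$ with $f(gman)=\sigma^{2N+1}(m)^{-1}a^{-\lambda}f(g)$, $G$ acting by left translation; here $(e^{tH_0})^\lambda=e^{\lambda t}$. For $m\in\mathbb{Z}$, $\nu\in\mathbb{C}$ let $\tau_{m,\nu}$ be the one-dimensional representation $\mathbb{C}_{m,\nu}$ of $P'$ in which $\begin{pmatrix}\cos s&-\sin s\\ \sin s&\cos s\end{pmatrix}\in SO(2)\simeq M'$ acts by $e^{ims}$, $e^{tH_0}$ by $e^{\nu t}$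 and $N_+'$ trivially; $\mathcal{L}_{m,\nu}=G'\times_{P'}\mathbb{C}_{m,\nu}$, and $C^\infty(S^2,\mathcal{L}_{m,\nu})$ is the corresponding $G'$-module. Operators. $\mathrm{Hom}_{SO_0(3,1)}(\cdot,\cdot)$ denotes continuous linear $G'$-equivariant maps (symmetry breaking operators). $\mathrm{Diff}_{SO_0(3,1)}(\cdot,\cdot)$ is the subspace of differential symmetry breaking operators: those $T$ that are differential operators with respect to the inclusion $S^2\hookrightarrow S^3$, i.e. $\mathrm{supp}(Tf)\subset\mathrm{supp}(f)\cap S^2$ for all $f$ (equivalently, locally $T$ is a finite sum of partial derivatives on $S^3$ with smooth coefficients followed by restriction to $S^2$). *)

(* Defs.v *)
From HB Require Import structures.
From mathcomp Require Import all_boot all_order all_algebra.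
From mathcomp Require Import all_classical all_reals all_analysis.
From mathcomp Require Import complex.

Set Implicit Arguments.
Unset Strict Implicit.
Unset Printing Implicit Defensive.

Import Order.TTheory GRing.Theory Num.Theory numFieldNormedType.Exports.
Local Open Scope classical_set_scope.
Local Open Scope ring_scope.

Section Smooth.
Context {R : realType} {V W : normedModType R}.
Implicit Types (U : set V) (F H : V -> W).

Definition iter_derive (vs : seq V) F : V -> W :=
  foldr (fun v E => fun x => 'D_v E x) F vs.

(* C^oo on U: every iterated directional derivative is Frechet
   differentiable at every point of U. *)
Definition smooth_on U F :=
  forall (vs : seq V) x, U x -> differentiable (iter_derive vs F) x.

Lemma near_eq_differentiable F H (x : V) :
  (\near x, F x = H x) -> differentiable F x -> differentiable H x.
Proof.
move=> FH dF; have [dFc dFE] := (diff_locallyP _ _).1 dF.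
have FHx : F x = H x by apply: nbhs_singleton FH.
suff HE : H \o shift x = cst (H x) + 'd F x +o_ 0 id.
  by apply/diff_locallyP; rewrite (diff_unique dFc HE).
apply/eqaddoP => e e0; have /eqaddoP/(_ e e0) := dFE.
have : \forall z \near (0 : V), F (z + x) = H (z + x).
  by move: FH; rewrite (near_shift 0 x); apply: filterS => z /=; rewrite subr0.
by apply: filterS2 => h /= FHh; rewrite /= !fctE /= FHh FHx.
Unshelve. all: by end_near. Qed.

Lemma smooth_onS U U' F : U' `<=` U -> smooth_on U F -> smooth_on U' F.
Proof. by move=> sU sF vs x /sU; apply: sF. Qed.

Lemma smooth_onZD U F H (a : R) : open U ->
  smooth_on U F -> smooth_on U H -> smooth_on U (a *: F + H).
Proof.
move=> oU sF sH.
have E vs x : U x -> iter_derive vs (a *: F + H) x =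
    (a *: iter_derive vs F + iter_derive vs H) x.
  elim: vs x => //= v vs IH x Ux.
  rewrite (@near_eq_derive _ _ _ _ (a *: iter_derive vs F + iter_derive vs H)).
    rewrite deriveD ?deriveZ//; [exact/diff_derivable/sF| |].
      exact/diff_derivable/differentiableZ/sF.
    exact/diff_derivable/sH.
  by near=> y; apply: IH; near: y; exact: open_nbhs_nbhs.
move=> vs x Ux.
apply: (@near_eq_differentiable (a *: iter_derive vs F + iter_derive vs H)).
  by near=> y; apply/esym/E; near: y; exact: open_nbhs_nbhs.
by apply: differentiableD; [apply: differentiableZ; exact: sF|exact: sH].
Unshelve. all: by end_near. Qed.

End Smooth.

Section SmoothComp.
Context {R : realType} {V V' W : normedModType R}.

Lemma smooth_on_linear (U : set V) (F : V -> W) (L : {linear V' -> V}) :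
  continuous L -> smooth_on U F -> smooth_on (L @^-1` U) (F \o L).
Proof.
move=> cL sF vs x Ux.
have -> : iter_derive vs (F \o L) = iter_derive (map L vs) F \o L.
  elim: vs => //= v vs ->; apply/funext => y; set E := iter_derive _ F.
  have e : (fun t : R => t^-1 *: ((E \o L \o shift y) (t *: v) - (E \o L) y)) =
      (fun t => t^-1 *: ((E \o shift (L y)) (t *: L v) - E (L y))).
    by apply/funext => t /=; rewrite linearP.
  by rewrite /derive e.
apply: (@differentiable_comp _ _ _ _ L); last exact: sF.
exact: linear_differentiable.
Qed.

End SmoothComp.

Section ComplexCoordinates.
Context {R : realType}.

(* The library has no topology on R[i] as a real normed space, so smoothness,
   continuity and convergence are tested on real and imaginary parts.
   Real (b = false) and imaginary (b = true) parts of a complex matrix. *)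
Definition part (b : bool) {m n} (A : 'M[R[i]]_(m, n)) : 'M[R]_(m, n) :=
  map_mx (fun z : R[i] => if b then complex.Im z else complex.Re z) A.

Definition cexp (z : R[i]) : R[i] :=
  (expR (complex.Re z))%:C%C *
  (cos (complex.Im z) +i* sin (complex.Im z))%C.

Lemma partZD b m n (c : R[i]) (A B : 'M[R[i]]_(m, n)) :
  part b (c *: A + B) =
  complex.Re c *: part b A +
  ((if b then complex.Im c else - complex.Im c) *: part (~~ b) A + part b B).
Proof.
apply/matrixP => i j; rewrite !mxE; case: c => cr ci.
case: (A i j) => ar ai; case: (B i j) => br bi.
by case: b => /=; rewrite ?mulNr addrA // [_ * _ + ci * _]addrC.
Qed.

Definition mexp {n} (X : 'M[R]_n.+1) : 'M[R]_n.+1 :=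
  limn (series (fun k => k`!%:R^-1 *: X ^+ k)).

End ComplexCoordinates.

Section Groups.
Context {R : realType}.

Definition Q41 (x : 'cV[R]_5) : R :=
  \sum_(i < 5 | i != ord_max) x i 0 ^+ 2 - x ord_max 0 ^+ 2.

Definition O41 : set 'M[R]_5 :=
  [set g | g \in unitmx /\ forall x, Q41 (g *m x) = Q41 x].

Definition SO41 : set 'M[R]_5 := connected_component O41 1%:M.

Definition SO31 : set 'M[R]_5 :=
  [set g | SO41 g /\ g *m delta_mx (inord 3) 0 = delta_mx (inord 3) 0 :> 'cV_5].

Definition lie (K : set 'M[R]_5) : set 'M[R]_5 :=
  [set X | forall t : R, K (mexp (t *: X))].

Definition H_0 : 'M[R]_5 := delta_mx ord0 ord_max + delta_mx ord_max ord0.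

Definition nplus : set 'M[R]_5 :=
  [set X | lie SO41 X /\ H_0 *m X - X *m H_0 = X].

Definition Nplus : set 'M[R]_5 := mexp @` nplus.

Definition SO3 : set 'M[R]_3 := [set g | g^T *m g = 1%:M /\ \det g = 1].

(* diag(1, g, 1) *)
Definition diag1g1 (g : 'M[R]_3) : 'M[R]_5 :=
  block_mx (1%:M : 'M[R]_1) 0 0 (block_mx g 0 0 (1%:M : 'M[R]_1)).

Definition rot (s : R) : 'M[R]_2 :=
  \matrix_(i < 2, j < 2)
    (if i == j then cos s else if (i < j)%N then - sin s else sin s).

(* diag(1, rot s, 1, 1) *)
Definition diagrot (s : R) : 'M[R]_5 :=
  diag1g1 (block_mx (rot s) 0 0 (1%:M : 'M[R]_1)).

(* A representation of P = MAN_+ (resp. P' = M'AN'_+) on C^d is given by its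
   graph, the set of pairs (q, A) where q acts by the matrix A. This avoids
   extracting the factors m, a, n from q. *)
Definition P_rep d (sigma : 'M[R]_3 -> 'M[R[i]]_d) (lambda : R[i]) :
    set ('M[R]_5 * 'M[R[i]]_d) :=
  [set qA | exists m (t : R) n, [/\ SO3 m, Nplus n,
     qA.1 = diag1g1 m *m mexp (t *: H_0) *m n &
     qA.2 = cexp (lambda * t%:C%C) *: sigma m]].

Definition P'_rep (m : int) (nu : R[i]) : set ('M[R]_5 * 'M[R[i]]_1) :=
  [set qA | exists (s t : R) n, [/\ Nplus n, SO31 n,
     qA.1 = diagrot s *m mexp (t *: H_0) *m n &
     qA.2 = (cexp (0 +i* (m%:~R * s))%C * cexp (nu * t%:C%C))%:M]].

(* The row space of U is a subspace of C^d written in row vectors, hence the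
   transpose. *)
Definition SO3_irrep d (sigma : 'M[R]_3 -> 'M[R[i]]_d) : Prop :=
  [/\ sigma 1%:M = 1%:M,
      {in SO3 &, forall g h, sigma (g *m h) = sigma g *m sigma h},
      forall b, {within SO3, continuous (part b \o sigma)} &
      forall U : 'M[R[i]]_d,
        (forall g, SO3 g -> stablemx U (sigma g)^T) ->
        U = 0 \/ row_full U].

Lemma mulmx_continuous m n p (h : 'M[R]_(m, n)) :
  continuous (mulmx h : 'M[R]_(n, p) -> 'M[R]_(m, p)).
Proof.
move=> x.
have E i j : (fun y : 'M[R]_(n, p) => (h *m y) i j) @ nbhs x --> (h *m x) i j.
  rewrite mxE (_ : (fun y => _) = fun y : 'M[R]_(n, p) =>
    \sum_k h i k * y k j); last by apply/funext => y; rewrite mxE.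
  apply: cvg_big => [|k _]; first exact: add_continuous.
  by apply: cvgM; [exact: cvg_cst|exact: coord_continuous].
move=> A [P Px PA].
have : \forall y \near x, forall ij : 'I_m * 'I_p,
    P ij.1 ij.2 ((h *m y) ij.1 ij.2).
  apply: (@filter_forall _ _
    (fun ij y => P ij.1 ij.2 ((h *m y) ij.1 ij.2)) (nbhs x)) => -[i j] /=.
  by apply: E; exact: Px.
by apply: filterS => y Py; apply: PA => i j; exact: (Py (i, j)).
Qed.

Definition matrix_group (K : set 'M[R]_5) : Prop :=
  [/\ K 1%:M, forall h, K h -> h \in unitmx &
      forall h g, K h -> K g -> K (invmx h *m g)].

Lemma SO41_unit h : SO41 h -> h \in unitmx.
Proof. by move=> /connected_component_sub[]. Qed.

Lemma SO41_1 : SO41 1%:M.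
Proof.
apply: connected_component_refl; split; first exact: unitmx1.
by move=> x; rewrite mul1mx.
Qed.

Lemma SO41_divl h g : SO41 h -> SO41 g -> SO41 (invmx h *m g).
Proof.
move=> Gh Gg; have hu := SO41_unit Gh.
have [_ hQ] := connected_component_sub Gh.
apply: (@connected_component_max _ O41 (mulmx (invmx h) @` SO41)) => //.
- by exists h => //; rewrite mulVmx.
- move=> _ [k Gk <-]; have [ku kQ] := connected_component_sub Gk; split.
    by rewrite unitmx_mul unitmx_inv hu.
  by move=> x; rewrite -hQ mulmxA mulKVmx // kQ.
- apply: connected_continuous_connected; first exact: component_connected.
  exact/continuous_subspaceT/mulmx_continuous.
Qed.

Lemma SO41_group : matrix_group SO41.
Proof. by split; [exact: SO41_1|exact: SO41_unit|exact: SO41_divl]. Qed.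

Lemma SO31_divl h g : SO31 h -> SO31 g -> SO31 (invmx h *m g).
Proof.
move=> [Gh he] [Gg ge]; split; first exact: SO41_divl.
by rewrite -mulmxA ge -{1}he mulKmx // SO41_unit.
Qed.

Lemma SO31_sub h : SO31 h -> SO41 h.
Proof. by case. Qed.

Lemma SO31_group : matrix_group SO31.
Proof.
split; [by split; [exact: SO41_1|rewrite mul1mx]| |exact: SO31_divl].
by move=> h /SO31_sub/SO41_unit.
Qed.

End Groups.

Section Sections.
Context {R : realType}.
Variables (K : set 'M[R]_5) (d : nat) (rho : set ('M[R]_5 * 'M[R[i]]_d)).

(* K is a closed submanifold of the space of matrices; f is smooth on K when it
   extends locally to a C^oo function of the matrix entries. *)
Definition smooth_fun (f : 'M[R]_5 -> 'cV[R[i]]_d) : Prop :=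
  forall b g, K g -> exists U (F : 'M[R]_5 -> 'cV[R]_d),
    [/\ open U, U g, smooth_on U F &
        forall x, U x -> K x -> part b (f x) = F x].

(* A section of K x_Q C^d, where rho is the graph of a representation of Q, is an
   equivariant function on K. Functions on K are encoded as functions on all
   matrices that vanish off K, so that distinct sections are distinct
   functions. *)
Definition is_section : {pred 'M[R]_5 -> 'cV[R[i]]_d} :=
  mem [set f | [/\ forall g, ~ K g -> f g = 0,
      smooth_fun f &
      forall g qA, K g -> rho qA -> f (g *m qA.1) = invmx qA.2 *m f g]].

Lemma is_section_submod : submod_closed is_section.
Proof.
split.
  apply/mem_set; split => // [|g qA _ _]; last by rewrite mulmx0.
  move=> b g Kg; exists setT, (cst 0); split => //; first exact: openT.
    move=> vs x _.
    have -> : iter_derive vs (cst 0) = cst (0 : 'cV[R]_d).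
      by elim: vs => //= v vs ->; apply/funext => y; exact: derive_cst.
    exact: differentiable_cst.
  by move=> x _ _; apply/matrixP => i j; rewrite !mxE; case: b.
move=> c f h; rewrite !inE => -[fz fs fe] [hz hs he]; split.
- by move=> g Kg; rewrite !fctE fz // hz // scaler0 addr0.
- move=> b g Kg.
  have [U1 [F1 [op1 U1g sm1 E1]]] := fs b g Kg.
  have [U2 [F2 [op2 U2g sm2 E2]]] := fs (~~ b) g Kg.
  have [U3 [F3 [op3 U3g sm3 E3]]] := hs b g Kg.
  have oU : open (U1 `&` (U2 `&` U3)) by do 2 apply: openI => //.
  exists (U1 `&` (U2 `&` U3)), (complex.Re c *: F1 +
    ((if b then complex.Im c else - complex.Im c) *: F2 + F3)).
  split => //.
    apply: smooth_onZD => //; first by apply: smooth_onS sm1 => x [].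
    apply: smooth_onZD => //; first by apply: smooth_onS sm2 => x [_ []].
    by apply: smooth_onS sm3 => x [_ []].
  by move=> x [x1 [x2 x3]] Kx; rewrite partZD E1 // E2 // E3.
- by move=> g qA Kg rq; rewrite !fctE fe // he // mulmxDr scalemxAr.
Qed.

HB.instance Definition _ :=
  GRing.isSubmodClosed.Build _ _ is_section is_section_submod.

Record sections := Section {
  section_fun :> 'M[R]_5 -> 'cV[R[i]]_d;
  _ : section_fun \in is_section }.

HB.instance Definition _ := [isSub for section_fun].
HB.instance Definition _ := [Choice of sections by <:].
HB.instance Definition _ := [SubChoice_isSubLmodule of sections by <:].

(* Left translation, (h . f) g = f (h^-1 g). *)
Section LeftTranslation.
Variables (gK : matrix_group K) (h : 'M[R]_5) (Kh : K h).

Fact ltrans_subproof (f : sections) :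
  (fun g => f (invmx h *m g)) \in is_section.
Proof.
have [K1 Ku Kdiv] := gK; have hu := Ku _ Kh.
have KVh : K (invmx h) by rewrite -[invmx h]mulmx1; exact: Kdiv.
case: f => f /=; rewrite !inE => -[fz fs fe]; split.
- move=> g Kg; apply: fz => Khg; apply: Kg.
  by rewrite -(mulKVmx hu g) -{1}[h]invmxK; exact: Kdiv.
- move=> b g Kg; have [U [F [oU Ug sF FE]]] := fs b _ (Kdiv _ _ Kh Kg).
  have ch : continuous (mulmx (invmx h) : 'M[R]_5 -> 'M[R]_5).
    exact: mulmx_continuous.
  exists (mulmx (invmx h) @^-1` U), (F \o mulmx (invmx h)); split => //.
  + exact: (open_comp (fun x _ => ch x) oU).
  + exact: smooth_on_linear.
  + by move=> x Ux Kx; rewrite FE //; exact: Kdiv.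
- by move=> g qA Kg rq; rewrite mulmxA fe //; exact: Kdiv.
Qed.

Definition ltrans (f : sections) : sections := Section (ltrans_subproof f).

End LeftTranslation.

(* The left-invariant vector field X on K, acting on functions. *)
Definition lie_derive (X : 'M[R]_5) (u : 'M[R]_5 -> 'cV[R]_d) :
    'M[R]_5 -> 'cV[R]_d :=
  fun g => 'D_1 (fun t : R => u (g *m mexp (t *: X))) 0.

(* The Frechet topology of the smooth sections: the coarsest one such that, for
   all X_1, ..., X_k in the Lie algebra of K, f |-> X_1 ... X_k f is continuous
   for uniform convergence on the compact subsets of K. *)
Definition jet (w : seq (lie K) * bool) (f : sections) :
    {family [set B | compact B /\ B `<=` K], 'M[R]_5 -> 'cV[R]_d} :=
  foldr (fun X => lie_derive (val X)) (part w.2 \o f) w.1.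

HB.instance Definition _ := Topological.copy sections
  (sup_topology (fun w => Topological.on (initial_topology (jet w)))).

End Sections.

Section SymmetryBreaking.
Context {R : realType}.

(* g |-> g P in G / P = S^3, the projectivized light cone: the line of the
   null vector x = g (1,0,0,0,1) is sent to (x_0, ..., x_3) / x_4. On SO31 this is
   G' / P' = S^2 followed by the inclusion S^2 in S^3. *)
Definition sphere_pt (g : 'M[R]_5) : 'cV[R]_4 :=
  let x : 'cV[R]_5 := g *m (delta_mx ord0 0 + delta_mx ord_max 0) in
  \col_(i < 4) (x (widen_ord (leqnSn 4) i) 0 / x ord_max 0).

Definition S2 : set 'cV[R]_4 :=
  [set y | \sum_(i < 4) y i 0 ^+ 2 = 1 /\ y ord_max 0 = 0].

(* Support in S^3, as a closure in R^4, where S^3 is closed. *)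
Definition supp d (f : 'M[R]_5 -> 'cV[R[i]]_d) : set 'cV[R]_4 :=
  closure (sphere_pt @` [set g | f g <> 0]).

Section Operators.
Context {d d' : nat}.
Variables (rho : set ('M[R]_5 * 'M[R[i]]_d))
  (rho' : set ('M[R]_5 * 'M[R[i]]_d')).

Definition Hom_SO31 : set {linear sections SO41 rho -> sections SO31 rho'} :=
  [set T | continuous T /\ forall h (Gh : SO31 h) f,
     T (ltrans SO41_group (SO31_sub Gh) f) = ltrans SO31_group Gh (T f)].

Definition Diff_SO31 : set {linear sections SO41 rho -> sections SO31 rho'} :=
  [set T | Hom_SO31 T /\ forall f, supp (T f) `<=` supp f `&` S2].

End Operators.

End SymmetryBreaking.

Arguments Hom_SO31 {R d d'} rho rho' _.
Arguments Diff_SO31 {R d d'} rho rho' _.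

(* Main.v *)
Require Import Defs.
From HB Require Import structures.
From mathcomp Require Import all_boot all_order all_algebra.
From mathcomp Require Import all_classical all_reals all_analysis.
From mathcomp Require Import complex.
From mathcomp Require Import ring lra.

Set Implicit Arguments.
Unset Strict Implicit.
Unset Printing Implicit Defensive.

Import Order.TTheory GRing.Theory Num.Theory numFieldNormedType.Exports.
Local Open Scope classical_set_scope.
Local Open Scope ring_scope.

(* Let T be a symmetry breaking operator and o the base point of S^3. Translating
   by G', it is enough to show that (T f)(1) = 0 when f vanishes near o. In the
   coordinates x_i = y_i / (y_4 - y_0) of S^3 minus o, put
     Xi f = X_2 (x_1 f) - X_1 (x_2 f) - Z f,
   where X_1, X_2 span n'_+, Z spans the Lie algebra of M', and each acts as the
   derivative of the left translation f (exp(s X) g); this is smooth since f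
   vanishes near o. The functional f |-> (T f)(1) kills every X_i h and turns Z
   into -i m, so it turns Xi into i m. On the other hand -Xi differentiates at g
   along Z + x_2 X_1 - x_1 X_2, which fixes the point g P; conjugated by g it is
   thus in m + n_+, with trace form -2, so that Xi acts pointwise, at g, by a
   conjugate of D = d sigma (Z). By Cayley-Hamilton chi_D (Xi) f = 0, hence
   chi_D (i m) (T f)(1) = 0. The weights of a representation of so(3) are
   symmetric and unbroken, so an eigenvalue i m of D would force
   2 |m| + 1 <= 2 N + 1. *)

(** The coordinates x_i have a pole at o, so that x_i f is a smooth section only when f vanishes
    near o. In Xi they stand inside the derivatives: the functional then kills the first two terms
    whole. Moving them out costs nothing, because X_2 x_1 = X_1 x_2 = 0, and this is what makes Xi
    act pointwise.

    Two analytic obstacles shape the rest. T is only continuous, so it commutes with infinitesimal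
    translations only once difference quotients are known to converge with all their derivatives,
    uniformly on compact sets. And sigma is only continuous: its derivative along a one-parameter
    subgroup comes from integrating the group law, and the bracket relations of so(3) come from
    differentiating a factorization of rotations, so that sigma is differentiated along
    one-parameter subgroups only.

    The trace form on m + n_+ sees only the rotation part. Its value -2 is that of Z, so the
    rotation part of the conjugated field has an axis of length 1 and is conjugate to Z under
    SO(3). *)

(** * Differential calculus: products, inverses and smoothness to finite order *)

Section Calculus.
Context {R : realType} {V W : normedModType R}.
Implicit Types (U : set V) (F H : V -> W) (a : V -> R).

Lemma derive_linear F x (c : R) v w : differentiable F x ->
  'D_(c *: v + w) F x = c *: 'D_v F x + 'D_w F x.
Proof. by move=> dF; rewrite !deriveE // linearP. Qed.

Lemma is_derive_comp_curve F (c : R -> V) t v : differentiable F (c t) ->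
  is_derive t 1 c v -> is_derive t 1 (F \o c) ('D_v F (c t)).
Proof.
move=> dF [dc dcv].
have dct : differentiable c t by apply/derivable1_diffP.
apply: DeriveDef; first by apply/derivable1_diffP; exact: differentiable_comp.
rewrite deriveE; last exact: differentiable_comp.
have <- : 'd c t 1 = v by rewrite -deriveE.
by rewrite diff_comp // deriveE.
Qed.

(** A named copy of scaling, to carry the bilinear structure that [diff_bilin] asks for. *)
Let scale2 (k : R) (w : W) : W := k *: w.
Let scale2_bilin : bilinear_for *:%R *:%R scale2.
Proof.
split=> [w a u v|k a u v]; rewrite /scale2.
  by rewrite scalerDl -scalerA.
rewrite scalerDr; congr (_ + _); rewrite scalerA.
by rewrite mulrC -scalerA.
Qed.
HB.instance Definition _ := bilinear_isBilinear.Build R R W W _ _ scale2 scale2_bilin.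

Let scale2_cont : continuous (fun p : R * W => scale2 p.1 p.2).
Proof. exact: scale_continuous. Qed.

Lemma differentiable_scale a F x : differentiable a x -> differentiable F x ->
  differentiable (fun y => a y *: F y) x.
Proof.
move=> da dF.
apply: (@differentiable_comp _ _ _ _ (fun y => (a y, F y)) (fun p : R * W => scale2 p.1 p.2)).
  exact: differentiable_pair.
exact: differentiable_bilin.
Qed.

Lemma derive_scale a F x v : differentiable a x -> differentiable F x ->
  'D_v (fun y => a y *: F y) x = a x *: 'D_v F x + 'D_v a x *: F x.
Proof.
move=> da dF.
rewrite !deriveE //; last exact: differentiable_scale.
rewrite (@diff_comp _ _ _ _ (fun y => (a y, F y)) (fun p : R * W => scale2 p.1 p.2)).
- rewrite /= diff_bilin // diff_pair //=.
- exact: differentiable_pair.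
- exact: differentiable_bilin.
Qed.

(** The order n makes induction possible: [smooth_uptoS] peels off the innermost derivative, and the
    derivative of a product is a sum of products of factors that are smooth to one order less. *)
Definition smooth_upto n U F :=
  forall vs x, (size vs <= n)%N -> U x -> differentiable (iter_derive vs F) x.

Lemma smooth_upto_le n k U F : (k <= n)%N -> smooth_upto n U F -> smooth_upto k U F.
Proof. by move=> kn sF vs x sk; apply: sF; exact: leq_trans kn. Qed.

Lemma smooth_uptoP U F : smooth_on U F <-> forall n, smooth_upto n U F.
Proof. by split=> [sF n vs x _|sF vs x]; [exact: sF|exact: (sF (size vs))]. Qed.

Lemma iter_derive_rcons vs v F : iter_derive (rcons vs v) F = iter_derive vs ('D_v F).
Proof. by rewrite /iter_derive foldr_rcons. Qed.

Lemma smooth_uptoS n U F : smooth_upto n.+1 U F <->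
  (forall x, U x -> differentiable F x) /\ forall v, smooth_upto n U ('D_v F).
Proof.
split=> [sF|[dF sF] vs x]; first split.
- by move=> x; exact: (sF [::]).
- by move=> v vs x svs; rewrite -iter_derive_rcons; apply: sF; rewrite size_rcons.
- case/lastP: vs => [_|vs v]; first exact: dF.
  by rewrite size_rcons iter_derive_rcons; exact: sF.
Qed.

Lemma smooth_on_derive U F v : smooth_on U F -> smooth_on U ('D_v F).
Proof. by move=> sF vs x; rewrite -iter_derive_rcons; exact: sF. Qed.

Lemma smooth_on_diff U F x : smooth_on U F -> U x -> differentiable F x.
Proof. by move=> sF; exact: (sF [::]). Qed.

Lemma iter_derive_ext U F H vs : open U -> (forall x, U x -> F x = H x) ->
  forall x, U x -> iter_derive vs F x = iter_derive vs H x.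
Proof.
move=> oU FH; elim: vs => //= v vs IH x Ux; apply: near_eq_derive.
by near=> y; apply: IH; near: y; exact: open_nbhs_nbhs.
Unshelve. all: by end_near. Qed.

Lemma smooth_upto_ext n U F H : open U -> (forall x, U x -> F x = H x) ->
  smooth_upto n U F -> smooth_upto n U H.
Proof.
move=> oU FH sF vs x svs Ux.
apply: (@near_eq_differentiable _ _ _ (iter_derive vs F)); last exact: sF.
near=> y; apply: (iter_derive_ext vs oU FH).
by near: y; exact: open_nbhs_nbhs.
Unshelve. all: by end_near. Qed.

Lemma smooth_upto0 n U : smooth_upto n U (fun=> 0 : W).
Proof.
move=> vs x _ _; rewrite (_ : iter_derive vs _ = fun=> 0); first exact: differentiable_cst.
by elim: vs => //= v vs ->; apply/funext => y; exact: derive_cst.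
Qed.

Lemma smooth_upto_cst n U (w : W) : smooth_upto n U (fun=> w).
Proof.
case: n => [|n]; first by case=> // x _ _; exact: differentiable_cst.
apply/smooth_uptoS; split=> [x _|v]; first exact: differentiable_cst.
rewrite (_ : 'D_v _ = fun=> 0); first exact: smooth_upto0.
by apply/funext => y; exact: derive_cst.
Qed.

Lemma smooth_on_cst U (w : W) : smooth_on U (fun=> w).
Proof. by apply/smooth_uptoP => n; exact: smooth_upto_cst. Qed.

Lemma smooth_uptoD n U F H : open U -> smooth_upto n U F -> smooth_upto n U H ->
  smooth_upto n U (fun x => F x + H x).
Proof.
move=> oU; elim: n F H => [|n IH] F H.
  move=> sF sH [|//] x _ Ux /=.
  by apply: differentiableD; [exact: (sF [::])|exact: (sH [::])].
move=> /smooth_uptoS[dF sF] /smooth_uptoS[dH sH]; apply/smooth_uptoS; split.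
  by move=> x Ux; apply: differentiableD; [exact: dF|exact: dH].
move=> v; apply: (@smooth_upto_ext _ _ (fun x => 'D_v F x + 'D_v H x)) => //.
  by move=> x Ux; rewrite deriveD //; apply: diff_derivable; [exact: dF|exact: dH].
exact: IH.
Qed.

Lemma smooth_onD U F H : open U -> smooth_on U F -> smooth_on U H ->
  smooth_on U (fun x => F x + H x).
Proof.
by move=> oU /smooth_uptoP sF /smooth_uptoP sH; apply/smooth_uptoP => n; exact: smooth_uptoD.
Qed.

Lemma smooth_on_sum (I : Type) (r : seq I) U (F : I -> V -> W) : open U ->
  (forall i, smooth_on U (F i)) -> smooth_on U (fun x => \sum_(i <- r) F i x).
Proof.
move=> oU sF; elim: r => [|i r IH].
  rewrite (_ : (fun _ => _) = fun=> 0); first exact: smooth_on_cst.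
  by apply/funext => x; rewrite big_nil.
rewrite (_ : (fun _ => _) = fun x => F i x + \sum_(j <- r) F j x); first exact: smooth_onD.
by apply/funext => x; rewrite big_cons.
Qed.

End Calculus.

Section SmoothScale.
Context {R : realType} {V W : normedModType R}.
Implicit Types (U : set V) (F H : V -> W) (a : V -> R).

Lemma smooth_uptoZ n U a F : open U -> smooth_upto n U a -> smooth_upto n U F ->
  smooth_upto n U (fun x => a x *: F x).
Proof.
move=> oU; elim: n a F => [|n IH] a F.
  move=> sF sH [|//] x _ Ux /=.
  by apply: differentiable_scale; [exact: (sF [::])|exact: (sH [::])].
move=> sa sF; have /smooth_uptoS[da sa'] := sa; have /smooth_uptoS[dF sF'] := sF.
apply/smooth_uptoS; split.
  by move=> x Ux; apply: differentiable_scale; [exact: da|exact: dF].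
move=> v; apply: (@smooth_upto_ext _ _ _ _ _
  (fun x => a x *: 'D_v F x + 'D_v a x *: F x)) => //.
  by move=> x Ux; rewrite derive_scale //; [exact: da|exact: dF].
apply: smooth_uptoD => //; apply: IH => //.
  exact: (smooth_upto_le (leqnSn n) sa).
exact: (smooth_upto_le (leqnSn n) sF).
Qed.

Lemma smooth_onZ U a F : open U -> smooth_on U a -> smooth_on U F ->
  smooth_on U (fun x => a x *: F x).
Proof.
by move=> oU /smooth_uptoP sF /smooth_uptoP sH; apply/smooth_uptoP => n; exact: smooth_uptoZ.
Qed.

End SmoothScale.

Section SmoothInverse.
Context {R : realType} {V : normedModType R}.
Implicit Types (U : set V) (a : V -> R).

(** The derivative of 1/a is - (1/a) (1/a) a', so order n + 1 of 1/a follows from order n of 1/a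
    itself. *)
Lemma smooth_onV U a : open U -> smooth_on U a -> (forall x, U x -> a x != 0) ->
  smooth_on U (fun x => (a x)^-1).
Proof.
move=> oU /smooth_uptoP sa a0; apply/smooth_uptoP => n.
have da x : U x -> differentiable a x by move=> Ux; exact: (sa 0%N [::]).
elim: n => [|n IH].
  by case=> // x _ Ux; apply: differentiableV; [exact: da|exact: a0].
apply/smooth_uptoS; split=> [x Ux|v].
  by apply: differentiableV; [exact: da|exact: a0].
apply: (@smooth_upto_ext _ _ _ _ _
  (fun x => - 1 *: ((a x)^-1 *: ((a x)^-1 *: 'D_v a x)))) => //.
  move=> x Ux; rewrite deriveV; [|exact: a0|exact/diff_derivable/da].
  by rewrite -exprVn scaleN1r scalerA -expr2 scaleNr.
apply: (@smooth_uptoZ _ _ _ n _ (fun=> -1)) => //.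
  exact: smooth_upto_cst.
apply: (@smooth_uptoZ _ _ _ n _ (fun x => (a x)^-1)) => //.
apply: (@smooth_uptoZ _ _ _ n _ (fun x => (a x)^-1)) => //.
by have /smooth_uptoS[_] := sa n.+1; apply.
Qed.

End SmoothInverse.

(** * Symmetry of second derivatives *)

Section Schwarz.
Context {R : realType} {V : normedModType R}.

Lemma is_derive_line (u c : V) (r : R) : is_derive r 1 (fun r : R => r *: u + c) u.
Proof.
have -> : (fun r : R => r *: u + c) = ( *:%R^~ u) + cst c by [].
rewrite -[X in is_derive _ _ _ X]addr0.
apply: is_deriveD.
apply: DeriveDef; first exact/derivable1_diffP.
by rewrite deriveE // diff_val scale1r.
Qed.

(* The second difference of F along v and w, divided by t^2, tends to both mixed derivatives. *)
Lemma second_difference (F : V -> R) U x v w : open U -> U x ->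
  (forall y, U y -> differentiable F y) -> differentiable ('D_v F) x ->
  (t^-1 * (t^-1 * (F (t *: v + t *: w + x) - F (t *: v + x)
     - F (t *: w + x) + F x))) @[t --> (0:R)^'+] --> 'D_w ('D_v F) x.
Proof.
move=> oU Ux dF dDF.
have dir c (r : R) : U (r *: v + c) ->
    is_derive r 1 (fun r => F (r *: v + c)) ('D_v F (r *: v + c)).
  move=> Ur; apply: (@is_derive_comp_curve _ _ _ F (fun r => r *: v + c)).
    exact: dF.
  exact: is_derive_line.
have [k k0 kL] := linear_lipschitz (diff_continuous dDF).
have [e0 e00 eU] : exists2 e : R, 0 < e & forall y, `|y| < e -> U (y + x).
  have := open_nbhs_nbhs (conj oU Ux).
  move=> /nbhs_ballP[e e0 xeU]; exists e => // y ye; apply: xeU.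
  by rewrite -ball_normE /= opprD addrCA subrr addr0 normrN.
apply/cvgrPdist_le => e e_gt0.
pose C := `|v| + `|w| + 1.
have C0 : 0 < C by rewrite /C ltr_wpDl // addr_ge0.
have := diff_locally dDF => /eqaddoP.
(* The linear approximation of ['D_v F] at x is used at two points of norm at most t C. With the
   constant e / (3 C) the two errors add up to at most (2/3) e t. *)
have C30 : 0 < e / (3 * C) by rewrite divr_gt0 // mulr_gt0.
move=> /(_ _ C30); rewrite near_simpl => /nbhs_ballP[d /= d0 dE].
have est y : `|y| < d -> `|'D_v F (y + x) - 'D_v F x - 'D_y ('D_v F) x| <= e / (3 * C) * `|y|.
  move=> yd; have := dE y; rewrite -ball_normE /= sub0r normrN => /(_ yd).
  rewrite -[X in `|X| <= _]/('D_v F (y + x) - ('D_v F x + 'd ('D_v F) x y)).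
  have -> : 'D_y ('D_v F) x = 'd ('D_v F) x y by rewrite deriveE.
  by rewrite opprD addrA.
near=> t.
have t0 : 0 < t by near: t; exact: nbhs_right_gt.
have tC : t * C < Num.min d e0.
  by rewrite -ltr_pdivlMr //; near: t; apply: nbhs_right_lt; rewrite divr_gt0 // lt_min d0 e00.
move: tC; rewrite lt_min => /andP[tCd tCe].
have bnd (r s : R) : 0 <= r <= t -> 0 <= s <= t -> `|r *: v + s *: w| <= t * C.
  move=> /andP[r0 rt] /andP[s0 st].
  rewrite (le_trans (ler_normD _ _)) // !normrZ !ger0_norm // /C !mulrDr mulr1.
  by rewrite -[leLHS]addr0 !lerD ?ler_wpM2r // ltW.
(* The second difference is f t - f 0, so the mean value theorem turns it into t times a first
   difference of ['D_v F]. *)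
pose f r := F (r *: v + (t *: w + x)) - F (r *: v + x).
pose f' r := 'D_v F (r *: v + (t *: w + x)) - 'D_v F (r *: v + x).
have inU (r s : R) : 0 <= r <= t -> 0 <= s <= t -> U (r *: v + (s *: w + x)).
  by move=> r0 s0; rewrite addrA; apply: eU; rewrite (le_lt_trans (bnd _ _ _ _)).
have inU0 (r : R) : 0 <= r <= t -> U (r *: v + x).
  by move=> r0; have := inU r 0 r0; rewrite scale0r add0r lexx ltW //; apply.
have tt : 0 <= t <= t by rewrite lexx ltW.
have der r : 0 <= r <= t -> is_derive r 1 f (f' r).
  by move=> r0; apply: is_deriveB; apply: dir; [exact: inU|exact: inU0].
have [||c cI] := @MVT _ f f' 0 t t0.
- by move=> r; rewrite in_itv /= => /andP[r0 rt]; apply: der; rewrite !ltW.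
- apply: derivable_within_continuous => r; rewrite in_itv /= => rt.
  by have [] := der r rt.
rewrite /f scale0r !add0r subr0 => Ef.
have {cI} c0 : 0 <= c <= t by move: cI; rewrite in_itv /= => /andP[? ?]; rewrite !ltW.
have -> : F (t *: v + t *: w + x) - F (t *: v + x) - F (t *: w + x) + F x = f' c * t.
  by rewrite -Ef -(addrA (t *: v)); ring.
rewrite (mulrC (f' c)) mulKf ?gt_eqF //.
have zt : (0 : R) <= 0 <= t by rewrite lexx ltW.
have e1 := est (c *: v + t *: w) (le_lt_trans (bnd _ _ c0 tt) tCd).
have e2 := est (c *: v) _.
have cvB : `|c *: v| <= t * C by have := bnd _ _ c0 zt; rewrite scale0r addr0.
have {}e2 := e2 (le_lt_trans cvB tCd).
have lin : 'D_(c *: v + t *: w) ('D_v F) x - 'D_(c *: v) ('D_v F) x = t * 'D_w ('D_v F) x.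
  rewrite derive_linear // !deriveE // !linearZ /= -!deriveE //.
  by rewrite addrAC scalerN subrr add0r.
have B : `|f' c - t * 'D_w ('D_v F) x| <= 2 * (e / (3 * C) * (t * C)).
  have -> : f' c - t * 'D_w ('D_v F) x =
    ('D_v F (c *: v + t *: w + x) - 'D_v F x - 'D_(c *: v + t *: w) ('D_v F) x) -
    ('D_v F (c *: v + x) - 'D_v F x - 'D_(c *: v) ('D_v F) x).
    rewrite -lin /f' addrA; set A1 := 'D_v F _; set A2 := 'D_v F _; set A3 := 'D_v F x.
    set A4 := 'D__ _ x; set A5 := 'D__ _ x; move: A1 A2 A3 A4 A5 => A1 A2 A3 A4 A5.
    by ring.
  rewrite (le_trans (ler_normB _ _)) // mulr_natl mulr2n lerD //.
    by rewrite (le_trans e1) // ler_wpM2l ?(ltW C30) // bnd.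
  by rewrite (le_trans e2) // ler_wpM2l ?(ltW C30).
have -> : 'D_w ('D_v F) x - t^-1 * f' c = - t^-1 * (f' c - t * 'D_w ('D_v F) x).
  move: (f' c) ('D_w _ x) => A1 A2.
  by field; rewrite gt_eqF.
have G (Z b : R) : `|Z| <= b -> `|- t^-1 * Z| <= t^-1 * b.
  by move=> zb; rewrite normrM normrN (@ger0_norm _ t^-1) ?invr_ge0 ?(ltW t0) // ler_wpM2l // invr_ge0 ltW.
apply: le_trans (G _ _ B) _.
have -> : t^-1 * (2 * (e / (3 * C) * (t * C))) = 2 / 3 * e by field; rewrite !gt_eqF.
by rewrite ger_pMl // ler_pdivrMr // mul1r ler_nat.
Unshelve. all: by end_near. Qed.

(** The second difference is symmetric in v and w, so both mixed derivatives are limits of the same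
    function. *)
Lemma schwarzR (F : V -> R) U x v w : open U -> U x -> smooth_on U F ->
  'D_w ('D_v F) x = 'D_v ('D_w F) x.
Proof.
move=> oU Ux sF.
have dF y : U y -> differentiable F y by exact: smooth_on_diff.
have dDF u : differentiable ('D_u F) x.
  by apply: (smooth_on_diff (U := U)) => //; exact: smooth_on_derive.
have A := second_difference (w := w) oU Ux dF (dDF v).
have B := second_difference (w := v) oU Ux dF (dDF w).
have E : (fun t : R => t^-1 * (t^-1 * (F (t *: w + t *: v + x) - F (t *: w + x)
     - F (t *: v + x) + F x))) = (fun t => t^-1 * (t^-1 *
     (F (t *: v + t *: w + x) - F (t *: v + x) - F (t *: w + x) + F x))).
  apply/funext => t; do 2 congr (_ * _); rewrite (addrC (t *: w) (t *: v)).
  by congr (_ + _); rewrite addrAC.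
move: B; rewrite E => B.
exact: (cvg_unique (@norm_hausdorff _ _) A B).
Qed.

End Schwarz.

(** * Linear vector fields on spaces of matrices *)

Section Fields.
Context {R : realType} {p q d : nat}.
Notation V := 'M[R]_(p, q).
Notation W := 'cV[R]_d.
Implicit Types (U : set V) (F H : V -> W).

Lemma differentiable_entry F x i : differentiable F x -> differentiable (fun y => F y i 0) x.
Proof.
move=> dF; apply: (@differentiable_comp _ _ _ _ F (fun w : W => w i 0)) => //.
exact: differentiable_coord.
Qed.

Lemma derive_entry F x v i : differentiable F x -> 'D_v F x i 0 = 'D_v (fun y => F y i 0) x.
Proof. by move=> dF; rewrite derive_mx ?mxE //; exact: diff_derivable. Qed.

Lemma smooth_on_entry U F i : open U -> smooth_on U F -> smooth_on U (fun y => F y i 0).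
Proof.
move=> oU /smooth_uptoP sF; apply/smooth_uptoP => n; move: {sF}(sF n).
elim: n F => [|n IH] F sF; first by case=> // x _ Ux; apply/differentiable_entry/(sF [::]).
have /smooth_uptoS[dF sF'] := sF.
apply/smooth_uptoS; split=> [x Ux|v]; first exact/differentiable_entry/dF.
apply: (@smooth_upto_ext _ _ _ _ _ (fun y => 'D_v F y i 0)) => //; last exact: IH.
by move=> x Ux; rewrite derive_entry //; exact: dF.
Qed.

Lemma schwarz F U x v w : open U -> U x -> smooth_on U F ->
  'D_w ('D_v F) x = 'D_v ('D_w F) x.
Proof.
move=> oU Ux sF.
have E u z : 'D_u ('D_z F) x = \col_i 'D_u ('D_z (fun y => F y i 0)) x.
  apply/colP => i; rewrite mxE derive_entry; last first.
    by apply: (smooth_on_diff (U := U)) => //; exact: smooth_on_derive.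
  apply: near_eq_derive; near=> y; apply: derive_entry.
  apply: (smooth_on_diff (U := U)) => //.
  by near: y; exact: open_nbhs_nbhs.
rewrite (E w v) (E v w); apply: eq_mx => i _.
exact: (@schwarzR _ _ (fun y => F y i 0) U x v w oU Ux (smooth_on_entry _ oU sF)).
Unshelve. all: by end_near. Qed.

Lemma differentiable_lin_entry (L : {linear V -> V}) i j x : continuous L ->
  differentiable (fun y => L y i j) x.
Proof.
move=> cL; apply: (@differentiable_comp _ _ _ _ L (fun w : V => w i j)).
  exact: linear_differentiable.
exact: differentiable_coord.
Qed.

Lemma derive_lin_entry (L : {linear V -> V}) i j x v : continuous L ->
  'D_v (fun y => L y i j) x = L v i j.
Proof.
move=> cL; have dL : differentiable L x by exact: linear_differentiable.
have := @derive_mx _ _ _ _ L x v (@diff_derivable _ _ _ _ _ v dL).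
by rewrite deriveE // diff_lin // => E; rewrite E mxE.
Qed.

Lemma smooth_on_lin_entry U (L : {linear V -> V}) i j : continuous L ->
  smooth_on U (fun y => L y i j).
Proof.
move=> cL; apply/smooth_uptoP => -[|n].
  by case=> // x _ _; exact: differentiable_lin_entry.
apply/smooth_uptoS; split=> [x _|v]; first exact: differentiable_lin_entry.
rewrite (_ : 'D_v _ = fun=> L v i j); first exact: smooth_upto_cst.
by apply/funext => x; exact: derive_lin_entry.
Qed.

(** F differentiated along the vector field x |-> L x. Right multiplication by X gives the
    left-invariant field of X, left multiplication the right-invariant one. *)
Definition dfield (L : V -> V) F : V -> W := fun x => 'D_(L x) F x.

Lemma derive_sum_delta F x v : differentiable F x ->
  'D_v F x = \sum_(ij : 'I_p * 'I_q) v ij.1 ij.2 *: 'D_(delta_mx ij.1 ij.2) F x.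
Proof.
move=> dF; rewrite deriveE // {1}[v]matrix_sum_delta linear_sum /=.
under eq_bigr do rewrite linear_sum /=.
rewrite pair_big /=; apply: eq_bigr => -[i j] _ /=.
by rewrite linearZ /= deriveE.
Qed.

Lemma smooth_dfield U (L : {linear V -> V}) F : continuous L -> open U ->
  smooth_on U F -> smooth_on U (dfield L F).
Proof.
move=> cL oU sF; apply/smooth_uptoP => n.
apply: (@smooth_upto_ext _ _ _ _ _ (fun x => \sum_(ij : 'I_p * 'I_q) L x ij.1 ij.2 *: 'D_(delta_mx ij.1 ij.2) F x)) => //.
  by move=> x Ux; rewrite /dfield (derive_sum_delta (L x)) //; exact: (smooth_on_diff sF).
move: n; apply/smooth_uptoP; apply: smooth_on_sum => // ij.
apply: smooth_onZ => //; last exact: smooth_on_derive.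
exact: smooth_on_lin_entry.
Qed.

(** In the basis [delta_mx] the field is a finite sum of products. The derivatives of the
    coefficients reassemble to ['D_(L v) F], the other terms, by Schwarz, to a mixed second
    derivative. *)
Lemma derive_dfield U (L : {linear V -> V}) F v x : continuous L -> open U -> U x ->
  smooth_on U F -> 'D_v (dfield L F) x = 'D_v ('D_(L x) F) x + 'D_(L v) F x.
Proof.
move=> cL oU Ux sF.
have dF : differentiable F x by exact: (smooth_on_diff sF).
have dDF u : differentiable ('D_u F) x by apply: (smooth_on_diff (U := U)) => //; exact: smooth_on_derive.
pose G (y : V) := \sum_(ij : 'I_p * 'I_q) L y ij.1 ij.2 *: 'D_(delta_mx ij.1 ij.2) F y.
have -> : 'D_v (dfield L F) x = 'D_v G x.
  apply: near_eq_derive; near=> y; rewrite /dfield (derive_sum_delta (L y)) //.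
  by apply: (smooth_on_diff sF); near: y; exact: open_nbhs_nbhs.
pose H (ij : 'I_p * 'I_q) (y : V) := L y ij.1 ij.2 *: 'D_(delta_mx ij.1 ij.2) F y.
have dH ij : differentiable (H ij) x.
  by apply: differentiable_scale => //; exact: differentiable_lin_entry.
have dH' ij : is_derive x v (H ij) (L x ij.1 ij.2 *: 'D_v ('D_(delta_mx ij.1 ij.2) F) x
    + L v ij.1 ij.2 *: 'D_(delta_mx ij.1 ij.2) F x).
  apply: DeriveDef; first exact: diff_derivable.
  rewrite derive_scale //; last exact: differentiable_lin_entry.
  by rewrite derive_lin_entry.
have -> : 'D_v G x = \sum_ij (L x ij.1 ij.2 *: 'D_v ('D_(delta_mx ij.1 ij.2) F) x
    + L v ij.1 ij.2 *: 'D_(delta_mx ij.1 ij.2) F x).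
  have -> : G = \sum_ij H ij by apply/funext => y; rewrite fct_sumE.
  have : is_derive x v (\sum_ij H ij) (\sum_ij (L x ij.1 ij.2 *: 'D_v ('D_(delta_mx ij.1 ij.2) F) x
    + L v ij.1 ij.2 *: 'D_(delta_mx ij.1 ij.2) F x)).
    elim/big_rec2: _ => [|ij y1 y2 _ IH]; first exact: is_derive_cst.
    exact: is_deriveD.
  by case.
rewrite big_split /= -(derive_sum_delta (L v)) //; congr (_ + _).
have S1 u : 'D_v ('D_u F) x = 'D_u ('D_v F) x by exact: (schwarz _ _ oU Ux sF).
rewrite (S1 (L x)) (derive_sum_delta (L x) (dDF v)); apply: eq_bigr => ij _.
by rewrite S1.
Unshelve. all: by end_near. Qed.

(** Second-order terms agree by Schwarz, first-order terms because L and M commute. The case of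
    interest is left against right multiplication. *)
Lemma dfield_comm U (L M : {linear V -> V}) F x : continuous L -> continuous M ->
  (forall y, L (M y) = M (L y)) -> open U -> U x -> smooth_on U F ->
  dfield L (dfield M F) x = dfield M (dfield L F) x.
Proof.
move=> cL cM LM oU Ux sF; 
have S1 := derive_dfield (L x) cM oU Ux sF.
have S2 := derive_dfield (M x) cL oU Ux sF.
have E1 : 'D_(L x) ('D_(M x) F) x = 'D_(M x) ('D_(L x) F) x by exact: (schwarz _ _ oU Ux sF).
have E2 : 'D_(M (L x)) F x = 'D_(L (M x)) F x by rewrite LM.
exact: (etrans S1 (etrans (f_equal2 +%R E1 E2) (esym S2))).
Qed.

End Fields.

(** * Continuity of linear maps, and the matrix exponential *)

Section Linear.
Context {R : realType}.

Lemma mx_linear_continuous {p q : nat} {W : normedModType R} (L : {linear 'M[R]_(p, q) -> W}) :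
  continuous L.
Proof.
have -> : L = (fun x => \sum_(ij : 'I_p * 'I_q) x ij.1 ij.2 *: L (delta_mx ij.1 ij.2)) :> (_ -> _).
  apply/funext => x; rewrite {1}[x]matrix_sum_delta linear_sum /=.
  under eq_bigr do rewrite linear_sum /=.
  by rewrite pair_big /=; apply: eq_bigr => -[i j] _ /=; rewrite linearZ.
apply: continuous_big => [|ij _ x]; first exact: add_continuous.
apply: (@cvgZr_tmp _ _ _ (nbhs x) _ (fun y : 'M[R]_(p, q) => y ij.1 ij.2)).
exact: coord_continuous.
Qed.

Lemma mulmxr_continuous p q r (h : 'M[R]_(q, r)) : continuous (mulmxr h : 'M[R]_(p, q) -> 'M[R]_(p, r)).
Proof. exact: mx_linear_continuous. Qed.

End Linear.

(* This joins the completeness of the uniform structure to the normed module,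
   which normed_cvg needs. *)
HB.instance Definition _ (R : realType) m n := NormedModule.on 'M[R]_(m.+1, n.+1).

Section Mexp.
Context {R : realType} {n : nat}.
Implicit Types X : 'M[R]_n.+1.

Lemma mx_norm_entry p q (A : 'M[R]_(p, q)) i j : `|A i j| <= `|A|.
Proof. by rewrite [leRHS]/Num.Def.normr /= mx_normrE; exact: (le_bigmax _ _ (i, j)). Qed.

Lemma mx_norm_le p q (A : 'M[R]_(p, q)) (c : R) : 0 <= c -> (forall i j, `|A i j| <= c) -> `|A| <= c.
Proof.
move=> c0 Ac; rewrite [leLHS]/Num.Def.normr /= mx_normrE.
by apply: bigmax_le => // -[i j] _; exact: Ac.
Qed.

Lemma mx_normM p q r (A : 'M[R]_(p, q)) (B : 'M[R]_(q, r)) : `|A *m B| <= q%:R * `|A| * `|B|.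
Proof.
apply: mx_norm_le => [|i j]; first by rewrite !mulr_ge0.
rewrite mxE (le_trans (ler_norm_sum _ _ _)) //.
apply: (@le_trans _ _ (\sum_(k < q) `|A| * `|B|)).
  by apply: ler_sum => k _; rewrite normrM ler_pM // mx_norm_entry.
by rewrite sumr_const card_ord -mulrA mulr_natl.
Qed.

Lemma mx_normX X k : `|X ^+ k| <= (n.+1%:R * `|X| + 1) ^+ k.
Proof.
elim: k => [|k IH].
  rewrite !expr0; apply: mx_norm_le => // i j; rewrite mxE.
  by case: (i == j); rewrite ?normr1 ?normr0.
rewrite exprSr exprS (le_trans (mx_normM _ _)) // mulrAC.
by apply: ler_pM; rewrite ?mulr_ge0 // lerDl.
Qed.

Definition mexp_coeff X := fun k : nat => k`!%:R^-1 *: X ^+ k.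

Lemma mexp_coeff_le X k : `|mexp_coeff X k| <= exp_coeff (n.+1%:R * `|X| + 1) k.
Proof.
rewrite normrZ ger0_norm ?invr_ge0 // /exp_coeff /= mulrC.
by rewrite ler_wpM2r ?invr_ge0 // mx_normX.
Qed.

Lemma is_cvg_mexp X : cvgn (series (mexp_coeff X)).
Proof.
apply: normed_cvg; apply: (@series_le_cvg _ _ (exp_coeff (n.+1%:R * `|X| + 1))).
- by move=> k; exact: normr_ge0.
- by move=> k; apply: exp_coeff_ge0; rewrite addr_ge0 // mulr_ge0.
- exact: mexp_coeff_le.
- exact: is_cvg_series_exp_coeff.
Qed.

Lemma mexpE X : mexp X = limn (series (mexp_coeff X)). Proof. by []. Qed.

Lemma mexp_eigen X (v : 'cV[R]_n.+1) c : X *m v = c *: v -> mexp X *m v = expR c *: v.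
Proof.
move=> Xv.
have Xk k : X ^+ k *m v = c ^+ k *: v.
  elim: k => [|k IH]; first by rewrite !expr0 mul1mx scale1r.
  by rewrite exprS -mulmxA IH -scalemxAr Xv scalerA -exprSr.
have A : (mulmxr v \o series (mexp_coeff X)) @ \oo --> mexp X *m v.
  have cX : series (mexp_coeff X) @ \oo --> mexp X by exact: is_cvg_mexp.
  apply: (@cvg_comp _ _ _ _ (mulmxr v) _ (nbhs (mexp X))) => //.
  exact: mulmxr_continuous.
have B : (fun k => series (exp_coeff c) k *: v) @ \oo --> expR c *: v.
  by apply: cvgZr_tmp; exact: is_cvg_series_exp_coeff.
apply: (cvg_unique (@norm_hausdorff _ _) A).
suff -> : mulmxr v \o series (mexp_coeff X) = (fun k => series (exp_coeff c) k *: v) by [].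
apply/funext => k /=; rewrite /series /= mulmx_suml scaler_suml.
by apply: eq_bigr => i _; rewrite -scalemxAl Xk scalerA /exp_coeff /= mulrC.
Qed.

Lemma mexp_nilp3 X : X ^+ 3 = 0 -> mexp X = 1%:M + X + 2^-1 *: (X *m X).
Proof.
move=> X3; rewrite mexpE; apply: lim_near_cst => //.
near=> k; have k3 : (3 <= k)%N by near: k; exact: nbhs_infty_ge.
have X3k i : X ^+ (3 + i) = 0 by rewrite exprD X3 mul0r.
rewrite /series /= (@big_cat_nat _ _ _ 3) //=.
have -> : \sum_(3 <= i < k) mexp_coeff X i = 0.
  rewrite big_nat_cond big1 // => i /andP[/andP[i3 _] _].
  by rewrite /mexp_coeff -(subnKC i3) X3k scaler0.
rewrite addr0 !big_nat_recr //= big_geq // add0r /mexp_coeff !factS fact0 !muln1 invr1 !scale1r.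
by rewrite expr0 expr1 expr2.
Unshelve. all: by end_near. Qed.

Lemma mexp0 : mexp (0 : 'M[R]_n.+1) = 1%:M.
Proof. by rewrite mexp_nilp3 ?mulmx0 ?scaler0 ?addr0 // expr0n. Qed.

(** Every term of order at least 2 contains t^2, and what is left is dominated by the exponential
    series of c. This quadratic remainder gives the derivative of the exponential at 0. *)
Lemma mexp_sub_le X (t : R) : `|t| <= 1 ->
  `|mexp (t *: X) - 1%:M - t *: X| <= t ^+ 2 * expR (n.+1%:R * `|X| + 1).
Proof.
move=> t1; set c := _ + 1.
have c0 : 0 <= c by rewrite addr_ge0 // mulr_ge0.
have A : (fun k => series (mexp_coeff (t *: X)) k - 1%:M - t *: X) @ \oo --> mexp (t *: X) - 1%:M - t *: X.
  by apply: cvgB; [apply: cvgB; [exact: is_cvg_mexp|exact: cvg_cst]|exact: cvg_cst].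
apply: (@closed_cvg _ _ \oo _ (fun k => `|series (mexp_coeff (t *: X)) k - 1%:M - t *: X|)
  [set x : R | x <= t ^+ 2 * expR c]) => /=; [exact: closed_le| |exact: cvg_norm].
near=> k => /=; have k2 : (2 <= k)%N by near: k; exact: nbhs_infty_ge.
have -> : series (mexp_coeff (t *: X)) k - 1%:M - t *: X = \sum_(2 <= i < k) mexp_coeff (t *: X) i.
  rewrite /series /= big_ltn ?(ltnW k2) // big_ltn //.
  rewrite /mexp_coeff /= !fact0 factS fact0 muln1 invr1 !scale1r expr0 expr1.
  set S := \sum_(_ <= _ < _) _; rewrite -[1%:M]/(1 : 'M[R]_n.+1).
  by rewrite [X in X - _ - _]addrC addrK addrC addKr.
rewrite (le_trans (ler_norm_sum _ _ _)) //.
apply: (@le_trans _ _ (\sum_(2 <= i < k) t ^+ 2 * exp_coeff c i)).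
  apply: ler_sum_nat => i /andP[i2 _].
  have -> : mexp_coeff (t *: X) i = t ^+ i *: mexp_coeff X i.
    by rewrite /mexp_coeff exprZn !scalerA mulrC.
  rewrite normrZ normrX ler_pM ?exprn_ge0 // ?mexp_coeff_le //.
  by rewrite -(subnKC i2) exprD -[leRHS]real_normK ?num_real // ler_piMr ?exprn_ge0 // exprn_ile1.
rewrite -mulr_sumr ler_wpM2l ?sqr_ge0 //.
apply: (@le_trans _ _ (series (exp_coeff c) k)).
  rewrite /series /= [leRHS]big_ltn ?(ltnW k2) // [X in _ + X]big_ltn // addrA lerDr.
  by rewrite addr_ge0 // exp_coeff_ge0.
apply: nondecreasing_cvgn_le; last exact: is_cvg_series_exp_coeff.
by apply: nondecreasing_series => i _ _; exact: exp_coeff_ge0.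
Unshelve. all: by end_near. Qed.

Lemma is_derive_mexp0 X : is_derive (0 : R) 1 (fun t => mexp (t *: X)) X.
Proof.
have A : (fun h : R => h^-1 *: (((fun t => mexp (t *: X)) \o shift 0) (h *: (1 : R)) - mexp ((0 : R) *: X)))
    @ 0^' --> X.
  apply/cvgrPdist_le => e e0; near=> t.
  rewrite /= [t%:A]mulr1 addr0 scale0r mexp0.
  have t0 : t != 0 by near: t; exact: nbhs_dnbhs_neq.
  have -> : X - t^-1 *: (mexp (t *: X) - 1%:M) = - t^-1 *: (mexp (t *: X) - 1%:M - t *: X).
    by rewrite [in RHS]scalerBr !scaleNr opprK scalerA mulVf // scale1r addrC.
  have t1 : `|t| <= 1 by near: t; apply: dnbhs0_le.
  rewrite normrZ normrN normfV ler_pdivrMl ?normr_gt0 //.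
  rewrite (le_trans (mexp_sub_le X t1)) // -real_normK ?num_real // expr2 -mulrA ler_wpM2l //.
  rewrite -ler_pdivlMr ?expR_gt0 //; near: t; apply: dnbhs0_le.
  by rewrite divr_gt0 // expR_gt0.
by apply: DeriveDef; [apply/cvg_ex; exists X|apply: cvg_lim].
Unshelve. all: by end_near. Qed.

End Mexp.

(** * Curves of complex matrices, and mean value bounds *)

Section ComplexCurves.
Context {R : realType}.

Lemma is_derive_linear {p q : nat} {W : normedModType R}
    (L : {linear 'M[R]_(p, q) -> W}) (c : R -> 'M[R]_(p, q)) (t : R) v :
  is_derive t 1 c v -> is_derive t 1 (L \o c) (L v).
Proof.
move=> dc; have cL : continuous L by exact: mx_linear_continuous.
have dL : differentiable L (c t) by exact: linear_differentiable.
have <- : 'D_v L (c t) = L v by rewrite deriveE // diff_lin.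
exact: is_derive_comp_curve.
Qed.

Lemma is_derive_mulmx {p q r : nat} (A : R -> 'M[R]_(p, q)) (B : R -> 'M[R]_(q, r)) (t : R) A' B' :
  is_derive t 1 A A' -> is_derive t 1 B B' ->
  is_derive t 1 (fun s => A s *m B s) (A' *m B t + A t *m B').
Proof.
move=> [dA EA] [dB EB].
have dAe i j : derivable (fun s => A s i j) t 1 by apply: (derivable_mxP _ _ _).1.
have dBe i j : derivable (fun s => B s i j) t 1 by apply: (derivable_mxP _ _ _).1.
have EAe i j : 'D_1 (fun s => A s i j) t = A' i j by rewrite -EA derive_mx // mxE.
have EBe i j : 'D_1 (fun s => B s i j) t = B' i j by rewrite -EB derive_mx // mxE.
have H i j : is_derive t 1 (fun s => (A s *m B s) i j) ((A' *m B t + A t *m B') i j).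
  have -> : (fun s => (A s *m B s) i j) = \sum_k (fun s => A s i k * B s k j).
    by apply/funext => s; rewrite mxE fct_sumE.
  rewrite !mxE -big_split /=; elim/big_rec2: _ => [|k y1 y2 _ IH]; first exact: is_derive_cst.
  apply: is_deriveD.
  apply: DeriveDef; first exact: derivableM.
  rewrite deriveM // EAe EBe /= addrC; congr (_ + _).
  by rewrite /GRing.scale /= mulrC.
have dAB : derivable (fun s => A s *m B s) t 1 by apply/derivable_mxP => i j; case: (H i j).
by apply: DeriveDef => //; rewrite derive_mx //; apply/matrixP => i j; rewrite mxE; case: (H i j).
Qed.

Lemma part_mulmx b p q r (A : 'M[R[i]]_(p, q)) (B : 'M[R[i]]_(q, r)) :
  part b (A *m B) = part false A *m part b B +
    (if b then 1 else -1) *: (part true A *m part (~~ b) B).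
Proof.
apply/matrixP => i j; rewrite !mxE mulr_sumr -big_split /=.
transitivity (\sum_k (if b then complex.Im (A i k * B k j) else complex.Re (A i k * B k j))).
  by case: b; elim/big_rec2: _ => //= k y1 y2 _ <-; case: (_ * _); case: y2.
apply: eq_bigr => k _; rewrite !mxE; case: (A i k) => ar ai; case: (B k j) => br bi.
by case: b => /=; ring.
Qed.

Definition cplx {m n} (A B : 'M[R]_(m, n)) : 'M[R[i]]_(m, n) :=
  \matrix_(i, j) (A i j +i* B i j)%C.

Lemma part_cplx b m n (A B : 'M[R]_(m, n)) : part b (cplx A B) = if b then B else A.
Proof. by apply/matrixP => i j; rewrite !mxE; case: b. Qed.

Lemma part_inj m n (A B : 'M[R[i]]_(m, n)) : (forall b, part b A = part b B) -> A = B.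
Proof.
move=> E; apply/matrixP => i j; move: (E false) (E true) => /matrixP /(_ i j) + /matrixP /(_ i j).
by rewrite !mxE; case: (A i j) (B i j) => [a1 a2] [b1 b2] /= -> ->.
Qed.

Lemma part0 b m n : part b (0 : 'M[R[i]]_(m, n)) = 0.
Proof. by apply/matrixP => i j; rewrite !mxE; case: b. Qed.

Lemma partD b m n (A B : 'M[R[i]]_(m, n)) : part b (A + B) = part b A + part b B.
Proof. by apply/matrixP => i j; rewrite !mxE; case: b; case: (A i j); case: (B i j). Qed.

Lemma partB b m n (A B : 'M[R[i]]_(m, n)) : part b (A - B) = part b A - part b B.
Proof. by apply/matrixP => i j; rewrite !mxE; case: b; case: (A i j); case: (B i j). Qed.

Lemma partZ b m n (r : R) (A : 'M[R[i]]_(m, n)) : part b (r%:C%C *: A) = r *: part b A.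
Proof.
apply/matrixP => i j; rewrite !mxE; case: b; case: (A i j) => a1 a2 /=.
  by rewrite mul0r addr0.
by rewrite mul0r subr0.
Qed.

Lemma cvg_mx_entries {T : Type} (F : set_system T) {FF : Filter F} p q
    (A : T -> 'M[R]_(p, q)) (a : 'M[R]_(p, q)) :
  (forall i j, (fun x => A x i j) @ F --> a i j) -> A @ F --> a.
Proof.
move=> H; apply/cvgrPdist_le => e e0.
have : \forall x \near F, forall ij : 'I_p * 'I_q, `|a ij.1 ij.2 - A x ij.1 ij.2| <= e.
  by apply: filter_forall => -[i j] /=; move: e e0; apply/cvgrPdist_le; exact: H.
by apply: filterS => x Hx; apply: mx_norm_le => [|i j]; [exact: ltW|rewrite !mxE; exact: (Hx (i, j))].
Qed.

Lemma cvg_mulmx {T : Type} (F : set_system T) {FF : Filter F} p q r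
    (A : T -> 'M[R]_(p, q)) (B : T -> 'M[R]_(q, r)) (a : 'M[R]_(p, q)) (b : 'M[R]_(q, r)) :
  A @ F --> a -> B @ F --> b -> (fun x => A x *m B x) @ F --> a *m b.
Proof.
move=> Aa Bb; apply: cvg_mx_entries => i j; rewrite mxE.
rewrite (_ : (fun x => _) = fun x => \sum_k A x i k * B x k j); last by apply/funext => x; rewrite mxE.
apply: cvg_big => [|k _]; first exact: add_continuous.
apply: cvgM.
  have cc : (fun M : 'M[R]_(p, q) => M i k) @ a --> a i k by exact: coord_continuous.
  exact: (cvg_comp A (fun M => M i k) Aa cc).
have cc : (fun M : 'M[R]_(q, r) => M k j) @ b --> b k j by exact: coord_continuous.
exact: (cvg_comp B (fun M => M k j) Bb cc).
Qed.

(** The slope w is free, so that the error is the oscillation of f' about w, which can be bounded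
    uniformly in parameters. With w = e = 0 it says that f is constant. *)
Lemma mean_value_bound (f f' : R -> R) (s w e : R) :
  (forall x : R, `|x| <= `|s| -> is_derive x 1 f (f' x)) ->
  (forall x : R, `|x| <= `|s| -> `|f' x - w| <= e) -> `|f s - f 0 - s * w| <= e * `|s|.
Proof.
move=> df H; have [s0|s0|<-] := ltgtP 0 s; last first.
- by rewrite subrr mul0r subr0 !normr0 mulr0.
- have ins x : x \in `[s, 0] -> `|x| <= `|s|.
    by rewrite in_itv /= => /andP[sx x0]; rewrite !ler0_norm ?(ltW s0) // lerN2.
  have [||x xI E] := @MVT _ f f' s 0 s0.
  + by move=> x xI; apply/df/ins; rewrite in_itv /= !ltW ?(itvP xI).
  + by apply: derivable_within_continuous => x /ins /df [].
  have {}xI : `|x| <= `|s| by apply: ins; rewrite in_itv /= !ltW ?(itvP xI).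
  have -> : f s - f 0 - s * w = (f' x - w) * s.
    by rewrite -(opprB (f 0)) E; ring.
  by rewrite normrM ler_wpM2r // H.
- have ins x : x \in `[0, s] -> `|x| <= `|s|.
    by rewrite in_itv /= => /andP[x0 xs]; rewrite !ger0_norm ?(ltW s0).
  have [||x xI E] := @MVT _ f f' 0 s s0.
  + by move=> x xI; apply/df/ins; rewrite in_itv /= !ltW ?(itvP xI).
  + by apply: derivable_within_continuous => x /ins /df [].
  have {}xI : `|x| <= `|s| by apply: ins; rewrite in_itv /= !ltW ?(itvP xI).
  have -> : f s - f 0 - s * w = (f' x - w) * s by rewrite E; ring.
  by rewrite normrM ler_wpM2r // H.
Qed.

Lemma mean_value_bound_mx p q (f f' : R -> 'M[R]_(p, q)) (s e : R) (w : 'M[R]_(p, q)) : 0 <= e ->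
  (forall x : R, `|x| <= `|s| -> is_derive x 1 f (f' x)) ->
  (forall x : R, `|x| <= `|s| -> `|f' x - w| <= e) -> `|f s - f 0 - s *: w| <= e * `|s|.
Proof.
move=> e0 df H; apply: mx_norm_le => [|i j]; first by rewrite mulr_ge0.
rewrite !mxE; apply: (@mean_value_bound (fun x => f x i j) (fun x => f' x i j)) => x /[dup] xs.
  move=> /df [dfx <-]; apply: DeriveDef; first exact: ((derivable_mxP _ _ _).1 dfx).
  by rewrite derive_mx // mxE.
move=> /H; apply: le_trans; have := mx_norm_entry (f' x - w) i j.
by rewrite !mxE.
Qed.

Definition is_cderive {m n} (c : R -> 'M[R[i]]_(m, n)) (t : R) D :=
  forall b, is_derive t 1 (part b \o c) (part b D).

Lemma is_cderive_unique m n (c : R -> 'M[R[i]]_(m, n)) t D D' :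
  is_cderive c t D -> is_cderive c t D' -> D = D'.
Proof. by move=> cD cD'; apply: part_inj => b; have [_ <-] := cD b; have [_ ->] := cD' b. Qed.

Lemma is_cderive_mulmx p q r (A : R -> 'M[R[i]]_(p, q)) (B : R -> 'M[R[i]]_(q, r)) t A' B' :
  is_cderive A t A' -> is_cderive B t B' ->
  is_cderive (fun s => A s *m B s) t (A' *m B t + A t *m B').
Proof.
move=> dA dB b.
have -> : part b \o (fun s => A s *m B s) = (fun s => part false (A s) *m part b (B s)) +
    (if b then 1 else -1) *: (fun s => part true (A s) *m part (~~ b) (B s)).
  by apply/funext => s /=; rewrite part_mulmx.
rewrite partD !part_mulmx addrACA -scalerDr.
apply: is_deriveD; first exact: (is_derive_mulmx (dA false) (dB b)).
by apply: is_deriveZ; exact: (is_derive_mulmx (dA true) (dB (~~ b))).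
Qed.

Lemma is_cderive_cst m n (A : 'M[R[i]]_(m, n)) t : is_cderive (fun=> A) t 0.
Proof. by move=> b; rewrite part0; exact: is_derive_cst. Qed.

Lemma is_cderive_mull p q r (C : 'M[R[i]]_(p, q)) (B : R -> 'M[R[i]]_(q, r)) t B' :
  is_cderive B t B' -> is_cderive (fun s => C *m B s) t (C *m B').
Proof.
move=> dB; have := is_cderive_mulmx (is_cderive_cst C t) dB.
by rewrite mul0mx add0r.
Qed.

Lemma is_cderive_mulr p q r (C : 'M[R[i]]_(q, r)) (B : R -> 'M[R[i]]_(p, q)) t B' :
  is_cderive B t B' -> is_cderive (fun s => B s *m C) t (B' *m C).
Proof.
move=> dB; have := is_cderive_mulmx dB (is_cderive_cst C t).
by rewrite mulmx0 addr0.
Qed.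

Lemma is_cderiveD m n (A B : R -> 'M[R[i]]_(m, n)) t A' B' :
  is_cderive A t A' -> is_cderive B t B' ->
  is_cderive (fun s => A s + B s) t (A' + B').
Proof.
move=> dA dB b; rewrite partD.
have -> : part b \o (fun s => A s + B s) = (part b \o A) + (part b \o B).
  by apply/funext => s /=; rewrite partD.
exact: is_deriveD.
Qed.

Lemma is_cderive_comp m n (A : R -> 'M[R[i]]_(m, n)) (a : R -> R) (t a' : R) A' :
  is_derive t 1 a a' -> is_cderive A (a t) A' ->
  is_cderive (A \o a) t (a'%:C%C *: A').
Proof.
move=> da dA b; rewrite partZ.
have [dAb EA] := dA b.
have dif : differentiable (part b \o A) (a t) by apply/derivable1_diffP.
have -> : a' *: part b A' = 'D_a' (part b \o A) (a t).
  rewrite -EA !deriveE // -{2}[a']mulr1 -[a' * 1]/(a' *: (1 : R)) linearZ //.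
exact: (is_derive_comp_curve dif da).
Qed.

End ComplexCurves.

(** * Left-invariant and right-invariant derivatives on a matrix group *)

Section Group.
Context {R : realType} (K : set 'M[R]_5) (gK : matrix_group K).

Lemma matrix_groupV h : K h -> K (invmx h).
Proof. by case: gK => K1 _ Kd Kh; rewrite -[invmx h]mulmx1; exact: Kd. Qed.

Lemma matrix_groupM h g : K h -> K g -> K (h *m g).
Proof. by case: gK => _ _ Kd Kh Kg; rewrite -[h]invmxK; apply: Kd => //; exact: matrix_groupV. Qed.

Lemma matrix_group_unit h : K h -> h \in unitmx.
Proof. by case: gK => _ + _; apply. Qed.

Lemma matrix_groupMl h g : K h -> K (h *m g) <-> K g.
Proof.
move=> Kh; split=> [Kg|]; last exact: matrix_groupM.
by rewrite -(mulKmx (matrix_group_unit Kh) g); apply: matrix_groupM => //; exact: matrix_groupV.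
Qed.

Context {d : nat}.
Implicit Types (u : 'M[R]_5 -> 'cV[R]_d) (X : 'M[R]_5).

Definition smooth_real u := forall g, K g -> exists U (F : 'M[R]_5 -> 'cV[R]_d),
  [/\ open U, U g, smooth_on U F & forall x, U x -> K x -> u x = F x].

Lemma lie_derive_local X u U F g : lie K X -> open U -> U g -> K g -> smooth_on U F ->
  (forall x, U x -> K x -> u x = F x) ->
  is_derive (0 : R) 1 (fun t : R => u (g *m mexp (t *: X))) (dfield (mulmxr X) F g).
Proof.
move=> lX oU Ug Kg sF uF.
have dc : is_derive (0 : R) 1 (fun t : R => g *m mexp (t *: X)) (g *m X).
  exact: (is_derive_linear (mulmx g) (is_derive_mexp0 X)).
have g0 : g *m mexp ((0 : R) *: X) = g by rewrite scale0r mexp0 mulmx1.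
have dF : differentiable F (g *m mexp ((0 : R) *: X)) by rewrite g0; exact: (smooth_on_diff sF).
have dct : differentiable (fun t : R => g *m mexp (t *: X)) 0.
  by apply/derivable1_diffP; case: dc.
have := is_derive_comp_curve dF dc; rewrite g0.
apply: near_eq_is_derive; near=> t; apply/esym/uF.
  near: t; apply: (differentiable_continuous dct).
  by rewrite g0; exact: open_nbhs_nbhs.
by apply: matrix_groupM => //; exact: lX.
Unshelve. all: by end_near. Qed.

Lemma lie_deriveE X u U F g : lie K X -> open U -> U g -> K g -> smooth_on U F ->
  (forall x, U x -> K x -> u x = F x) -> lie_derive X u g = dfield (mulmxr X) F g.
Proof. by move=> lX oU Ug Kg sF uF; have [] := lie_derive_local lX oU Ug Kg sF uF. Qed.

Lemma is_derive_lie X u g : lie K X -> smooth_real u -> K g ->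
  is_derive (0 : R) 1 (fun t : R => u (g *m mexp (t *: X))) (lie_derive X u g).
Proof.
move=> lX su Kg; have [U [F [oU Ug sF uF]]] := su g Kg.
by have D := lie_derive_local lX oU Ug Kg sF uF; apply: DeriveDef; case: D.
Qed.

Lemma smooth_lie_derive X u : lie K X -> smooth_real u -> smooth_real (lie_derive X u).
Proof.
move=> lX su g Kg; have [U [F [oU Ug sF uF]]] := su g Kg.
exists U, (dfield (mulmxr X) F); split => //.
  by apply: smooth_dfield => //; exact: mx_linear_continuous.
by move=> x Ux Kx; exact: lie_deriveE uF.
Qed.

Lemma lie_derive_ext X u v g : lie K X -> K g -> (forall x, K x -> u x = v x) ->
  lie_derive X u g = lie_derive X v g.
Proof.
move=> lX Kg uv; rewrite /lie_derive; congr ('D_1 _ (0 : R)); apply/funext => t.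
by apply: uv; apply: matrix_groupM => //; exact: lX.
Qed.

Definition one_param X (c : R -> 'M[R]_5) :=
  [/\ c 0 = 1%:M, forall s, K (c s) & forall s : R, is_derive s 1 c (X *m c s)].

(* The derivative of left translation along c: a right-invariant vector field,
   which thus commutes with lie_derive. *)
Definition left_derive (c : R -> 'M[R]_5) u : 'M[R]_5 -> 'cV[R]_d :=
  fun g => 'D_1 (fun s : R => u (c s *m g)) 0.

Context {X : 'M[R]_5} {c : R -> 'M[R]_5} (oc : one_param X c).

Lemma left_derive_local u U F g (s : R) : open U -> U (c s *m g) -> K g -> smooth_on U F ->
  (forall x, U x -> K x -> u x = F x) ->
  is_derive s 1 (fun s : R => u (c s *m g)) (dfield (mulmx X) F (c s *m g)).
Proof.
case: oc => c0 Kc dc oU Ug Kg sF uF.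
have dcg : is_derive s 1 (fun s : R => c s *m g) (X *m (c s *m g)).
  by rewrite mulmxA; exact: (is_derive_linear (mulmxr g) (dc s)).
have dF : differentiable F (c s *m g) by exact: (smooth_on_diff sF).
have dct : differentiable (fun t : R => c t *m g) s.
  by apply/derivable1_diffP; case: dcg.
have := is_derive_comp_curve dF dcg.
apply: near_eq_is_derive; near=> t; apply/esym/uF.
  near: t; apply: (differentiable_continuous dct).
  exact: open_nbhs_nbhs.
by apply: matrix_groupM.
Unshelve. all: by end_near. Qed.

Lemma left_deriveE u U F g : open U -> U g -> K g -> smooth_on U F ->
  (forall x, U x -> K x -> u x = F x) -> left_derive c u g = dfield (mulmx X) F g.
Proof.
move=> oU Ug Kg sF uF; have E : c 0 *m g = g by case: oc => -> _ _; rewrite mul1mx.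
have := @left_derive_local u U F g 0 oU; rewrite E => /(_ Ug Kg sF uF).
by case.
Qed.

Lemma is_derive_left u g : smooth_real u -> K g ->
  is_derive (0 : R) 1 (fun s : R => u (c s *m g)) (left_derive c u g).
Proof.
move=> su Kg; have [U [F [oU Ug sF uF]]] := su g Kg.
have E : c 0 *m g = g by case: oc => -> _ _; rewrite mul1mx.
have D := @left_derive_local u U F g 0 oU; rewrite E in D.
have {}D := D Ug Kg sF uF.
by apply: DeriveDef; case: D.
Qed.

Lemma smooth_left_derive u : smooth_real u -> smooth_real (left_derive c u).
Proof.
move=> su g Kg; have [U [F [oU Ug sF uF]]] := su g Kg.
exists U, (dfield (mulmx X) F); split => //.
  by apply: smooth_dfield => //; exact: mx_linear_continuous.
by move=> x Ux Kx; exact: left_deriveE uF.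
Qed.

Lemma lie_left_comm Y u g : lie K Y -> smooth_real u -> K g ->
  lie_derive Y (left_derive c u) g = left_derive c (lie_derive Y u) g.
Proof.
move=> lY su Kg; have [U [F [oU Ug sF uF]]] := su g Kg.
pose LX : {linear 'M[R]_5 -> 'M[R]_5} := mulmx X.
pose LY : {linear 'M[R]_5 -> 'M[R]_5} := mulmxr Y.
have cX : continuous LX by exact: mx_linear_continuous.
have cY : continuous LY by exact: mx_linear_continuous.
have lu x : U x -> K x -> left_derive c u x = dfield LX F x.
  by move=> Ux Kx; exact: (left_deriveE oU Ux Kx sF uF).
have ru x : U x -> K x -> lie_derive Y u x = dfield LY F x.
  by move=> Ux Kx; exact: (lie_deriveE lY oU Ux Kx sF uF).
have sX : smooth_on U (dfield LX F) by exact: smooth_dfield.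
have sY : smooth_on U (dfield LY F) by exact: smooth_dfield.
rewrite (lie_deriveE lY oU Ug Kg sX lu) (left_deriveE oU Ug Kg sY ru).
have LL y : LY (LX y) = LX (LY y) by rewrite /= mulmxA.
exact: (dfield_comm cY cX LL oU Ug sF).
Qed.

(** Uniformity in g near g0 is what convergence on compact sets requires. In a ball where [psi]
    stays within e / 2 of [psi g0], its oscillation is at most e, and the mean value bound applies
    along s |-> c s g. *)
Lemma left_quotient_near u g0 (e : R) : smooth_real u -> K g0 -> 0 < e ->
  \forall g \near g0 & s \near (0 : R)^', K g ->
    `|s^-1 *: (u (c s *m g) - u g) - left_derive c u g| <= e.
Proof.
move=> su Kg0 e0; have [U [F [oU Ug sF uF]]] := su g0 Kg0.
have E (g : 'M[R]_5) : c 0 *m g = g by case: oc => -> _ _; rewrite mul1mx.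
have cX : continuous (mulmx X : 'M[R]_5 -> _) by exact: mx_linear_continuous.
pose psi := dfield (mulmx X) F.
have spsi : smooth_on U psi by exact: smooth_dfield.
have cpsi : {for g0, continuous psi} by apply/differentiable_continuous/(smooth_on_diff spsi).
have [e1 e10 eU] : exists2 e1 : R, 0 < e1 & forall y, ball g0 e1 y -> U y /\ `|psi y - psi g0| <= e / 2.
  have : \forall y \near g0, U y /\ `|psi y - psi g0| <= e / 2.
    near=> y; split; first by near: y; exact: open_nbhs_nbhs.
    rewrite distrC; near: y; move/cvgrPdist_le: cpsi; apply; exact: divr_gt0.
  by move=> /nbhs_ballP[e1 e10 H]; exists e1.
have : \forall p \near (g0, (0 : R)), ball g0 e1 (c p.2 *m p.1).
  have : (fun p : 'M[R]_5 * R => c p.2 *m p.1) @ (g0, (0 : R)) --> g0.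
    rewrite -[X in _ --> X](E g0); apply: cvg_mulmx; last exact: cvg_fst.
    have c0 : {for (0 : R), continuous c}.
      by apply: differentiable_continuous; apply/derivable1_diffP; case: oc => _ _ /(_ 0) [].
    by apply: (cvg_comp snd c _ c0); exact: cvg_snd.
  by apply; exact: nbhsx_ballx.
move=> [[/= A B] [Ag0 B0] AB]; move: B0 => /nbhs_ballP[r /= r0 rB].
exists (A, [set s : R | 0 < `|s| < r]) => /=.
  split=> //; near=> s => /=; rewrite normr_gt0; apply/andP; split.
    by near: s; exact: nbhs_dnbhs_neq.
  by near: s; apply: dnbhs0_lt.
move=> -[g s] /= [Ag /andP[s0 sr]] Kg.
have inb x : `|x| <= `|s| -> ball g0 e1 (c x *m g).
  move=> xs; apply: (AB (g, x)); split => //=; apply: rB.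
  by rewrite -ball_normE /= sub0r normrN (le_lt_trans xs).
have inb0 : ball g0 e1 g by have := inb 0; rewrite normr0 E; apply.
have -> : left_derive c u g = psi g by have [Ug' _] := eU _ inb0; exact: left_deriveE uF.
have Kc x : K (c x) by case: oc.
have {E}E0 : u g = u (c 0 *m g) by rewrite E.
have := @mean_value_bound_mx _ _ _ (fun s => u (c s *m g)) (fun s => psi (c s *m g)) s e (psi g) (ltW e0).
rewrite -E0 => B1.
have {}B1 : `|u (c s *m g) - u g - s *: psi g| <= e * `|s|.
  apply: B1 => x xs; have [Ux psix] := eU _ (inb _ xs).
    exact: left_derive_local uF.
  have [_ psig] := eU _ inb0.
  move: (psi (c x *m g)) (psi g) (psi g0) psix psig => P1 P2 P3 h1 h2.
  have -> : P1 - P2 = (P1 - P3) - (P2 - P3) by rewrite opprB addrA subrK.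
  by apply: (le_trans (ler_normB _ _)); rewrite (splitr e) lerD.
have -> : s^-1 *: (u (c s *m g) - u g) - psi g = s^-1 *: (u (c s *m g) - u g - s *: psi g).
  by rewrite [RHS]scalerBr scalerA mulVf ?scale1r // -normr_gt0.
by rewrite normrZ normfV ler_pdivrMl // mulrC.
Unshelve. all: by end_near. Qed.

Lemma lie_derive_quotient Y u (s : R) g : lie K Y -> smooth_real u -> K g ->
  lie_derive Y (fun g => s^-1 *: (u (c s *m g) - u g)) g =
  s^-1 *: (lie_derive Y u (c s *m g) - lie_derive Y u g).
Proof.
move=> lY su Kg; have Kcg : K (c s *m g) by apply: matrix_groupM => //; case: oc.
have D1 := is_derive_lie lY su Kg; have D2 := is_derive_lie lY su Kcg.
rewrite {1}/lie_derive.
have -> : (fun t : R => s^-1 *: (u (c s *m (g *m mexp (t *: Y))) - u (g *m mexp (t *: Y)))) =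
    s^-1 *: ((fun t : R => u (c s *m g *m mexp (t *: Y))) - (fun t : R => u (g *m mexp (t *: Y)))).
  by apply/funext => t; rewrite mulmxA.
by have [_ ->] := is_deriveZ s^-1 (is_deriveB D2 D1).
Qed.

Definition jets (ws : seq (lie K)) u := foldr (fun Y => lie_derive (val Y)) u ws.

Lemma smooth_jets ws u : smooth_real u -> smooth_real (jets ws u).
Proof.
by move=> su; elim: ws => //= Y ws IH; apply: smooth_lie_derive => //; exact: set_valP.
Qed.

Lemma jets_ext ws u v g : K g -> (forall x, K x -> u x = v x) -> jets ws u g = jets ws v g.
Proof.
move=> Kg uv; elim: ws g Kg => [|Y ws IH] g Kg /=; first exact: uv.
by apply: lie_derive_ext => //; exact: set_valP.
Qed.

(** Left-invariant fields commute with left translations. A jet of a difference quotient is thus the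
    difference quotient of the jet, and the single estimate [left_quotient_near] serves every
    seminorm. *)
Lemma jets_quotient ws u (s : R) g : smooth_real u -> K g ->
  jets ws (fun g => s^-1 *: (u (c s *m g) - u g)) g =
  s^-1 *: (jets ws u (c s *m g) - jets ws u g).
Proof.
move=> su; elim: ws g => //= Y ws IH g Kg.
have lY : lie K (val Y) by exact: set_valP.
by rewrite -lie_derive_quotient //; [exact: lie_derive_ext|exact: smooth_jets].
Qed.

Lemma jets_left ws u g : smooth_real u -> K g ->
  jets ws (left_derive c u) g = left_derive c (jets ws u) g.
Proof.
move=> su; elim: ws g => //= Y ws IH g Kg.
have lY : lie K (val Y) by exact: set_valP.
by rewrite -lie_left_comm //; [exact: lie_derive_ext|exact: smooth_jets].
Qed.

End Group.

(** * Left derivatives of sections as limits in the Frechet topology *)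

Section SectionTopology.
Context {R : realType} (K : set 'M[R]_5) (gK : matrix_group K).
Context {d : nat} (rho : set ('M[R]_5 * 'M[R[i]]_d)).
Notation sec := (sections K rho).

Lemma section_smooth (f : sec) b : smooth_real K (part b \o f).
Proof. by case: f => f /= /[!inE] -[_ sf _]; exact: sf. Qed.

Lemma section_out (f : sec) g : ~ K g -> f g = 0.
Proof. by case: f => f /= /[!inE] -[fz _ _]; exact: fz. Qed.

Lemma section_equi (f : sec) g qA : K g -> rho qA -> f (g *m qA.1) = invmx qA.2 *m f g.
Proof. by case: f => f /= /[!inE] -[_ _ fe]; exact: fe. Qed.

Lemma cvg_sections (T : Type) (F : set_system T) {FF : Filter F} (q : T -> sec) (f : sec) :
  (forall (ws : seq (lie K)) b B, compact B -> B `<=` K -> forall e : R, 0 < e ->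
    \forall t \near F, forall g, B g ->
      `|jets ws (part b \o f) g - jets ws (part b \o q t) g| <= e) ->
  q @ F --> f.
Proof.
move=> H; apply/cvg_sup => -[ws b].
suff cF : (jet (ws, b) \o q) @ F --> jet (ws, b) f.
  move=> A /= [_ [[B oB <-] Bf BA]].
  have /cF : nbhs (jet (ws, b) f) B by exact: open_nbhs_nbhs.
  by apply: (@filterS _ F) => t Bt; apply: BA.
apply/fam_cvgP => B [cB BK] P /uniform_nbhs[E [entE EP]].
move: entE; rewrite -entourage_ballE => -[e /= e0 eE].
(* Half of e, since the ball is given by a strict inequality and the hypothesis by a weak one. *)
have := H ws b B cB BK (e / 2) (divr_gt0 e0 (ltr0Sn _ 1)).
apply: filterS => t Ht; apply: EP => y By; apply: eE => /=.
rewrite -ball_normE /=; apply: le_lt_trans (Ht y By) _.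
by rewrite ltr_pdivrMr // ltr_pMr // ltr1n.
Qed.

Lemma cvg_sections_eval (T : Type) (F : set_system T) {FF : Filter F} (q : T -> sec) (f : sec) b g :
  K g -> q @ F --> f -> (fun t => part b (q t g)) @ F --> part b (f g).
Proof.
move=> Kg /cvg_sup /(_ ([::], b)) qf.
have qj : (jet ([::], b) \o q) @ F --> jet ([::], b) f.
  apply: cvg_comp qf _; exact: initial_continuous.
have : {uniform [set g], (jet ([::], b) \o q) @ F --> jet ([::], b) f}.
  move: qj => /fam_cvgP; apply; split; first exact: compact_set1.
  by move=> _ ->.
by rewrite uniform_set1.
Qed.

Context {X : 'M[R]_5} {c : R -> 'M[R]_5} (oc : one_param K X c).

(** [left_derive] acts on real functions, so the derivative is assembled from those of the real and
    imaginary parts. *)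
Definition left_fun (f : sec) : 'M[R]_5 -> 'cV[R[i]]_d := fun g =>
  cplx (left_derive c (part false \o f) g) (left_derive c (part true \o f) g).

Lemma part_left_fun b f : part b \o left_fun f = left_derive c (part b \o f).
Proof. by apply/funext => g /=; rewrite part_cplx; case: b. Qed.

Lemma is_cderive_left (f : sec) g : K g -> is_cderive (fun s : R => f (c s *m g)) 0 (left_fun f g).
Proof.
move=> Kg b; rewrite part_cplx.
have := is_derive_left gK oc (section_smooth f b) Kg.
by case: b.
Qed.

Fact left_subproof (f : sec) : left_fun f \in is_section K rho.
Proof.
rewrite inE; split.
- move=> g Kg; apply: part_inj => b; rewrite part0 part_cplx.
  have E b' : left_derive c (part b' \o f) g = 0.
    rewrite /left_derive (_ : (fun s => _) = fun=> 0) ?derive_cst //.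
    apply/funext => s /=; rewrite section_out ?part0 // => Kcg; apply: Kg.
    by apply/(matrix_groupMl gK (h := c s)) => //; case: oc.
  by rewrite !E; case: b.
- move=> b; have := smooth_left_derive gK oc (section_smooth f b).
  by rewrite -part_left_fun.
- move=> g qA Kg rq.
  (* The equivariance of f on the right holds at every point [c s *m g]; differentiating it in s
     gives that of the derivative. *)
  have H := is_cderive_mull (invmx qA.2) (is_cderive_left f Kg).
  have E : (fun s : R => invmx qA.2 *m f (c s *m g)) = (fun s : R => f (c s *m (g *m qA.1))).
    apply/funext => s; rewrite mulmxA section_equi //.
    by apply: matrix_groupM => //; case: oc.
  rewrite E in H; apply: part_inj => b; have [_ <-] := H b.
  by rewrite part_cplx; case: b.
Qed.

Definition left_section (f : sec) : sec := Section (left_subproof f).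

Lemma curveV s : K (invmx (c s)).
Proof. by apply: matrix_groupV => //; case: oc. Qed.

(** The convergence takes place in the space of sections, so that a continuous T may be applied to
    it. *)
Lemma left_quotient_cvg (f : sec) :
  (fun s : R => (s^-1)%:C%C *: (ltrans gK (curveV s) f - f)) @ (0 : R)^' --> left_section f.
Proof.
apply: cvg_sections => ws b B cB BK e e0.
have sf := section_smooth f b.
(* Compactness of B turns the estimates near each g into one range of s valid on all of B. *)
have := (compact_near_coveringP B).1 cB R (0 : R)^'
  (fun s g => K g -> `|s^-1 *: (jets ws (part b \o f) (c s *m g) - jets ws (part b \o f) g)
     - left_derive c (jets ws (part b \o f)) g| <= e) _.
move=> /(_ _ _)/wrap[].
  by move=> g Bg; apply: (left_quotient_near gK oc) => //; [exact: smooth_jets|exact: BK].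
apply: filterS => s Hs g Bg; have Kg := BK g Bg.
rewrite /= part_left_fun (jets_left gK oc) // distrC.
rewrite (_ : jets ws (part b \o _) g = s^-1 *: (jets ws (part b \o f) (c s *m g) - jets ws (part b \o f) g)).
  exact: Hs.
rewrite -(jets_quotient gK oc) //; apply: jets_ext => // x Kx /=.
by rewrite partZ partB /= invmxK.
Qed.

End SectionTopology.

(** * Symmetric and unbroken strings of weights *)

Section Weights.
Context {F : numFieldType} {n : nat}.
Implicit Types (H A B : 'M[F]_n) (v : 'rV[F]_n).

Lemma eigen_sequence_size H (c : nat -> F) (v : nat -> 'rV[F]_n) k : injective c ->
  (forall i, (i < k)%N -> v i != 0 /\ v i *m H = c i *: v i) -> (k <= n)%N.
Proof.
move=> cI Hv; have := @max_poly_roots _ (char_poly H) [seq c i | i <- iota 0 k].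
rewrite size_map size_iota size_char_poly ltnS; apply.
- exact/monic_neq0/char_poly_monic.
- apply/allP => _ /mapP[i + ->]; rewrite mem_iota add0n /= => ik.
  rewrite -eigenvalue_root_char; apply/eigenvalueP; exists (v i); by case: (Hv i ik).
- by rewrite map_inj_uniq // iota_uniq.
Qed.

Definition comm A B := A *m B - B *m A.

(** Vectors are rows and matrices act from the right, so A H = H A + e A shifts an eigenvalue of H
    by e. *)
Lemma raising_iter H A v (c e : F) i : comm A H = e *: A -> v *m H = c *: v ->
  iter i (mulmxr A) v *m H = (c + e *+ i) *: iter i (mulmxr A) v.
Proof.
move=> AH vH; elim: i => [|i IH]; first by rewrite mulr0n addr0.
have -> : iter i.+1 (mulmxr A) v *m H = iter i (mulmxr A) v *m (H *m A + e *: A).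
  by rewrite -AH /comm addrC subrK /= mulmxA.
by rewrite mulmxDr mulmxA IH -scalemxAl -scalemxAr -scalerDl mulrS addrCA addrC.
Qed.

(* Raise v to a highest weight vector, then lower that. *)
Lemma weight_bound H A B v k : v != 0 -> v *m H = k%:R *: v ->
  comm A H = A -> comm B H = - B -> comm A B = 2 *: H -> (k.*2 < n)%N.
Proof.
move=> v0 vH AH BH AB.
(* Otherwise H would have n + 1 distinct eigenvalues k, k + 1, ..., k + n. *)
have [j [wj0 wj1]] : exists j, iter j (mulmxr A) v != 0 /\ iter j.+1 (mulmxr A) v = 0.
  apply: contrapT => nex.
  have all0 j : iter j (mulmxr A) v != 0.
    elim: j => // j IH; apply/negP => /eqP E; apply: nex; by exists j.
  have := @eigen_sequence_size H (fun i => k%:R + 1 *+ i) (fun i => iter i (mulmxr A) v) n.+1.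
  rewrite ltnn => E; suff : false by []; apply: E.
    by move=> i j' /addrI /eqP; rewrite eqr_nat => /eqP.
  by move=> i _; split => //; apply: raising_iter => //; rewrite scale1r.
set w := iter j (mulmxr A) v in wj0.
have wH : w *m H = (k + j)%:R *: w by rewrite natrD; apply: raising_iter => //; rewrite scale1r.
have wA : w *m A = 0 by [].
set K := (k + j)%N in wH.
pose u i := iter i (mulmxr B) w.
have uH i : u i *m H = (K%:R - i%:R) *: u i.
  by rewrite (@raising_iter H B w K%:R (-1)) ?scaleN1r // mulNrn.
(* The ladder relation. The factor is nonzero for i < 2K, so the lowered vectors u_0, ..., u_{2K}
   are all nonzero: 2K + 1 distinct weights, with K >= k. *)
have uA i : u i.+1 *m A = - (i.+1%:R * (K.*2%:R - i%:R)) *: u i.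
  elim: i => [|i IH].
    have -> : u 1%N *m A = w *m (A *m B - comm A B).
      by rewrite /comm opprB addrCA subrr addr0 mulmxA.
    rewrite AB mulmxBr mulmxA wA mul0mx sub0r -scalemxAr wH scalerA -scaleNr.
    by congr (- _ *: _); rewrite mul1r subr0 -mul2n natrM.
  have -> : u i.+2 *m A = u i.+1 *m (A *m B - comm A B).
    by rewrite /comm opprB addrCA subrr addr0 mulmxA.
  have -> : u i.+1 *m (A *m B - comm A B) = u i.+1 *m A *m B - 2 *: (u i.+1 *m H).
    by rewrite AB mulmxBr mulmxA scalemxAr.
  have -> : u i.+1 *m A *m B = - (i.+1%:R * (K.*2%:R - i%:R)) *: u i.+1 by rewrite IH -scalemxAl.
  rewrite uH scalerA -scalerBl.
  by congr (_ *: _); rewrite -mul2n natrM -[in RHS]addn2 -[i.+1]addn1 !natrD; ring.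
have u0 i : (i <= K.*2)%N -> u i != 0.
  elim: i => // i IH iK; apply/negP => /eqP E.
  have := uA i; rewrite E mul0mx => /esym/eqP; rewrite scaler_eq0 (negbTE (IH (ltnW iK))) orbF.
  by rewrite oppr_eq0 mulf_eq0 pnatr_eq0 /= subr_eq0 eqr_nat gtn_eqF.
suff : (K.*2 < n)%N by apply: leq_ltn_trans; rewrite leq_double leq_addr.
apply: (@eigen_sequence_size H (fun i => K%:R - i%:R) u).
  by move=> i i' /addrI /oppr_inj /eqP; rewrite eqr_nat => /eqP.
by move=> i; rewrite ltnS => iK; split; [exact: u0|exact: uH].
Qed.

End Weights.

Section So3Weights.
Context {R : realType} {n : nat}.
Implicit Types D : 'M[R[i]]_n.
Local Notation I := ('i%C : R[i]).

Lemma commNl (A B : 'M[R[i]]_n) : comm (- A) B = - comm A B.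
Proof. by rewrite /comm mulNmx mulmxN opprB opprK addrC. Qed.
Lemma commNr (A B : 'M[R[i]]_n) : comm A (- B) = - comm A B.
Proof. by rewrite /comm mulNmx mulmxN opprB opprK addrC. Qed.
Lemma comm_anti (A B : 'M[R[i]]_n) : comm A B = - comm B A.
Proof. by rewrite /comm opprB. Qed.
Lemma commZl c (A B : 'M[R[i]]_n) : comm (c *: A) B = c *: comm A B.
Proof. by rewrite /comm -scalemxAl -scalemxAr -scalerBr. Qed.
Lemma commZr c (A B : 'M[R[i]]_n) : comm A (c *: B) = c *: comm A B.
Proof. by rewrite /comm -scalemxAl -scalemxAr -scalerBr. Qed.
Lemma commDl (A B C : 'M[R[i]]_n) : comm (A + B) C = comm A C + comm B C.
Proof. by rewrite /comm mulmxDl mulmxDr opprD addrACA. Qed.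
Lemma commDr (A B C : 'M[R[i]]_n) : comm A (B + C) = comm A B + comm A C.
Proof. by rewrite /comm mulmxDl mulmxDr opprD addrACA. Qed.
Lemma commxx (A : 'M[R[i]]_n) : comm A A = 0.
Proof. by rewrite /comm subrr. Qed.

Lemma comm_conj (A A' X Y : 'M[R[i]]_n) : A' *m A = 1%:M ->
  A *m comm X Y *m A' = comm (A *m X *m A') (A *m Y *m A').
Proof.
move=> AA; have E P Q : A *m P *m A' *m (A *m Q *m A') = A *m (P *m Q) *m A'.
  by rewrite -!mulmxA (mulmxA A' A) AA mul1mx.
by rewrite /comm !E mulmxBr mulmxBl.
Qed.

(** With D2 = [D3, D1] the two double brackets amount to the relations of so(3). Then -k D3 and D1
    +- k D2, for k a square root of -1, form an sl(2) triple. *)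
Lemma so3_weight_bound D3 D1 (m : int) :
  comm D3 (comm D3 D1) = - D1 -> comm D1 (comm D1 D3) = - D3 ->
  eigenvalue D3 (I * m%:~R) -> (`|m|%N.*2 < n)%N.
Proof.
move=> R1 R2 /eigenvalueP[v vD v0].
pose D2 := comm D3 D1.
have C32 : comm D3 D2 = - D1 by [].
have C12 : comm D1 D2 = D3.
  by rewrite -[D3 in RHS]opprK -R2 (comm_anti D1 D3) commNr opprK.
(* The sign is chosen so that H = -k D3 has the nonnegative eigenvalue |m|. *)
pose k : R[i] := if (0 <= m)%R then I else - I.
have kk : k * k = -1.
  by rewrite /k; case: ifP => _; rewrite ?mulrNN -expr2 complex.sqr_i.
pose H := - k *: D3.
apply: (@weight_bound _ _ H (D1 + k *: D2) (D1 - k *: D2) v).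
- exact: v0.
- rewrite /H -scalemxAr vD scalerA; congr (_ *: _).
  rewrite mulrA mulNr /k; case: ifPn => m0.
    by rewrite -expr2 complex.sqr_i opprK mul1r -{1}(gez0_abs m0).
  have -> : - (- I * I) = -1 by rewrite mulNr opprK -expr2 complex.sqr_i.
  rewrite mulN1r -mulrNz -[in RHS]abszN.
  by rewrite -{1}(@gez0_abs (- m)) // oppr_ge0 ltW // ltNge.
- rewrite /H commZr commDl commZl (comm_anti D1) (comm_anti D2) C32 opprK -/D2.
  by rewrite scalerDr scalerN -scaleNr opprK scalerA mulNr kk opprK scale1r addrC.
- rewrite /H commZr commDl commNl commZl (comm_anti D1) (comm_anti D2) C32 opprK -/D2.
  by rewrite scalerBr scalerN scaleNr opprK scaleNr opprK scalerA kk scaleN1r opprB.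
- rewrite commDl !commDr commxx !commNr !commZl !commZr commxx !scaler0 oppr0 addr0 add0r.
  rewrite C12 (comm_anti D2) C12 scalerN /H scalerA mulrN scaleNr mulr2n mulrDl mul1r.
  by rewrite scalerDl opprD.
Qed.

End So3Weights.

(** * One-parameter groups of complex matrices and their generators *)

Section ComplexOneParameterGroups.
Context {R : realType} {n : nat}.
Implicit Types (S : R -> 'M[R[i]]_n) (D Z : 'M[R[i]]_n).

Definition cgroup S D := [/\ S 0 = 1%:M, forall s t, S (s + t) = S s *m S t &
  forall s : R, is_cderive S s (S s *m D)].

Lemma cgroup_comm S D s : cgroup S D -> S s *m D = D *m S s.
Proof.
case=> S0 SD dS.
have H1 := is_cderive_mulr (S s) (dS 0).
have H2 := is_cderive_mull (S s) (dS 0).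
have E : (fun t : R => S t *m S s) = (fun t => S s *m S t).
  by apply/funext => t; rewrite -!SD addrC.
rewrite E S0 mul1mx in H1; rewrite S0 mul1mx in H2.
exact: is_cderive_unique H2 H1.
Qed.

Lemma cgroupVr S D s : cgroup S D -> S s *m S (- s) = 1%:M.
Proof. by case=> S0 SD _; rewrite -SD subrr. Qed.

Lemma is_cderive_scale {p q} (a : R -> R) (t a' : R) (Z : 'M[R[i]]_(p, q)) : is_derive t 1 a a' ->
  is_cderive (fun s => (a s)%:C%C *: Z) t (a'%:C%C *: Z).
Proof.
move=> [da Ea] b; rewrite partZ.
have -> : part b \o (fun s => (a s)%:C%C *: Z) = (fun s => a s *: part b Z).
  by apply/funext => s /=; rewrite partZ.
have dif : differentiable a t by apply/derivable1_diffP.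
apply: DeriveDef.
  by apply/derivable1_diffP; exact: differentiable_scale.
rewrite (derive_scale (F := fun=> part b Z)) // Ea.
by rewrite derive_cst scaler0 add0r.
Qed.

Lemma is_cderive_comp1 {p q} (A : R -> 'M[R[i]]_(p, q)) (a : R -> R) (t : R) A' :
  is_derive t 1 a 1 -> is_cderive A (a t) A' -> is_cderive (A \o a) t A'.
Proof.
move=> da dA; have := is_cderive_comp da dA.
by have -> : (1 : R)%:C%C = 1 by []; rewrite scale1r.
Qed.

Lemma is_deriveNid (t : R) : is_derive t 1 (fun s : R => - s) (-1).
Proof. exact: is_deriveN. Qed.

Lemma cgroup_opp S D : cgroup S D -> cgroup (fun s => S (- s)) (- D).
Proof.
case=> S0 SD dS; split=> [|s t|s]; first by rewrite oppr0.
  by rewrite opprD SD.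
have := is_cderive_comp (is_deriveNid s) (dS (- s)).
have -> : ((-1 : R)%:C%C) = -1 by rewrite rmorphN1.
by rewrite scaleN1r -mulmxN.
Qed.

Lemma cgroup_conj_derive S D Z s : cgroup S D ->
  is_cderive (fun s => S s *m Z *m S (- s)) s (S s *m comm D Z *m S (- s)).
Proof.
move=> gS; have [_ _ dS] := gS; have [_ _ dSN] := cgroup_opp gS.
have := is_cderive_mulmx (is_cderive_mulr Z (dS s)) (dSN s).
by rewrite mulmxN (cgroup_comm (- s) gS) mulmxN /comm mulmxBr mulmxBl !mulmxA.
Qed.

Lemma is_cderive_near m0 p (c c' : R -> 'M[R[i]]_(m0, p)) (t : R) (D : 'M[R[i]]_(m0, p)) :
  (\forall s \near t, c s = c' s) -> is_cderive c t D -> is_cderive c' t D.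
Proof.
move=> cc' cD b; apply: near_eq_is_derive (cD b).
by apply: filterS cc' => s /= ->.
Qed.

(** Two derivatives in h at 0 turn the left side into 2 [D, [D, Z]] and the right side into -2 Z. *)
Lemma double_commutator S D Z : cgroup S D ->
  (\forall h \near (0 : R), S h *m Z *m S (- h) + S (- h) *m Z *m S h = (2 * cos h)%:C%C *: Z) ->
  comm D (comm D Z) = - Z.
Proof.
move=> gS H.
have gS' := cgroup_opp gS.
have [S0 _ _] := gS.
have dP W h : is_cderive (fun h => S h *m W *m S (- h)) h (S h *m comm D W *m S (- h)).
  exact: cgroup_conj_derive.
have dN W h : is_cderive (fun h => S (- h) *m W *m S h) h (S (- h) *m comm (- D) W *m S h).
  have := cgroup_conj_derive W h gS'.
  by under [X in is_cderive X]eq_fun do rewrite opprK; rewrite opprK.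
(* The identity is needed around each h near 0: it is differentiated there once, and the result
   again at 0. *)
have H2 := near_join H.
have E1 : \forall h \near (0 : R), S h *m comm D Z *m S (- h) + S (- h) *m comm (- D) Z *m S h
    = (- 2 * sin h)%:C%C *: Z.
  near=> h; have Hh : \forall s \near h, S s *m Z *m S (- s) + S (- s) *m Z *m S s = (2 * cos s)%:C%C *: Z.
    by near: h; exact: H2.
  have d1 := is_cderive_near Hh (is_cderiveD (dP Z h) (dN Z h)).
  apply: is_cderive_unique d1 _; apply: is_cderive_scale.
  have dc : is_derive h 1 (2 *: (cos : R -> R)) (2 *: - sin h) by exact: is_deriveZ.
  by move: dc; rewrite /GRing.scale /= mulrN -mulNr.
have d2 := is_cderive_near E1 (is_cderiveD (dP (comm D Z) 0) (dN (comm (- D) Z) 0)).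
have d3 : is_cderive (fun h => (- 2 * sin h)%:C%C *: Z) 0 ((- 2)%:C%C *: Z).
  apply: is_cderive_scale.
  have dc : is_derive (0 : R) 1 (-2 *: (sin : R -> R)) (-2 *: cos 0) by exact: is_deriveZ.
  by move: dc; rewrite cos0 /GRing.scale /= mulr1.
have := is_cderive_unique d2 d3.
have S0' : S (- (0 : R)) = 1%:M by rewrite (@oppr0 R).
have -> : comm (- D) (comm (- D) Z) = comm D (comm D Z).
  by rewrite !commNl commNr opprK.
move: (comm D (comm D Z)) => X; rewrite S0' S0 !mul1mx !mulmx1.
rewrite -mulr2n -scaler_nat => E.
have two0 : (2 : R[i]) != 0 by rewrite pnatr_eq0.
apply: (scalerI two0); rewrite E scalerN -scaleNr; congr (_ *: _).
by rewrite rmorphN; congr (- _); rewrite rmorph_nat.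
Unshelve. all: by end_near. Qed.

End ComplexOneParameterGroups.

Section ContinuousGroups.
Context {R : realType}.

Lemma continuous_primitive (f : R -> R) (a : R) : continuous f ->
  exists F : R -> R, forall x, - a < x < a -> is_derive x 1 F (f x).
Proof.
move=> cf; exists (fun x => (\int[lebesgue_measure]_(t in `[(- a), x]) f t)%R).
move=> x /andP[ax xa].
have int : (@lebesgue_measure R).-integrable `[- a, a] (EFin \o f).
  apply: continuous_compact_integrable; first exact: segment_compact.
  exact: continuous_subspaceT.
have [dF EF] := continuous_FTC1_closed xa int ax (cf x).
by apply: DeriveDef; rewrite -?derive1E.
Qed.

Definition cnorm1 (z : R[i]) : R := `|complex.Re z| + `|complex.Im z|.

Lemma cnorm1M z w : cnorm1 (z * w) <= cnorm1 z * cnorm1 w.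
Proof.
case: z w => [a b] [c d]; rewrite /cnorm1 /=.
rewrite (le_trans (lerD (ler_normB _ _) (ler_normD _ _))) // !normrM.
by rewrite le_eqVlt; apply/orP; left; apply/eqP; ring.
Qed.

Lemma cnorm1D z w : cnorm1 (z + w) <= cnorm1 z + cnorm1 w.
Proof.
case: z w => [a b] [c d]; rewrite /cnorm1 /= addrACA.
by rewrite lerD // ler_normD.
Qed.

Lemma cnorm1_eq0 z : cnorm1 z = 0 -> z = 0.
Proof.
case: z => a b /eqP; rewrite /cnorm1 /= paddr_eq0 // !normr_eq0.
by move=> /andP[/eqP -> /eqP ->].
Qed.

(** A row v with v M = 0 satisfies v = - v (M - 1), and the l^1 norm of the right side is at most e
    n < 1 times that of v. *)
Lemma near_id_unitmx n (M : 'M[R[i]]_n) (e : R) : 0 <= e -> e * n%:R < 1 ->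
  (forall i j, cnorm1 ((M - 1%:M) i j) <= e) -> M \in unitmx.
Proof.
move=> e0 en Me; rewrite -row_free_unit -kermx_eq0; apply/rowV0P => v /sub_kermxP vM.
have vE : v = - (v *m (M - 1%:M)) by rewrite mulmxBr vM sub0r mulmx1 opprK.
pose T := \sum_j cnorm1 (v 0 j).
have c0 z : 0 <= cnorm1 z by rewrite addr_ge0.
have TT : T <= e * n%:R * T.
  rewrite {1}/T; apply: (@le_trans _ _ (\sum_(j < n) e * T)); last first.
    by rewrite sumr_const card_ord -[X in X <= _]mulr_natr mulrAC; exact: lexx.
  apply: ler_sum => j _; rewrite {1}vE !mxE.
  have -> : cnorm1 (- (\sum_k v 0 k * (M - 1%:M) k j)) = cnorm1 (\sum_k v 0 k * (M - 1%:M) k j).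
    by rewrite /cnorm1; case: (\sum_k _) => a b /=; rewrite !normrN.
  apply: (@le_trans _ _ (\sum_k cnorm1 (v 0 k) * e)).
    elim/big_rec2: _ => [|k y1 y2 _ IH]; first by rewrite /cnorm1 /= !normr0 addr0.
    rewrite (le_trans (cnorm1D _ _)) // lerD // (le_trans (cnorm1M _ _)) //.
    by rewrite ler_wpM2l.
  by rewrite -mulr_suml mulrC.
have T0 : T = 0.
  apply/eqP; rewrite eq_le sumr_ge0 ?andbT //.
  have := TT; rewrite -subr_ge0 -{2}[T]mul1r -mulrBl.
  by rewrite nmulr_rge0 // subr_lt0.
apply/rowP => j; rewrite [RHS]mxE; apply: cnorm1_eq0.
move: T0 => /eqP; rewrite psumr_eq0 // => /allP /(_ j).
by rewrite mem_index_enum => /(_ isT) /eqP.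
Qed.

(** Continuity implies differentiability. For a primitive P of S, integrating the group law gives
    S(t) (P(a) - P(0)) = P(t + a) - P(t), which is differentiable in t, and P(a) - P(0) is
    invertible for some small a because P'(0) = 1. *)
Lemma cgroup_exists n (S : R -> 'M[R[i]]_n) : S 0 = 1%:M ->
  (forall s t, S (s + t) = S s *m S t) -> (forall b, continuous (part b \o S)) ->
  exists D, cgroup S D.
Proof.
move=> S0 SD cS.
have cSe b i j : continuous (fun t => part b (S t) i j).
  move=> t; have cc := @coord_continuous R n n i j (part b (S t)).
  exact: (continuous_comp (cS b t) cc).
(* The primitive lives on (-3, 3), which contains t + s whenever |t| and |s| are less than 1. *)
pose Pe b i j := sval (cid (continuous_primitive 3 (cSe b i j))).
pose P (t : R) : 'M[R[i]]_n := cplx (\matrix_(i, j) Pe false i j t) (\matrix_(i, j) Pe true i j t).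
have dP t : -3 < t < 3 -> is_cderive P t (S t).
  move=> t3 b.
  have E : part b \o P = (fun t => \matrix_(i, j) Pe b i j t).
    by apply/funext => u /=; rewrite part_cplx; case: b.
  have dPe i j : is_derive t 1 (Pe b i j) (part b (S t) i j).
    exact: (svalP (cid (continuous_primitive 3 (cSe b i j)))).
  have dm : derivable (part b \o P) t 1.
    apply/derivable_mxP => i j; rewrite E.
    by under [X in derivable X]eq_fun do rewrite mxE; case: (dPe i j).
  apply: DeriveDef => //; rewrite derive_mx //; apply/matrixP => i j; rewrite mxE E.
  have -> : (fun t0 : R => (\matrix_(i0, j0) Pe b i0 j0 t0) i j) = Pe b i j by apply/funext => u; rewrite mxE.
  by case: (dPe i j).
(* As a function of s, P(t + s) - S(t) P(s) has derivative S(t + s) - S(t) S(s) = 0. *)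
have key t s : `|t| < 1 -> `|s| < 1 -> S t *m (P s - P 0) = P (t + s) - P t.
  move=> t1 s1; pose G s := P (t + s) - S t *m P s.
  have dG x : `|x| <= `|s| -> is_cderive G x 0.
    move=> xs; have x1 : `|x| < 1 by exact: le_lt_trans xs s1.
    move: t1 x1; rewrite !ltr_norml => /andP[t1 t2] /andP[x1 x2].
    have A : is_cderive (fun s => P (t + s)) x (S (t + x)).
      have dsh : is_derive x 1 (fun s : R => t + s) 1.
        have -> : (fun s : R => t + s) = cst t + id by [].
        by rewrite -[X in is_derive _ _ _ X]add0r; apply: is_deriveD.
      apply: is_cderive_comp1 dsh _.
      by apply: dP; apply/andP; split; lra.
    have B : is_cderive (fun s => - S t *m P s) x (- S t *m S x).
      by apply: is_cderive_mull; apply: dP; apply/andP; split; lra.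
    have := is_cderiveD A B; rewrite SD mulNmx subrr.
    by rewrite /G; under [X in is_cderive X]eq_fun do rewrite mulNmx.
  have : G s = G 0.
    apply: part_inj => b.
    have := @mean_value_bound_mx _ _ _ (part b \o G) (fun=> 0) s 0 0 (lexx _).
    have d' (x : R) : `|x| <= `|s| -> is_derive x 1 (part b \o G) 0.
      by move=> xs; have := dG x xs b; rewrite part0.
    move=> /(_ d'); rewrite subrr normr0 scaler0 subr0 mul0r => /(_ (fun _ _ => lexx _)).
    by rewrite normr_le0 subr_eq0 => /eqP.
  rewrite /G addr0 mulmxBr => E.
  by move/eqP: E; rewrite subr_eq => /eqP ->; rewrite [RHS]addrAC (addrAC (P t)) subrr add0r addrC.
have [a a1 aU] : exists2 a : R, `|a| < 1 & P a - P 0 \in unitmx.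
  have d0 := dP 0; rewrite S0 in d0.
  have z3 : -3 < (0 : R) < 3 by apply/andP; split; lra.
  have {}d0 b := d0 z3 b.
  (* Real and imaginary parts each err by at most e, so an entry errs by at most 2 e in [cnorm1],
     and 2 e n < 1 as [near_id_unitmx] requires. *)
  pose e : R := (4 * (n.+1)%:R)^-1.
  have e0 : 0 < e by rewrite invr_gt0 mulr_gt0.
  have eE : e * (n%:R + 1) * 4 = 1.
    have : (n%:R + 1 : R) != 0 by rewrite natr1 pnatr_eq0.
    by rewrite /e -[n.+1%:R]natr1; move: (n%:R + 1 : R) => w w0; field.
  have nb b : \forall a \near (0 : R)^', `|part b 1%:M - a^-1 *: (part b (P a) - part b (P 0))| <= e.
    have [/cvg_ex[l] cl El] := d0 b.
    have ll : l = part b 1%:M by rewrite -El; apply/esym/cvg_lim.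
    rewrite ll in cl; move/cvgrPdist_le: cl => /(_ e e0).
    apply: filterS => a; rewrite /= addr0 [a%:A]mulr1 //.
  have : \forall a \near (0 : R)^', [/\ a != 0, `|a| < 1 &
      forall b, `|part b 1%:M - a^-1 *: (part b (P a) - part b (P 0))| <= e].
    have nz : \forall a \near (0 : R)^', a != 0 by exact: nbhs_dnbhs_neq.
    have lt1 : \forall a \near (0 : R)^', `|a| < 1 by exact: dnbhs0_lt.
    apply: filterS (filterI (filterI nz lt1) (filterI (nb true) (nb false))) => a.
    by move=> [[a0 a1] [nt nf]]; split => // -[].
  move=> /filter_ex[a [an0 a1 H]]; exists a => //.
  have : (a^-1)%:C%C *: (P a - P 0) \in unitmx.
    apply: (@near_id_unitmx _ _ (2 * e)).
    - by rewrite mulr_ge0 // ltW.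
    - by move: (n%:R : R) eE => nn eE; lra.
    move=> i j; have H' b : `|part b ((a^-1)%:C%C *: (P a - P 0) - 1%:M) i j| <= e.
      apply: le_trans (mx_norm_entry _ i j) _.
      by rewrite partB partZ partB distrC.
    by rewrite /cnorm1 mulr2n mulrDl mul1r; have := H' false; have := H' true; rewrite !mxE /= => h1 h2; exact: lerD.
  rewrite unitmxZ // unitfE.
  by rewrite -(rmorph0 (real_complex R)) (inj_eq (@complexI R)) invr_eq0.
pose B := P a - P 0.
have d0 : is_cderive S 0 ((S a - S 0) *m invmx B).
  have A1 : is_cderive (fun t => (P (t + a) - P t) *m invmx B) 0 ((S a - S 0) *m invmx B).
    apply: is_cderive_mulr.
    have dsh : is_derive (0 : R) 1 (fun s : R => s + a) 1.
      have -> : (fun s : R => s + a) = id + cst a by [].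
      by rewrite -[X in is_derive _ _ _ X]addr0; apply: is_deriveD.
    move: a1; rewrite ltr_norml => /andP[a1 a2].
    have A2 : is_cderive (fun t => P (t + a)) 0 (S a).
      apply: is_cderive_comp1 dsh _.
      by rewrite add0r; apply: dP; apply/andP; split; lra.
    have A3 : is_cderive (fun t => -1 *: P t) 0 (- S 0).
      have d00 : is_cderive P 0 (S 0) by apply: dP; apply/andP; split; lra.
      have := is_cderive_mull (-1)%:M d00.
      by under [X in is_cderive X]eq_fun do rewrite mul_scalar_mx; rewrite mul_scalar_mx scaleN1r.
    have := is_cderiveD A2 A3.
    by under [X in is_cderive X]eq_fun do rewrite scaleN1r.
  apply: is_cderive_near A1; apply: filterS (nbhs0_lt (@ltr01 R)) => t t1.
  by rewrite -key // mulmxK.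
exists ((S a - S 0) *m invmx B); split => // s.
have A1 : is_cderive (fun t => S s *m S (t - s)) s (S s *m ((S a - S 0) *m invmx B)).
  apply: is_cderive_mull.
  have dsh : is_derive s 1 (fun t : R => t - s) 1.
    have -> : (fun t : R => t - s) = id + cst (- s) by [].
    by rewrite -[X in is_derive _ _ _ X]addr0; apply: is_deriveD.
  apply: is_cderive_comp1 dsh _.
  by rewrite subrr.
have E : (fun t => S s *m S (t - s)) = S by apply/funext => t; rewrite -SD addrCA subrr addr0.
by rewrite E in A1.
Unshelve. all: by end_near. Qed.

End ContinuousGroups.

(** * Rotations of three-space and a factorization of Euler type *)

Section Matrices3.
Context {K : comPzRingType}.

Definition mx3 (a b c d e f g h i : K) : 'M[K]_3 :=
  \matrix_(k < 3, l < 3) nth 0 (nth [::] [:: [:: a; b; c]; [:: d; e; f]; [:: g; h; i]] k) l.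

Lemma ord3P (P : 'I_3 -> Prop) : P ord0 -> P 1 -> P (inord 2) -> forall i, P i.
Proof.
move=> P0 P1 P2 [[|[|[|//]]] ?].
- by rewrite (_ : Ordinal _ = ord0) //; exact: val_inj.
- by rewrite (_ : Ordinal _ = 1) //; exact: val_inj.
- by rewrite (_ : Ordinal _ = inord 2) //; apply: val_inj; rewrite /= inordK.
Qed.

Lemma mx3E (A : 'M[K]_3) : A = mx3 (A ord0 ord0) (A ord0 1) (A ord0 (inord 2))
  (A 1 ord0) (A 1 1) (A 1 (inord 2)) (A (inord 2) ord0) (A (inord 2) 1) (A (inord 2) (inord 2)).
Proof.
by apply/matrixP; apply: ord3P; apply: ord3P; rewrite !mxE /= ?inordK.
Qed.

Lemma mulmx3 a b c d e f g h i a' b' c' d' e' f' g' h' i' :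
  mx3 a b c d e f g h i *m mx3 a' b' c' d' e' f' g' h' i' =
  mx3 (a * a' + b * d' + c * g') (a * b' + b * e' + c * h') (a * c' + b * f' + c * i')
      (d * a' + e * d' + f * g') (d * b' + e * e' + f * h') (d * c' + e * f' + f * i')
      (g * a' + h * d' + i * g') (g * b' + h * e' + i * h') (g * c' + h * f' + i * i').
Proof.
apply/matrixP; apply: ord3P; apply: ord3P;
  by rewrite !mxE !big_ord_recl big_ord0 !mxE /= ?inordK //= addr0 addrA.
Qed.

Lemma trmx3 a b c d e f g h i : (mx3 a b c d e f g h i)^T = mx3 a d g b e h c f i.
Proof. by apply/matrixP; apply: ord3P; apply: ord3P; rewrite !mxE /= ?inordK. Qed.

Lemma scalar_mx3 a : a%:M = mx3 a 0 0 0 a 0 0 0 a.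
Proof.
apply/matrixP; apply: ord3P; apply: ord3P; rewrite !mxE /= ?inordK //=;
  by rewrite -val_eqE /= ?inordK.
Qed.

Lemma det_mx3 a b c d e f g h i : \det (mx3 a b c d e f g h i) =
  a * (e * i - f * h) - b * (d * i - f * g) + c * (d * h - e * g).
Proof.
rewrite (expand_det_row _ ord0) !big_ord_recl big_ord0 !mxE /= /cofactor.
rewrite !(expand_det_row _ ord0) !big_ord_recl !big_ord0 !mxE /= /cofactor !det_mx11 !mxE /=.
by rewrite /bump /=; ring.
Qed.

End Matrices3.

Section Rotations.
Context {R : realType}.
Local Notation mx := (@mx3 R).

Definition R3 (s : R) : 'M[R]_3 := block_mx (Defs.rot s) 0 0 (1%:M : 'M[R]_1).

Lemma R3E s : R3 s = mx (cos s) (- sin s) 0 (sin s) (cos s) 0 0 0 1.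
Proof.
apply/matrixP; apply: ord3P; apply: ord3P; rewrite !mxE;
  by case: splitP => k /= kE; rewrite !mxE; case: splitP => l /= lE; rewrite !mxE;
     move: kE lE; rewrite ?inordK //; case: k => -[|[|[]]] //=; case: l => -[|[|[]]] //=.
Qed.

Definition R1 (s : R) : 'M[R]_3 := mx 1 0 0 0 (cos s) (- sin s) 0 (sin s) (cos s).

(** The quarter turn about the second axis. Conjugation by it sends R3 s to R1 s and R1 s to R3 (-
    s), so it carries relations from one generator to the other. *)
Definition quarter : 'M[R]_3 := mx 0 0 1 0 1 0 (- 1) 0 0.

Lemma SO3_mx3 a b c d e f g h i : SO3 (mx a b c d e f g h i) <->
  [/\ a * a + d * d + g * g = 1, b * b + e * e + h * h = 1, c * c + f * f + i * i = 1,
    [/\ a * b + d * e + g * h = 0, a * c + d * f + g * i = 0 & b * c + e * f + h * i = 0] &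
    a * (e * i - f * h) - b * (d * i - f * g) + c * (d * h - e * g) = 1].
Proof.
rewrite /SO3 /= trmx3 mulmx3 scalar_mx3 det_mx3; split.
  move=> [/matrixP E D]; split; [..|split|]; last exact: D.
  - by have := E ord0 ord0; rewrite !mxE.
  - by have := E 1 1; rewrite !mxE.
  - by have := E (inord 2) (inord 2); rewrite !mxE /= inordK.
  - by have := E ord0 1; rewrite !mxE.
  - by have := E ord0 (inord 2); rewrite !mxE /= inordK.
  - by have := E 1 (inord 2); rewrite !mxE /= inordK.
move=> [E1 E2 E3 [E4 E5 E6] E7]; by split=> //; congr mx3; lra.
Qed.

Lemma SO3_R3 s : SO3 (R3 s).
Proof.
have := cos2Dsin2 s; rewrite R3E !expr2 => E; apply/SO3_mx3; split; [..|split|]; lra.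
Qed.

Lemma SO3_R1 s : SO3 (R1 s).
Proof.
have := cos2Dsin2 s; rewrite !expr2 => E; apply/SO3_mx3; split; [..|split|]; lra.
Qed.

Lemma SO3_quarter : SO3 quarter.
Proof. by apply/SO3_mx3; split; [..|split|]; ring. Qed.

Lemma SO3M g h : SO3 g -> SO3 h -> SO3 (g *m h : 'M[R]_3).
Proof.
move=> [gg dg] [hh dh]; split; last by rewrite det_mulmx dg dh mulr1.
by rewrite trmx_mul mulmxA -(mulmxA h^T) gg mulmx1.
Qed.

Lemma SO3_tr g : SO3 g -> SO3 (g^T : 'M[R]_3).
Proof. by move=> [gg dg]; split; [rewrite trmxK; exact: mulmx1C|rewrite det_tr]. Qed.

Lemma quarter_R3 s : quarter *m R3 s = R1 s *m quarter.
Proof. by rewrite R3E !mulmx3; congr mx3; ring. Qed.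

Lemma quarter_R1 s : quarter *m R1 s = R3 (- s) *m quarter.
Proof. by rewrite R3E cosN sinN !mulmx3; congr mx3; ring. Qed.

Lemma R3D s t : R3 (s + t) = R3 s *m R3 t.
Proof. by rewrite !R3E cosD sinD !mulmx3; congr mx3; ring. Qed.

Lemma R3_0 : R3 0 = 1%:M.
Proof. by rewrite R3E cos0 sin0 scalar_mx3 oppr0. Qed.

(* In SU(2) the left side is [[x C + i y, i x S], [i x S, x C - i y]], with x = cos h, y = sin h. *)
Lemma euler_identity (h t a b : R) : cos b = 1 - 2 * (sin t * cos h) ^+ 2 ->
  sin b * sin a = 2 * sin t * cos h * sin h ->
  sin b * cos a = 2 * sin t * cos t * cos h ^+ 2 ->
  cos a ^+ 2 * (1 - (sin t * cos h) ^+ 2) = (cos h * cos t) ^+ 2 ->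
  cos a * sin a * (1 - (sin t * cos h) ^+ 2) = cos h * cos t * sin h ->
  sin a ^+ 2 * (1 - (sin t * cos h) ^+ 2) = sin h ^+ 2 ->
  R1 t *m R3 (2 * h) *m R1 t = R3 a *m R1 b *m R3 a.
Proof.
move=> E1 E2 E3 E4 E5 E6.
have c2 : cos (2 * h) = 2 * cos h ^+ 2 - 1 by rewrite mulr_natl cosD -!expr2 sin2cos2; ring.
have s2 : sin (2 * h) = 2 * cos h * sin h by rewrite mulr_natl sinD; ring.
have ta := cos2Dsin2 a; have tt := cos2Dsin2 t; have th := cos2Dsin2 h.
rewrite !R3E /R1 !mulmx3 c2 s2; move: E2 E3 E4 E5 E6 ta tt th.
rewrite E1; move: (cos a) (sin a) (sin b) (cos t) (sin t) (cos h) (sin h) => A B sb C S X Y.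
by move=> E2 E3 E4 E5 E6 ta tt th; congr mx3; lra.
Qed.

Lemma sqrt_inv_sq (x : R) : 0 < x -> (Num.sqrt x)^-1 ^+ 2 = x^-1.
Proof. by move=> x0; rewrite exprVn sqr_sqrtr // ltW. Qed.

(** Its derivative in t at 0 encodes a bracket relation, although each side is a product of
    one-parameter subgroups. *)
Lemma R1_R3_R1 (h t : R) : 0 < cos h -> 0 < cos t ->
  R1 t *m R3 (2 * h) *m R1 t = R3 (atan (tan h / cos t)) *m
    R1 (2 * asin (sin t * cos h)) *m R3 (atan (tan h / cos t)).
Proof.
move=> h0 t0; set a := atan _; set b := 2 * asin _.
have tt := cos2Dsin2 t; have th := cos2Dsin2 h.
have rho0 : 0 < 1 - (sin t * cos h) ^+ 2.
  by rewrite exprMn; have := exprn_gt0 2 t0; have := sqr_ge0 (sin t); have := sqr_ge0 (sin h); nra.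
have sig : -1 <= sin t * cos h <= 1 by apply/andP; split; nra.
have sb2 : sin (asin (sin t * cos h)) = sin t * cos h by rewrite asinK // in_itv.
have cb2 : cos (asin (sin t * cos h)) = Num.sqrt (1 - (sin t * cos h) ^+ 2) by rewrite cos_asin.
set rho := Num.sqrt _ in cb2.
have r0 : 0 < rho by rewrite sqrtr_gt0.
have r2 : rho ^+ 2 = 1 - (sin t * cos h) ^+ 2 by rewrite sqr_sqrtr // ltW.
have ca : cos a = cos h * cos t / rho.
  rewrite /a cos_atan; apply: (@mulIf _ rho); first by rewrite gt_eqF.
  rewrite divfK ?gt_eqF //; apply/eqP; rewrite -(@eqrXn2 _ 2) //; last first.
  - by rewrite mulr_ge0 // ltW.
  - by rewrite mulr_ge0 ?invr_ge0 ?sqrtr_ge0 // ltW.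
  rewrite exprMn sqrt_inv_sq ?r2; last by rewrite ltr_pwDl // sqr_ge0.
  have -> : tan h = sin h / cos h by [].
  have Q : 1 - (sin t * cos h) ^+ 2 = (cos h * cos t) ^+ 2 + sin h ^+ 2.
    have sS : sin t ^+ 2 = 1 - cos t ^+ 2 by lra.
    by rewrite !exprMn sS; lra.
  have d0 : (cos h * cos t) ^+ 2 + sin h ^+ 2 != 0.
    by rewrite gt_eqF // ltr_pwDl ?sqr_ge0 // exprn_gt0 // mulr_gt0.
  apply/eqP; rewrite Q; move: (cos h) (cos t) (sin h) h0 t0 d0 => x C y x0 C0 d0.
  have -> : 1 + (y / x / C) ^+ 2 = ((x * C) ^+ 2 + y ^+ 2) / (x * C) ^+ 2.
    by field; rewrite !gt_eqF.
  by rewrite invf_div divfK.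
have sa : sin a = sin h / rho.
  have -> : sin a = tan a * cos a by rewrite /tan divfK // ca gt_eqF // divr_gt0 // mulr_gt0.
  rewrite atanK ca /tan; move: (cos h) (cos t) (sin h) h0 t0 => x C y x0 C0.
  by field; rewrite !gt_eqF.
have cb : cos b = 1 - 2 * (sin t * cos h) ^+ 2.
  by rewrite /b mulr_natl cosD sb2 cb2 -!expr2 r2; ring.
have sb : sin b = 2 * (sin t * cos h) * rho by rewrite /b mulr_natl sinD sb2 cb2; ring.
have r0' : rho != 0 by rewrite gt_eqF.
apply: euler_identity => //; rewrite ?sb ?ca ?sa -?r2; move: (cos h) (cos t) (sin h) (sin t) => x C y S; by field.
Qed.

Lemma near_pihalf : \forall h \near (0 : R), - (pi / 2) < h < pi / 2.
Proof.
have p0 : 0 < pi / 2 :> R by rewrite divr_gt0 // pi_gt0.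
by apply: filterS (nbhs0_lt p0) => h; rewrite ltr_norml.
Qed.

Lemma asin0 : asin 0 = 0 :> R.
Proof.
have p0 : 0 <= pi / 2 :> R by rewrite divr_ge0 // pi_ge0.
by rewrite -{1}(@sin0 R) sinK // in_itv /= oppr_le0 p0.
Qed.

(** The angle is even in t, hence stationary at 0: the outer R3 factors contribute nothing to the
    first derivative. *)
Lemma is_derive_euler_a (h : R) : is_derive (0 : R) 1 (fun t => atan (tan h / cos t)) 0.
Proof.
have dc : is_derive (0 : R) 1 (fun t : R => (cos t)^-1) 0.
  have c0 : cos 0 != 0 :> R by rewrite cos0 oner_neq0.
  have d : is_derive (0 : R) 1 cos (- sin 0) by exact: is_derive_cos.
  have [dd Ed] := d.
  apply: DeriveDef; first exact: derivableV.
  by rewrite deriveV // Ed sin0 oppr0 scaler0.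
have dm : is_derive (0 : R) 1 (fun t : R => tan h / cos t) 0.
  have [dd Ed] := is_deriveZ (tan h) dc.
  by apply: DeriveDef => //; rewrite Ed scaler0.
have := is_derive1_comp (is_derive1_atan _) dm.
by rewrite mulr0.
Qed.

Lemma is_derive_euler_b (h : R) :
  is_derive (0 : R) 1 (fun t => 2 * asin (sin t * cos h)) (2 * cos h).
Proof.
have dm : is_derive (0 : R) 1 (fun t : R => sin t * cos h) (cos h).
  have ds : is_derive (0 : R) 1 sin (cos 0) by exact: is_derive_sin.
  have [dd Ed] := is_deriveZ (cos h) ds.
  have -> : (fun t : R => sin t * cos h) = cos h *: (sin : R -> R).
    by apply/funext => t; rewrite /= mulrC.
  by apply: DeriveDef => //; rewrite Ed cos0 /GRing.scale /= mulr1.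
have s0 : -1 < sin 0 * cos h < 1 by rewrite sin0 mul0r ltrN10 ltr01.
have da := @is_derive1_comp _ asin (fun t : R => sin t * cos h) 0 _ _ (is_derive1_asin s0) dm.
have [dd Ed] := is_deriveZ 2 da.
apply: DeriveDef => //; rewrite Ed sin0 mul0r expr0n /= subr0 sqrtr1 invr1 mul1r //.
Qed.

End Rotations.

(** * The infinitesimal generator of a continuous representation of SO(3) *)

Section RepresentationSO3.
Context {R : realType} {N : nat} (sigma : 'M[R]_3 -> 'M[R[i]]_N).
Hypothesis s1 : sigma 1%:M = 1%:M.
Hypothesis sM : {in SO3 &, forall g h, sigma (g *m h) = sigma g *m sigma h}.
Hypothesis sc : forall b, {within SO3, continuous (part b \o sigma)}.

Lemma sigmaM g h : SO3 g -> SO3 h -> sigma (g *m h) = sigma g *m sigma h.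
Proof. by move=> Sg Sh; apply: sM; exact: mem_set. Qed.

Lemma sigmaV g : SO3 g -> sigma g *m sigma g^T = 1%:M.
Proof.
move=> Sg; rewrite -sigmaM //; last exact: SO3_tr.
by have [/mulmx1C -> _] := Sg.
Qed.

Lemma sigmaM3 g h k : SO3 g -> SO3 h -> SO3 k ->
  sigma g *m sigma h *m sigma k = sigma (g *m h *m k).
Proof. by move=> Sg Sh Sk; rewrite -!sigmaM //; exact: SO3M. Qed.

Lemma R3_continuous : continuous (@R3 R).
Proof.
move=> s; apply: cvg_mx_entries => i j.
have E (f : R -> R) : continuous f -> f @ s --> f s by move=> /(_ s).
rewrite (_ : (fun x => R3 x i j) = fun x => mx3 (cos x) (- sin x) 0 (sin x) (cos x) 0 0 0 1 i j); last first.
  by apply/funext => x; rewrite R3E.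
rewrite R3E; move: i j; apply: ord3P; apply: ord3P.
all: rewrite !mxE /= ?inordK //=; under eq_fun do rewrite !mxE /= ?inordK //=.
all: try (exact: cvg_cst); try (exact: continuous_sin); try (exact: continuous_cos).
by apply: cvgN; exact: continuous_sin.
Qed.

Lemma sigma_R3_group : exists D, cgroup (fun s => sigma (R3 s)) D.
Proof.
apply: cgroup_exists.
- by rewrite R3_0.
- by move=> s t; rewrite R3D sigmaM //; exact: SO3_R3.
- move=> b s.
  move/subspace_continuousP: (@sc b) => /(_ _ (SO3_R3 s)) H A /H.
  move=> HA; have {}HA : \forall x \near R3 s, SO3 x -> A (part b (sigma x)) by exact: HA.
  have : \forall t \near s, SO3 (R3 t) -> A (part b (sigma (R3 t))) by exact: (R3_continuous HA).
  by apply: (@filterS _ (nbhs s)) => t; apply; exact: SO3_R3.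
Qed.

Lemma so3_generator : exists2 D, cgroup (fun s => sigma (R3 s)) D &
  forall m : int, (N <= `|m|%N.*2)%N -> ~~ eigenvalue D ('i%C * m%:~R).
Proof.
have [D3 g3] := sigma_R3_group; exists D3 => // m mN.
set S := fun s => _ in g3.
pose A := sigma quarter; pose A' := sigma quarter^T.
have AA' : A *m A' = 1%:M by apply/sigmaV/SO3_quarter.
have A'A : A' *m A = 1%:M by apply: mulmx1C.
pose S1 s := sigma (R1 s).
have S1E s : S1 s = A *m S s *m A'.
  rewrite /S1 /A /S -sigmaM ?quarter_R3 //; [|exact: SO3_quarter|exact: SO3_R3].
  rewrite sigmaM; [|exact: SO3_R1|exact: SO3_quarter].
  by rewrite -mulmxA AA' mulmx1.
have S1E' s : A *m S1 s *m A' = S (- s).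
  rewrite /S1 /A /S -sigmaM ?quarter_R1 //; [|exact: SO3_quarter|exact: SO3_R1].
  rewrite sigmaM; [|exact: SO3_R3|exact: SO3_quarter].
  by rewrite -mulmxA AA' mulmx1.
pose D1 := A *m D3 *m A'.
have [S0 SD dS] := g3.
have dS1 s : is_cderive S1 s (A *m (S s *m D3) *m A').
  have -> : S1 = fun s => A *m S s *m A' by apply/funext.
  by apply: is_cderive_mulr; exact: is_cderive_mull.
have dS10 : is_cderive S1 0 D1 by have := dS1 0; rewrite S0 mul1mx.
have S10 : S1 0 = 1%:M by rewrite S1E S0 mulmx1.
have D1E : A *m D1 *m A' = - D3.
  have H1 : is_cderive (fun s => S (- s)) 0 (A *m D1 *m A').
    have -> : (fun s => S (- s)) = fun s => A *m S1 s *m A' by apply/funext.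
    by apply: is_cderive_mulr; exact: is_cderive_mull.
  have [_ _ /(_ 0)] := cgroup_opp g3; rewrite oppr0 S0 mul1mx.
  exact: is_cderive_unique.
have D1def : A *m D3 *m A' = D1 by [].
clearbody D1.
(* [R1_R3_R1] differentiated in t at 0 reads D1 S(2h) + S(2h) D1 = 2 cos h S(h) D1 S(h).
   Multiplication by S(-h) on both sides gives the hypothesis of [double_commutator]. *)
have rel : comm D3 (comm D3 D1) = - D1.
  apply: (double_commutator g3).
  have cc : cos x @[x --> (0 : R)] --> (1 : R).
    by have := @continuous_cos R 0; rewrite /continuous_at cos0.
  have cp : \forall x \near (0 : R), 0 < cos x by apply: (cvgr_gt _ cc); exact: ltr01.
  near=> h.
  have ch : 0 < cos h by near: h.
  have L : is_cderive (fun t => S1 t *m S (2 * h) *m S1 t) 0 (D1 *m S (2 * h) + S (2 * h) *m D1).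
    have := is_cderive_mulmx (is_cderive_mulr (S (2 * h)) dS10) dS10.
    by rewrite S10 mulmx1 mul1mx.
  pose a (t : R) := atan (tan h / cos t); pose b (t : R) := 2 * asin (sin t * cos h).
  have da := is_derive_euler_a h; rewrite -/a in da.
  have db := is_derive_euler_b h; rewrite -/b in db.
  have a0 : S (a 0) = S h.
    rewrite /a cos0 divr1 tanK // in_itv /=; near: h; exact: near_pihalf.
  have b0 : b 0 = 0 by rewrite /b sin0 mul0r asin0 mulr0.
  have Rr : is_cderive (fun t => S (a t) *m S1 (b t) *m S (a t)) 0 ((2 * cos h)%:C%C *: (S h *m D1 *m S h)).
    have dSa : is_cderive (S \o a) 0 0.
      by have := is_cderive_comp da (dS (a 0)); rewrite [_%:C%C]/(0 : R[i]) scale0r.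
    have dSb : is_cderive (S1 \o b) 0 ((2 * cos h)%:C%C *: D1).
      by apply: is_cderive_comp db _; rewrite b0.
    have := is_cderive_mulmx (is_cderive_mulmx dSa dSb) dSa.
    by rewrite /= a0 b0 S10 !mul0mx mulmx0 add0r addr0 -scalemxAr -scalemxAl.
  have E : D1 *m S (2 * h) + S (2 * h) *m D1 = (2 * cos h)%:C%C *: (S h *m D1 *m S h).
    apply: is_cderive_unique L _; apply: is_cderive_near Rr.
    near=> t; have ct : 0 < cos t by near: t.
    rewrite /S1 /S !sigmaM3 ?R1_R3_R1 //; by [exact: SO3_R3|exact: SO3_R1].
  have S2 : S (2 * h) = S h *m S h by rewrite -SD mulr_natl mulr2n.
  have SS : S h *m S (- h) = 1%:M by exact: (cgroupVr h g3).
  have SS' : S (- h) *m S h = 1%:M by exact: mulmx1C.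
  move: E => /(congr1 (fun M => S (- h) *m M *m S (- h))).
  rewrite S2 mulmxDr mulmxDl -scalemxAr -scalemxAl !mulmxA SS' !mul1mx.
  rewrite -!mulmxA SS !mulmx1 => <-.
  by rewrite addrC.
have conjC X Y : A *m comm X Y *m A' = comm (A *m X *m A') (A *m Y *m A') by exact: comm_conj.
(* Conjugation by [quarter] replaces (D3, D1) by (D1, - D3) in [rel]. *)
have rel2 : comm D1 (comm D1 D3) = - D3.
  have := congr1 (fun M => A *m M *m A') rel.
  rewrite !conjC D1def D1E mulmxN mulNmx D1E opprK !commNr => E.
  by apply: oppr_inj; rewrite opprK.
by apply/negP => /(so3_weight_bound rel rel2); rewrite ltnNge mN.
Unshelve. all: by end_near. Qed.

End RepresentationSO3.

(** * The group SO_0(4,1), its nilpotent elements and its parabolic subalgebra *)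

Section Coordinates.

Lemma sum5 (V : nmodType) (f : 'I_5 -> V) :
  \sum_i f i = f ord0 + f (inord 1) + f (inord 2) + f (inord 3) + f ord_max.
Proof.
rewrite !big_ord_recl big_ord0 addr0 !addrA; congr (_ + f _ + f _ + f _ + f _);
  by apply: val_inj; rewrite /= ?inordK.
Qed.

Lemma ord5P (P : 'I_5 -> Prop) : P ord0 -> P (inord 1) -> P (inord 2) -> P (inord 3) ->
  P ord_max -> forall i, P i.
Proof.
move=> P0 P1 P2 P3 P4 [[|[|[|[|[|//]]]]] ?].
- by rewrite (_ : Ordinal _ = ord0) //; exact: val_inj.
- by rewrite (_ : Ordinal _ = inord 1) //; apply: val_inj; rewrite /= inordK.
- by rewrite (_ : Ordinal _ = inord 2) //; apply: val_inj; rewrite /= inordK.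
- by rewrite (_ : Ordinal _ = inord 3) //; apply: val_inj; rewrite /= inordK.
- by rewrite (_ : Ordinal _ = ord_max) //; exact: val_inj.
Qed.

End Coordinates.

Ltac mx5_entries := apply/matrixP; apply: ord5P;
  [apply: ord5P|apply: ord5P|apply: ord5P|apply: ord5P|apply: ord5P];
  rewrite ?(mxE, sum5) /= ?inordK //=.

Ltac cv5_entries := let j := fresh "j" in apply/matrixP => + j; rewrite [j]ord1 {j}; apply: ord5P;
  rewrite ?(mxE, sum5) /= ?inordK //=.

Section Minkowski.
Context {R : realType}.

Definition mx5 (rows : seq (seq R)) : 'M[R]_5 := \matrix_(i, j) nth 0 (nth [::] rows i) j.
Definition cv5 (x : seq R) : 'cV[R]_5 := \col_i nth 0 x i.

Definition J5 := mx5 [:: [:: 1; 0; 0; 0; 0]; [:: 0; 1; 0; 0; 0]; [:: 0; 0; 1; 0; 0];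
  [:: 0; 0; 0; 1; 0]; [:: 0; 0; 0; 0; -1]].
Definition qvec : 'cV[R]_5 := delta_mx ord0 0 + delta_mx ord_max 0.
(** Elements of n_+, with n'_+ given by c = 0. They act on the coordinates x_i = y_i / (y_4 - y_0)
    as the translation by (a, b, c). *)
Definition Xn a b c := mx5 [:: [:: 0; a; b; c; 0]; [:: - a; 0; 0; 0; a]; [:: - b; 0; 0; 0; b];
  [:: - c; 0; 0; 0; c]; [:: 0; a; b; c; 0]].
Definition diag3 (A : 'M[R]_3) := mx5 [:: [:: 0; 0; 0; 0; 0];
  [:: 0; A ord0 ord0; A ord0 1; A ord0 (inord 2); 0];
  [:: 0; A 1 ord0; A 1 1; A 1 (inord 2); 0];
  [:: 0; A (inord 2) ord0; A (inord 2) 1; A (inord 2) (inord 2); 0];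
  [:: 0; 0; 0; 0; 0]].

Lemma qvecE : qvec = cv5 [:: 1; 0; 0; 0; 1].
Proof.
rewrite /qvec; cv5_entries; rewrite -?val_eqE /= ?inordK //= ?addr0 ?add0r //.
Qed.

Lemma H0E : H_0 = mx5 [:: [:: 0; 0; 0; 0; 1]; [:: 0; 0; 0; 0; 0]; [:: 0; 0; 0; 0; 0];
  [:: 0; 0; 0; 0; 0]; [:: 1; 0; 0; 0; 0]].
Proof.
rewrite /H_0; mx5_entries; rewrite -?val_eqE /= ?inordK //= ?addr0 ?add0r //.
Qed.

Lemma J5_tr : J5^T = J5.
Proof. by mx5_entries. Qed.

Lemma J5_sq : J5 *m J5 = 1%:M.
Proof. by mx5_entries; rewrite -?val_eqE /= ?inordK //=; ring. Qed.

Lemma Q41E (x : 'cV[R]_5) : Q41 x = (x^T *m J5 *m x) 0 0.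
Proof.
rewrite /Q41 big_mkcond sum5 -!val_eqE /= !inordK //= !(mxE, sum5) /= !inordK //=.
by ring.
Qed.

Lemma symm_form_eq0 n (D : 'M[R]_n) : D^T = D -> (forall x : 'cV_n, (x^T *m D *m x) 0 0 = 0) -> D = 0.
Proof.
move=> sD xD.
have B (i j : 'I_n) : ((delta_mx i 0 : 'cV[R]_n)^T *m D *m (delta_mx j 0 : 'cV[R]_n)) 0 0 = D i j.
  by rewrite trmx_delta -rowE -colE !mxE.
apply/matrixP => i j; rewrite [RHS]mxE.
have := xD (delta_mx i 0 + delta_mx j 0).
rewrite [(_ + _)^T]linearD /= mulmxDl mulmxDl !mulmxDr !mxE.
have e (k l : 'I_n) : (\sum_k0 ((delta_mx k 0 : 'cV[R]_n)^T *m D) 0 k0 *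
    (delta_mx l 0 : 'cV[R]_n) k0 0) = D k l.
  by rewrite -(B k l) [RHS]mxE.
rewrite !e; have := B i i; have := B j j; rewrite !xD => <- <-.
have <- : D i j = D j i by rewrite -{1}sD mxE.
by move=> H; lra.
Qed.

Lemma O41E (g : 'M[R]_5) : O41 g <-> g^T *m J5 *m g = J5.
Proof.
split=> [[gu gQ]|gJ].
  apply/eqP; rewrite -subr_eq0; apply/eqP; apply: symm_form_eq0.
    by rewrite linearB /= !trmx_mul trmxK J5_tr mulmxA.
  move=> x; have := gQ x; rewrite !Q41E trmx_mul mulmxBr mulmxBl !mulmxA => E.
  by rewrite mxE [X in _ + X]mxE E subrr.
split; last first.
  move=> x; rewrite !Q41E; have -> : (g *m x)^T *m J5 *m (g *m x) = x^T *m (g^T *m J5 *m g) *m x.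
    by rewrite trmx_mul !mulmxA.
  by rewrite gJ.
have : (J5 *m g^T *m J5) *m g = 1%:M by rewrite -!mulmxA (mulmxA g^T) gJ J5_sq.
by move=> /mulmx1_unit[].
Qed.

Lemma SO41_J (g : 'M[R]_5) : SO41 g -> g^T *m J5 *m g = J5.
Proof. by move=> /connected_component_sub/O41E. Qed.

(** The range of c is a connected subset of O(4,1) through the identity. *)
Lemma SO41_curve (c : R -> 'M[R]_5) : continuous c -> c 0 = 1%:M ->
  (forall s, (c s)^T *m J5 *m c s = J5) -> forall s, SO41 (c s).
Proof.
move=> cc c0 cJ s.
apply: (@connected_component_max _ O41 (range c)) => //.
- by exists 0.
- by move=> _ [t _ <-]; apply/O41E.
- apply: connected_continuous_connected; last exact: continuous_subspaceT.
  by apply/connected_intervalP => x y _ _ z _.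
Qed.

Lemma derive_continuous (c c' : R -> 'M[R]_5) : (forall s : R, is_derive s 1 c (c' s)) -> continuous c.
Proof.
by move=> dc s; apply: differentiable_continuous; apply/derivable1_diffP; case: (dc s).
Qed.

Lemma Xn_sq a b c : Xn a b c *m Xn a b c = (a ^+ 2 + b ^+ 2 + c ^+ 2) *:
  mx5 [:: [:: -1; 0; 0; 0; 1]; [:: 0; 0; 0; 0; 0]; [:: 0; 0; 0; 0; 0]; [:: 0; 0; 0; 0; 0]; [:: -1; 0; 0; 0; 1]].
Proof. by mx5_entries; ring. Qed.

Lemma Xn_nilp a b c : Xn a b c ^+ 3 = 0.
Proof.
change (Xn a b c *m (Xn a b c *m Xn a b c) = 0); rewrite Xn_sq -scalemxAr.
apply/eqP; rewrite scaler_eq0; apply/orP; right; apply/eqP.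
by mx5_entries; ring.
Qed.

Lemma Xn_skew a b c : (Xn a b c)^T *m J5 = - (J5 *m Xn a b c).
Proof. by mx5_entries; ring. Qed.

Definition nexp (X : 'M[R]_5) (s : R) : 'M[R]_5 := mexp (s *: X).

Lemma nexpE (X : 'M[R]_5) s : X ^+ 3 = 0 -> nexp X s = 1%:M + s *: X + (s ^+ 2 / 2) *: (X *m X).
Proof.
move=> X3; rewrite /nexp mexp_nilp3; last by rewrite exprZn X3 scaler0.
by rewrite -scalemxAl -scalemxAr !scalerA -mulrA mulrC expr2.
Qed.

(** Nilpotency makes the exponential a quadratic polynomial in s, which can be differentiated at
    every s. *)
Lemma is_derive_nexp (X : 'M[R]_5) (s : R) : X ^+ 3 = 0 -> is_derive s 1 (nexp X) (X *m nexp X s).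
Proof.
move=> X3; have -> : X *m nexp X s = X + s *: (X *m X).
  rewrite nexpE // !mulmxDr mulmx1 -!scalemxAr.
  have -> : X *m (X *m X) = 0 by rewrite -X3 exprS expr2.
  by rewrite scaler0 addr0.
have -> : nexp X = (fun s : R => s *: X + 1%:M) + (fun s => (s ^+ 2 / 2) *: (X *m X)).
  by apply/funext => t; rewrite nexpE // [1%:M + _]addrC.
apply: is_deriveD; first exact: is_derive_line.
have d2 : is_derive s 1 (fun s : R => s ^+ 2 / 2) s.
  have d := @is_derive_id _ _ s (1 : R).
  have [dd Ed] := is_deriveZ (2^-1) (is_deriveX 2 d).
  have -> : (fun s : R => s ^+ 2 / 2) = 2^-1 *: (id ^+ 2 : R -> R).
    by apply/funext => t; rewrite /= mulrC.
  apply: DeriveDef => //; rewrite Ed /= expr1 /GRing.scale /= mulr1; by field.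
have [dd Ed] := d2.
have dif : differentiable (fun s : R => s ^+ 2 / 2) s by apply/derivable1_diffP.
apply: DeriveDef.
  by apply/derivable1_diffP; exact: differentiable_scale.
rewrite (derive_scale (F := fun=> X *m X)) // Ed.
by rewrite derive_cst scaler0 add0r.
Qed.

Lemma nexp_J (X : 'M[R]_5) s : X ^+ 3 = 0 -> X^T *m J5 = - (J5 *m X) ->
  (nexp X s)^T *m J5 *m nexp X s = J5.
Proof.
move=> X3 XJ.
have X3' : X *m X *m X = 0 by rewrite -X3 exprSr expr2.
have X3'' : X *m (X *m X) = 0 by rewrite mulmxA.
have X4 : X *m X *m (X *m X) = 0 by rewrite mulmxA X3' mul0mx.
have E : (nexp X s)^T *m J5 = J5 *m (1%:M - s *: X + (s ^+ 2 / 2) *: (X *m X)).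
  rewrite nexpE // !linearD /= !linearZ /= trmx1 trmx_mul.
  rewrite !mulmxDl mul1mx -!scalemxAl -(mulmxA X^T) XJ mulmxN mulmxA XJ mulNmx opprK.
  by rewrite mulmx1 mulmxN mulmxA.
rewrite E nexpE // -mulmxA -[RHS]mulmx1; congr (_ *m _).
rewrite !mulmxDl !mulmxDr !mulNmx !mul1mx !mulmx1 -!scalemxAl -!scalemxAr X3' X3'' X4 !scaler0 !addr0 oppr0 addr0.
set Y := X *m X; apply/matrixP => i j; rewrite !mxE; move: (Y i j) (X i j) (_ *+ _) => y x d.
by field.
Qed.

Lemma nexp0 (X : 'M[R]_5) : nexp X 0 = 1%:M.
Proof. by rewrite /nexp scale0r mexp0. Qed.

Lemma SO41_nexp a b c s : SO41 (nexp (Xn a b c) s).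
Proof.
apply: SO41_curve.
- by apply: derive_continuous => t; apply: is_derive_nexp; exact: Xn_nilp.
- exact: nexp0.
- by move=> t; apply: nexp_J; [exact: Xn_nilp|exact: Xn_skew].
Qed.

Lemma H0_q : H_0 *m qvec = qvec :> 'cV[R]_5.
Proof. by rewrite H0E qvecE; cv5_entries; ring. Qed.

Lemma nplus_Xn a b c : nplus (Xn a b c).
Proof.
split; first by move=> t; exact: SO41_nexp.
by rewrite H0E; mx5_entries; ring.
Qed.

Lemma nplusZ (X : 'M[R]_5) (t : R) : nplus X -> nplus (t *: X).
Proof.
move=> [lX HX]; split.
  by move=> s; rewrite scalerA; exact: lX.
by rewrite -scalemxAl -scalemxAr -scalerBr HX.
Qed.

Lemma Nplus_nexp a b c s : Nplus (nexp (Xn a b c) s).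
Proof. by exists (s *: Xn a b c) => //; apply: nplusZ; exact: nplus_Xn. Qed.

Lemma H0_cube (x : 'cV[R]_5) : H_0 *m (H_0 *m (H_0 *m x)) = H_0 *m x.
Proof.
have H2 : H_0 *m H_0 = mx5 [:: [:: 1; 0; 0; 0; 0]; [:: 0; 0; 0; 0; 0]; [:: 0; 0; 0; 0; 0];
    [:: 0; 0; 0; 0; 0]; [:: 0; 0; 0; 0; 1]] by rewrite H0E; mx5_entries; ring.
rewrite !mulmxA -[H_0 *m H_0 *m _]mulmxA H2; congr (_ *m _); rewrite H0E; by mx5_entries; ring.
Qed.

(* X q is an eigenvector of H_0 for the eigenvalue 2, and H_0^3 = H_0. *)
Lemma Nplus_q n : Nplus n -> n *m qvec = qvec :> 'cV[R]_5.
Proof.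
move=> [X [_ HX] <-].
have Xq : X *m qvec = 0.
  have E1 : H_0 *m (X *m qvec) = 2 *: (X *m qvec).
    rewrite mulmxA -[H_0 *m X](subrK (X *m H_0)) HX mulmxDl -mulmxA H0_q.
    by rewrite scaler_nat mulr2n.
  have := H0_cube (X *m qvec).
  rewrite !E1 -!scalemxAr !E1 -!scalemxAr !E1 !scalerA => /eqP.
  rewrite -subr_eq0 -scalerBl scaler_eq0 => /orP[/eqP E|/eqP //].
  by exfalso; move: E; clear; lra.
have := @mexp_eigen _ _ X qvec 0; rewrite expR0 scale0r scale1r; exact.
Qed.

Lemma mexpH0_q (t : R) : mexp (t *: H_0) *m qvec = expR t *: qvec.
Proof. by apply: mexp_eigen; rewrite -scalemxAl H0_q. Qed.

Lemma ord131P (P : 'I_(1 + (3 + 1)) -> Prop) : P (lshift _ ord0) ->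
  P (rshift 1 (lshift 1 ord0)) -> P (rshift 1 (lshift 1 1)) ->
  P (rshift 1 (lshift 1 (inord 2))) -> P (rshift 1 (rshift 3 ord0)) -> forall i, P i.
Proof.
move=> P0 P1 P2 P3 P4 i; case: (fintype.split_ordP i) => [k ->|k ->]; first by rewrite [k]ord1.
case: (fintype.split_ordP k) => [l ->|l ->]; last by rewrite [l]ord1.
by move: l; exact: ord3P.
Qed.

(* diag(a, A, b) *)
Definition diag131 a (A : 'M[R]_3) b : 'M[R]_(1 + (3 + 1)) :=
  block_mx a%:M 0 0 (block_mx A 0 0 b%:M).

Lemma diag131E a (A : 'M[R]_3) b : diag131 a A b = mx5 [:: [:: a; 0; 0; 0; 0];
  [:: 0; A ord0 ord0; A ord0 1; A ord0 (inord 2); 0];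
  [:: 0; A 1 ord0; A 1 1; A 1 (inord 2); 0];
  [:: 0; A (inord 2) ord0; A (inord 2) 1; A (inord 2) (inord 2); 0];
  [:: 0; 0; 0; 0; b]].
Proof.
apply/matrixP; apply: ord131P; apply: ord131P;
  by rewrite ?(block_mxEul, block_mxEur, block_mxEdl, block_mxEdr) !mxE /= ?inordK //= mulr1n.
Qed.

Lemma diag131M (A B : 'M[R]_3) a b a' b' :
  diag131 a A b *m diag131 a' B b' = diag131 (a * a') (A *m B) (b * b').
Proof.
by rewrite /diag131 !mulmx_block !(mul0mx, mulmx0, addr0, add0r) -!scalar_mxM.
Qed.

Lemma tr_diag131 (A : 'M[R]_3) a b : (diag131 a A b)^T = diag131 a A^T b.
Proof. by rewrite /diag131 !tr_block_mx !trmx0 !tr_scalar_mx. Qed.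

Lemma diag131_1 : diag131 1 1%:M 1 = 1%:M.
Proof. by rewrite /diag131 -!scalar_mx_block. Qed.

Lemma J5E : J5 = diag131 1 1%:M (-1).
Proof. by rewrite diag131E; mx5_entries; rewrite -?val_eqE /= ?inordK. Qed.

Lemma diag3E (A : 'M[R]_3) : diag3 A = diag131 0 A 0.
Proof. by rewrite diag131E. Qed.

Lemma diag1g1E (A : 'M[R]_3) : diag1g1 A = diag131 1 A 1.
Proof. by []. Qed.

Lemma diag1g1_q (A : 'M[R]_3) : diag1g1 A *m qvec = qvec.
Proof. by rewrite diag1g1E diag131E qvecE; cv5_entries; ring. Qed.

Lemma diag1g1_J (A : 'M[R]_3) : A^T *m A = 1%:M -> (diag1g1 A)^T *m J5 *m diag1g1 A = J5.
Proof.
move=> AA; rewrite J5E diag1g1E.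
transitivity ((diag131 1 A 1)^T *m diag131 1 1%:M (-1) *m diag131 1 A 1) => //.
by rewrite tr_diag131 !diag131M mulmx1 AA !mul1r !mulr1.
Qed.

Definition Z3 : 'M[R]_3 := mx3 0 (-1) 0 1 0 0 0 0 0.

(* An element of so(4,1) that kills q is a rotation generator plus an element of n_+. *)
Lemma parabolic_split (K : 'M[R]_5) : K^T = - K -> K *m qvec = 0 ->
  exists A a b c, A^T = - A /\ J5 *m K = diag3 A + Xn a b c.
Proof.
move=> /matrixP aK; rewrite qvecE => /matrixP Kq.
exists (mx3 (K (inord 1) (inord 1)) (K (inord 1) (inord 2)) (K (inord 1) (inord 3))
  (K (inord 2) (inord 1)) (K (inord 2) (inord 2)) (K (inord 2) (inord 3))
  (K (inord 3) (inord 1)) (K (inord 3) (inord 2)) (K (inord 3) (inord 3))),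
  (K ord0 (inord 1)), (K ord0 (inord 2)), (K ord0 (inord 3)).
have S i j : K j i = - K i j by have := aK i j; rewrite !mxE.
have Q i : K i ord0 + K i ord_max = 0.
  by have := Kq i 0; rewrite !(mxE, sum5) /= !inordK //= => <-; ring.
have D i : K i i = 0 by have := S i i; lra.
have Q0 := Q ord0; have Q1 := Q (inord 1); have Q2 := Q (inord 2); have Q3 := Q (inord 3); have Q4 := Q ord_max.
split.
  rewrite trmx3; apply/matrixP; apply: ord3P; apply: ord3P; rewrite !mxE /= ?inordK //=; exact: S.
have S01 := S ord0 (inord 1); have S02 := S ord0 (inord 2); have S03 := S ord0 (inord 3); have S04 := S ord0 ord_max.
have S14 := S (inord 1) ord_max; have S24 := S (inord 2) ord_max; have S34 := S (inord 3) ord_max.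
have D0 := D ord0; have D4 := D ord_max.
by mx5_entries; rewrite ?mxE /= ?inordK //=; lra.
Qed.

(** For the trace form n_+ is orthogonal to m + n_+, so only the rotation part counts. *)
Lemma trace_split (A : 'M[R]_3) a b c : A^T = - A ->
  \tr ((diag3 A + Xn a b c) *m (diag3 A + Xn a b c)) =
  - 2 * (A 1 ord0 ^+ 2 + A ord0 (inord 2) ^+ 2 + A (inord 2) 1 ^+ 2).
Proof.
move=> /matrixP aA; have S i j : A j i = - A i j by have := aA i j; rewrite !mxE.
have D i : A i i = 0 by have := S i i; lra.
rewrite /mxtrace sum5 !(mxE, sum5) /= !inordK //= !D (S 1 ord0) (S ord0 (inord 2)) (S (inord 2) 1).
by ring.
Qed.

Lemma circle_angle (x y : R) : x ^+ 2 + y ^+ 2 = 1 -> exists t, cos t = x /\ sin t = y.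
Proof.
move=> xy.
have x1 : -1 <= x <= 1 by apply/andP; split; nra.
have s2 : Num.sqrt (1 - x ^+ 2) = `|y| by rewrite -xy addrAC subrr add0r sqrtr_sqr.
have [y0|y0] := leP 0 y.
  by exists (acos x); rewrite acosK ?in_itv //= sin_acos // s2 ger0_norm.
by exists (- acos x); rewrite cosN sinN acosK ?in_itv //= sin_acos // s2 ltr0_norm // opprK.
Qed.

(** A is the cross product with a unit vector and Z3 the one with the third basis vector. M carries
    the latter to the former; [be] and [al] are the spherical angles of the axis. *)
Lemma rotation_axis (A : 'M[R]_3) : A^T = - A ->
  A 1 ord0 ^+ 2 + A ord0 (inord 2) ^+ 2 + A (inord 2) 1 ^+ 2 = 1 ->
  exists2 M, SO3 M & A = M *m Z3 *m M^T.
Proof.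
move=> /matrixP aA; have S i j : A j i = - A i j by have := aA i j; rewrite !mxE.
have D i : A i i = 0 by have := S i i; lra.
rewrite [X in exists2 M, _ & X = _]mx3E !D (S 1 ord0) (S ord0 (inord 2)) (S (inord 2) 1).
move: (A 1 ord0) (A ord0 (inord 2)) (A (inord 2) 1) => c b a cba.
have [be [cb sb]] : exists t, cos t = c /\ sin t = Num.sqrt (1 - c ^+ 2).
  by apply: circle_angle; rewrite sqr_sqrtr; [ring|nra].
have sb2 : sin be ^+ 2 = a ^+ 2 + b ^+ 2 by rewrite sb sqr_sqrtr; nra.
have [al [ca sa]] : exists t, sin be * sin t = a /\ sin be * cos t = - b.
  (* On the third axis the angle [al] is undetermined, and 0 will do. *)
  have [s0|s0] := eqVneq (sin be) 0.
    exists 0; rewrite s0 !mul0r; move: sb2; rewrite s0 expr0n /= => ab.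
    by split; nra.
  have [t [ct st]] : exists t, cos t = - b / sin be /\ sin t = a / sin be.
    apply: circle_angle; rewrite !exprMn !exprVn -mulrDl sqrrN addrC -sb2 divff //.
    by rewrite expf_neq0.
  by exists t; rewrite ct st !mulrA ![sin be * _]mulrC !mulfK.
exists (R3 al *m R1 be); first by apply: SO3M; [exact: SO3_R3|exact: SO3_R1].
rewrite R3E /R1 /Z3 mulmx3 trmx3 !mulmx3 -cb -ca.
have -> : b = - (sin be * cos al) by rewrite sa opprK.
have E1 := cos2Dsin2 al; have E2 := cos2Dsin2 be.
move: E1 E2; move: (cos al) (sin al) (cos be) (sin be) => C S' x y E1 E2.
(* Some entries agree only modulo cos^2 + sin^2 = 1 at [al]; the multiplier is then plus or minus
   cos be. *)
have F (a1 a2 a3 : R) : a1 = a2 + a3 * (C ^+ 2 + S' ^+ 2 - 1) -> a1 = a2.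
  by rewrite E1 subrr mulr0 addr0.
by congr mx3; first [ring|apply: (F _ _ x); ring|apply: (F _ _ (- x)); ring].
Qed.

End Minkowski.

(** * One-parameter subgroups of G' *)

Section OneParameter.
Context {R : realType}.
Notation q0 := (qvec : 'cV[R]_5).
Notation e3 := (delta_mx (inord 3) 0 : 'cV[R]_5).

Lemma Xn_e3 (a b : R) : Xn a b 0 *m e3 = 0.
Proof.
by rewrite -colE; cv5_entries.
Qed.

Lemma nexp_e3 (a b s : R) : nexp (Xn a b 0) s *m e3 = e3.
Proof.
rewrite nexpE; last exact: Xn_nilp.
by rewrite !mulmxDl mul1mx -!scalemxAl -mulmxA Xn_e3 mulmx0 !scaler0 !addr0.
Qed.

Lemma SO31_nexp (a b s : R) : SO31 (nexp (Xn a b 0) s).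
Proof. by split; [exact: SO41_nexp|exact: nexp_e3]. Qed.

Lemma one_param_nexp (a b : R) : one_param SO31 (Xn a b 0) (nexp (Xn a b 0)).
Proof.
split; [exact: nexp0|exact: SO31_nexp|].
by move=> s; apply: is_derive_nexp; exact: Xn_nilp.
Qed.

Lemma diag131_e3 (a b : R) (A : 'M[R]_3) : A *m delta_mx (inord 2) 0 = delta_mx (inord 2) 0 :> 'cV_3 ->
  (diag131 a A b : 'M[R]_5) *m e3 = e3.
Proof.
move=> /matrixP AE; rewrite diag131E -colE.
have E i := AE i 0; have := E ord0; have := E 1; have := E (inord 2).
rewrite -!colE !mxE -!val_eqE /= !inordK //= => E2 E1 E0.
by cv5_entries; rewrite -!val_eqE /= ?inordK //= ?E0 ?E1 ?E2.
Qed.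

Lemma is_derive_R3 (s : R) : is_derive s 1 R3 (Z3 *m R3 s).
Proof.
pose P : 'M[R]_3 := mx3 1 0 0 0 1 0 0 0 0.
have E t : R3 t = cos t *: P + (sin t *: Z3 + mx3 0 0 0 0 0 0 0 0 1).
  rewrite R3E; apply/matrixP; apply: ord3P; apply: ord3P; rewrite !mxE /= ?inordK //=; ring.
have ER : R3 = (fun t : R => cos t *: P) +
    ((fun t : R => sin t *: (Z3 : 'M[R]_3)) + cst (mx3 0 0 0 0 0 0 0 0 1)).
  by apply/funext => t; rewrite E.
have dZ (f : R -> R) (f' : R) (M : 'M[R]_3) : is_derive s 1 f f' ->
    is_derive s 1 (fun t => f t *: M) (f' *: M).
  move=> [df Ef]; have dif : differentiable f s by apply/derivable1_diffP.
  apply: DeriveDef.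
    by apply/derivable1_diffP; exact: differentiable_scale.
  by rewrite (derive_scale (F := fun=> M)) // Ef derive_cst scaler0 add0r.
have EZ : Z3 *m R3 s = - sin s *: P + (cos s *: Z3 + 0).
  rewrite R3E /Z3 mulmx3; apply/matrixP; apply: ord3P; apply: ord3P; rewrite !mxE /= ?inordK //=; ring.
rewrite EZ ER.
exact: (is_deriveD (dZ _ _ _ (is_derive_cos s))
  (is_deriveD (dZ _ _ _ (is_derive_sin s)) (is_derive_cst _ _ _))).
Qed.

Lemma diag131_split a b (A : 'M[R]_3) : diag131 a A b = diag131 0 A 0 + diag131 a 0 b.
Proof. by rewrite /diag131 !add_block_mx !addr0 !raddf0 !add0r. Qed.

Lemma is_derive_diag131 (c : R -> 'M[R]_3) (s : R) c' a b :
  is_derive s 1 c c' -> is_derive s 1 (fun t => diag131 a (c t) b : 'M[R]_5) (diag3 c').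
Proof.
move=> dc; pose U : 'M[R]_(1 + (3 + 1), 3) := col_mx 0 (col_mx 1%:M 0).
pose L : {linear 'M[R]_3 -> 'M[R]_5} := mulmxr U^T \o mulmx U.
have LE' A : diag131 0 A 0 = U *m A *m U^T.
  have -> : U *m A = col_mx 0 (col_mx A 0) by rewrite /U !mul_col_mx !mul0mx mul1mx.
  rewrite /U !tr_col_mx !trmx0 trmx1 !mul_col_row !mul0mx !mulmx0 mulmx1.
  by rewrite /diag131 raddf0.
have LE A : diag131 0 A 0 = L A by exact: LE'.
have -> : (fun t => diag131 a (c t) b : 'M[R]_5) = (L \o c) + cst (diag131 a 0 b : 'M[R]_5).
  apply/funext => t; rewrite !fctE /= -[_ *m _ *m _]/(L (c t)) -LE.
  exact: diag131_split.
rewrite diag3E LE -[X in is_derive _ _ _ X]addr0; apply: is_deriveD; exact: is_derive_linear.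
Qed.

Lemma diagrotE (s : R) : diagrot s = diag131 1 (R3 s) 1.
Proof. by []. Qed.

Lemma is_derive_diagrot (s : R) : is_derive s 1 diagrot (diag3 Z3 *m diagrot s).
Proof.
have -> : diag3 Z3 *m diagrot s = diag3 (Z3 *m R3 s).
  rewrite diagrotE !diag3E; apply: etrans (diag131M _ _ _ _ _ _) _.
  by rewrite !mul0r.
exact: (is_derive_diag131 _ _ (is_derive_R3 s)).
Qed.

Lemma diagrot0 : diagrot 0 = 1%:M :> 'M[R]_5.
Proof. by rewrite diagrotE R3_0; exact: diag131_1. Qed.

Lemma SO41_diagrot (s : R) : SO41 (diagrot s).
Proof.
apply: SO41_curve.
- by apply: derive_continuous => t; exact: is_derive_diagrot.
- exact: diagrot0.
- by move=> t; apply: diag1g1_J; case: (SO3_R3 t).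
Qed.

Lemma one_param_rot : one_param SO31 (diag3 Z3) (diagrot : R -> _).
Proof.
split; [exact: diagrot0| |exact: is_derive_diagrot].
move=> s; split; first exact: SO41_diagrot.
rewrite diagrotE; apply: diag131_e3.
rewrite R3E -colE; apply/matrixP => i j; rewrite [j]ord1 {j}; move: i.
by apply: ord3P; rewrite !mxE /= -?val_eqE /= ?inordK //=.
Qed.

Lemma one_paramS (K K' : set 'M[R]_5) X c : K `<=` K' -> one_param K X c -> one_param K' X c.
Proof. by move=> KK' [c0 Kc dc]; split => // s; exact: KK'. Qed.

Lemma SO31_SO41 : (SO31 : set 'M[R]_5) `<=` SO41.
Proof. by move=> h /SO31_sub. Qed.

End OneParameter.

(** * Symmetry breaking operators commute with left derivatives *)

Section HomLeft.
Context {R : realType} {d d' : nat} (rho : set ('M[R]_5 * 'M[R[i]]_d)) (rho' : set ('M[R]_5 * 'M[R[i]]_d')).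
Variable T : {linear sections SO41 rho -> sections SO31 rho'}.
Hypothesis HT : Hom_SO31 rho rho' T.

(* Both sides are the limit of T applied to difference quotients of translates. *)
Lemma Hom_left X c (oc : one_param SO31 X c) (oc' : one_param SO41 X c) f g : SO31 g ->
  T (left_section SO41_group oc' f) g = left_section SO31_group oc (T f) g.
Proof.
move=> Kg; case: HT => cT eT; apply: part_inj => b.
have C1 := @left_quotient_cvg _ _ SO41_group _ _ _ _ oc' f.
have C2 := @left_quotient_cvg _ _ SO31_group _ _ _ _ oc (T f).
have C3 := cvg_comp _ _ C1 (cT _).
have E : T \o (fun s : R => (s^-1)%:C%C *: (ltrans SO41_group (curveV SO41_group oc' s) f - f)) =
  (fun s : R => (s^-1)%:C%C *: (ltrans SO31_group (curveV SO31_group oc s) (T f) - T f)).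
  apply/funext => s /=; rewrite linearZ linearB /=; congr (_ *: (_ - _)).
  rewrite -eT; congr (T (ltrans _ _ _)); exact: Prop_irrelevance.
have C4 : (fun s : R => (s^-1)%:C%C *: (ltrans SO31_group (curveV SO31_group oc s) (T f) - T f)) @ (0 : R)^' -->
  T (left_section SO41_group oc' f) by rewrite -E.
have D2 := @cvg_sections_eval _ _ _ _ _ _ _ _ _ b g Kg C2.
have D4 := @cvg_sections_eval _ _ _ _ _ _ _ _ _ b g Kg C4.
by apply: cvg_unique (D4 _) (D2 _); exact: norm_hausdorff.
Qed.

End HomLeft.

(** * Coordinates on the light cone *)

Section Chart.
Context {R : realType}.
Notation q0 := (qvec : 'cV[R]_5).

Lemma Q41_SO41 (g : 'M[R]_5) x : SO41 g -> Q41 (g *m x) = Q41 x.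
Proof. by move=> /connected_component_sub[_ ->]. Qed.

Lemma Q41_sum (x : 'cV[R]_5) :
  Q41 x = x ord0 0 ^+ 2 + x (inord 1) 0 ^+ 2 + x (inord 2) 0 ^+ 2 + x (inord 3) 0 ^+ 2 - x ord_max 0 ^+ 2.
Proof. by rewrite /Q41 big_mkcond sum5 -!val_eqE /= !inordK //= addr0. Qed.

Lemma cone_point (g : 'M[R]_5) : SO41 g -> Q41 (g *m q0) = 0.
Proof.
move=> Kg; rewrite Q41_SO41 // qvecE Q41_sum !mxE /= !inordK //=; ring.
Qed.

(** A null vector whose last coordinate vanishes is zero, since its other squares then sum to 0. *)
Lemma cone_max_neq0 (g : 'M[R]_5) : SO41 g -> (g *m q0) ord_max 0 != 0.
Proof.
move=> Kg; apply/eqP => y4; have := cone_point Kg; rewrite Q41_sum y4 => H.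
have gu := SO41_unit Kg.
have y0 : g *m q0 = 0.
  have := sqr_ge0 ((g *m q0) ord0 0); have := sqr_ge0 ((g *m q0) (inord 1) 0).
  have := sqr_ge0 ((g *m q0) (inord 2) 0); have := sqr_ge0 ((g *m q0) (inord 3) 0).
  move=> h3 h2 h1 h0.
  apply/matrixP => i j; rewrite [j]ord1 {j} [RHS]mxE; move: i.
  by apply: ord5P => //; apply/eqP; rewrite -sqrf_eq0; apply/eqP; lra.
have : q0 = 0 by rewrite -(mulKmx gu q0) y0 mulmx0.
by rewrite qvecE => /matrixP /(_ ord0 0); rewrite !mxE /=; apply/eqP; exact: oner_neq0.
Qed.

Definition lightc (i : 'I_5) (g : 'M[R]_5) : R := (g *m q0) i 0.
Definition height (g : 'M[R]_5) : R := lightc ord_max g - lightc ord0 g.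
(* The coordinates of S^3 minus the base point, where height vanishes (and chart
   takes the junk value 0). *)
Definition chart (i : 'I_5) (g : 'M[R]_5) : R := lightc i g / height g.

Lemma smooth_lightc (i : 'I_5) (U : set 'M[R]_5) : open U -> smooth_on U (lightc i).
Proof.
move=> oU; rewrite (_ : lightc i = fun g => g i ord0 + g i ord_max).
  by apply: smooth_onD => //; apply: (@smooth_on_lin_entry _ _ _ _ idfun); move=> x A.
by apply/funext => g; rewrite /lightc /qvec mulmxDr -!colE !mxE.
Qed.

Lemma smooth_height (U : set 'M[R]_5) : open U -> smooth_on U height.
Proof.
move=> oU; have -> : height = fun g => lightc ord_max g + (-1) *: lightc ord0 g.
  by apply/funext => g; rewrite /height scaleN1r.
apply: smooth_onD => //; first exact: smooth_lightc.
by apply: smooth_onZ => //; [exact: smooth_on_cst|exact: smooth_lightc].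
Qed.

Lemma smooth_chart (i : 'I_5) (U : set 'M[R]_5) : open U -> (forall g, U g -> height g != 0) ->
  smooth_on U (chart i).
Proof.
move=> oU h0; have -> : chart i = fun g => lightc i g *: (height g)^-1 by [].
apply: smooth_onZ => //; first exact: smooth_lightc.
by apply: smooth_onV => //; exact: smooth_height.
Qed.

Lemma continuous_lightc (i : 'I_5) : continuous (lightc i).
Proof.
move=> g; apply: differentiable_continuous.
by apply: (smooth_on_diff (U := setT)) => //; apply: smooth_lightc; exact: openT.
Qed.

Lemma continuous_height : continuous height.
Proof.
move=> g; apply: differentiable_continuous.
by apply: (smooth_on_diff (U := setT)) => //; apply: smooth_height; exact: openT.
Qed.

Lemma is_derive_lightc i (c : R -> 'M[R]_5) (t : R) V :
  is_derive t 1 c V -> is_derive t 1 (lightc i \o c) (lightc i V).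
Proof.
move=> dc; have [dcq Eq] := is_derive_linear (mulmxr q0) dc.
apply: DeriveDef; first exact: ((derivable_mxP _ _ _).1 dcq).
by rewrite /lightc -[V *m q0]/(mulmxr q0 V) -Eq derive_mx // mxE.
Qed.

Lemma is_derive_height (c : R -> 'M[R]_5) (t : R) V :
  is_derive t 1 c V -> is_derive t 1 (height \o c) (height V).
Proof. by move=> dc; apply: is_deriveB; exact: is_derive_lightc. Qed.

Lemma is_derive_chart i (c : R -> 'M[R]_5) (t : R) V : height (c t) != 0 ->
  is_derive t 1 c V -> is_derive t 1 (chart i \o c) ((lightc i V - chart i (c t) * height V) / height (c t)).
Proof.
move=> h0 dc; have dl := is_derive_lightc i dc; have dh := is_derive_height dc.
have dv := @is_deriveV _ (height \o c) t _ 1 h0 dh.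
have [d1 E1] := is_deriveM dl dv.
have -> : chart i \o c = (lightc i \o c) * (fun y => (height (c y))^-1) by [].
apply: DeriveDef => //; rewrite E1 /= /chart /GRing.scale /=.
by move: (height (c t)) h0 => h h0; field.
Qed.

End Chart.

(** * Gradients of sections, and vector fields that fix a point of the sphere *)

Section Gradient.
Context {R : realType} (K : set 'M[R]_5) {d : nat} (rho : set ('M[R]_5 * 'M[R[i]]_d)).

(** One real-linear G computes the derivative along every curve of K through g. Left and right
    motions thus become comparable: only their velocity at g matters. *)
Lemma section_gradient (f : sections K rho) g : K g ->
  exists2 G : 'M[R]_5 -> 'cV[R[i]]_d, (forall (r : R) V W, G (r *: V + W) = r%:C%C *: G V + G W) &
  forall (c : R -> 'M[R]_5) V, c 0 = g -> (forall s, K (c s)) -> is_derive (0 : R) 1 c V ->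
    is_cderive (f \o c) 0 (G V).
Proof.
move=> Kg.
have H b : exists2 G : 'M[R]_5 -> 'cV[R]_d, (forall (r : R) V W, G (r *: V + W) = r *: G V + G W) &
  forall (c : R -> 'M[R]_5) V, c 0 = g -> (forall s, K (c s)) -> is_derive (0 : R) 1 c V ->
    is_derive (0 : R) 1 (part b \o (f \o c)) (G V).
  have [U [F [oU Ug sF uF]]] := section_smooth f b Kg.
  have dF : differentiable F g by exact: smooth_on_diff sF _.
  exists (fun V => 'D_V F g) => [r V W|c V c0 Kc dc]; first exact: derive_linear.
  have dF' : differentiable F (c 0) by rewrite c0.
  have := is_derive_comp_curve dF' dc; rewrite c0.
  apply: near_eq_is_derive; near=> t; apply/esym/uF => //.
  near: t; have dct : differentiable c 0 by apply/derivable1_diffP; case: dc.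
  apply: (differentiable_continuous dct).
  by rewrite c0; exact: open_nbhs_nbhs.
have [G0 L0 H0] := H false; have [G1 L1 H1] := H true.
exists (fun V => cplx (G0 V) (G1 V)).
  by move=> r V W; apply: part_inj => -[]; rewrite partD partZ !part_cplx.
move=> c V c0 Kc dc b; rewrite part_cplx.
by case: b; [exact: H1|exact: H0].
Unshelve. all: by end_near. Qed.

Lemma left_fun_gradient (gK : matrix_group K) X c (oc : one_param K X c) (f : sections K rho) g G : K g ->
  (forall (c : R -> 'M[R]_5) V, c 0 = g -> (forall s, K (c s)) -> is_derive (0 : R) 1 c V ->
    is_cderive (f \o c) 0 (G V)) -> left_fun (c := c) f g = G (X *m g).
Proof.
move=> Kg HG; have [c0 Kc dc] := oc.
apply: (is_cderive_unique (is_cderive_left gK oc f Kg)).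
apply: (HG (fun s => c s *m g)); first by rewrite c0 mul1mx.
  by move=> s; apply: matrix_groupM.
have := is_derive_linear (mulmxr g) (dc 0).
by rewrite /= c0 mulmx1.
Qed.

End Gradient.

Section PointStabilizer.
Context {R : realType}.
Notation q0 := (qvec : 'cV[R]_5).

Lemma lightc_X1 (g : 'M[R]_5) : [/\ lightc (inord 1) (Xn 1 0 0 *m g) = height g,
  lightc (inord 2) (Xn 1 0 0 *m g) = 0 & height (Xn 1 0 0 *m g) = 0].
Proof.
rewrite /height /lightc -mulmxA; move: (g *m q0) => y.
by split; rewrite !(mxE, sum5) /= ?inordK //=; ring.
Qed.

Lemma lightc_X2 (g : 'M[R]_5) : [/\ lightc (inord 1) (Xn 0 1 0 *m g) = 0,
  lightc (inord 2) (Xn 0 1 0 *m g) = height g & height (Xn 0 1 0 *m g) = 0].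
Proof.
rewrite /height /lightc -mulmxA; move: (g *m q0) => y.
by split; rewrite !(mxE, sum5) /= ?inordK //=; ring.
Qed.

Lemma Xn_lin (a b : R) : Xn a b 0 = a *: Xn 1 0 0 + b *: Xn 0 1 0.
Proof.
apply/matrixP; apply: ord5P; [apply: ord5P|apply: ord5P|apply: ord5P|apply: ord5P|apply: ord5P];
  rewrite !mxE /= ?inordK //=; ring.
Qed.

Lemma diag3_Z3 : diag3 Z3 = mx5 [:: [:: 0; 0; 0; 0; 0]; [:: 0; 0; -1; 0; 0];
  [:: 0; 1; 0; 0; 0]; [:: 0; 0; 0; 0; 0]; [:: 0; 0; 0; 0; 0]] :> 'M[R]_5.
Proof. by rewrite /diag3 /Z3 !mxE /= ?inordK. Qed.

(* Z + x_2 X_1 - x_1 X_2 *)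
Definition stab (g : 'M[R]_5) : 'M[R]_5 :=
  diag3 Z3 + Xn (chart (inord 2) g) (- chart (inord 1) g) 0.

(** In the chart Z moves (x_1, x_2) by (- x_2, x_1), and the translation by (x_2, - x_1) undoes
    this. *)
Lemma stab_q (g : 'M[R]_5) : height g != 0 -> stab g *m (g *m q0) = 0.
Proof.
rewrite /stab /chart /height /lightc diag3_Z3; move: (g *m q0) => y h0.
by rewrite mulmxDl; cv5_entries; field.
Qed.

Lemma stab_skew g : (J5 *m stab g)^T = - (J5 *m stab g).
Proof.
rewrite trmx_mul J5_tr linearD /= mulmxDl Xn_skew mulmxDr opprD; congr (_ + _).
rewrite !diag3E J5E.
transitivity ((diag131 0 (Z3 : 'M[R]_3) 0)^T *m diag131 1 1%:M (-1)) => //.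
rewrite tr_diag131 diag131M !mul0r mulmx1.
transitivity (- (diag131 1 1%:M (-1) *m diag131 0 (Z3 : 'M[R]_3) 0)) => //.
rewrite diag131M !mulr0 mul1mx /diag131 !opp_block_mx !raddf0.
suff -> : Z3^T = - Z3 :> 'M[R]_3 by [].
rewrite /Z3 trmx3; by apply/matrixP; apply: ord3P; apply: ord3P; rewrite !mxE /= ?inordK //= ?oppr0 ?opprK.
Qed.

Lemma stab_trace g : \tr (stab g *m stab g) = - 2.
Proof.
rewrite trace_split; last first.
  by rewrite /Z3 trmx3; apply/matrixP; apply: ord3P; apply: ord3P; rewrite !mxE /= ?inordK //= ?oppr0 ?opprK.
rewrite /Z3 !mxE /= ?inordK //=; ring.
Qed.

(** Conjugated by g, the field kills the base vector, so it splits into a rotation generator and an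
    element of n_+. The invariant trace form shows that the rotation has unit speed. *)
Lemma stab_split (g : 'M[R]_5) : SO41 g -> height g != 0 ->
  exists M a b c, SO3 M /\ stab g *m g = g *m (diag3 (M *m Z3 *m M^T) + Xn a b c).
Proof.
move=> Kg h0; have gJ := SO41_J Kg.
have gV : J5 *m g^T *m J5 *m g = 1%:M by rewrite -!mulmxA (mulmxA g^T) gJ J5_sq.
have gV' : g *m (J5 *m g^T *m J5) = 1%:M by exact: mulmx1C.
(* Since J5 g^T J5 is the inverse of g, J5 K is g^-1 (stab g) g; K itself is skew, as
   [parabolic_split] requires. *)
pose K := g^T *m (J5 *m stab g) *m g.
have KT : K^T = - K.
  by rewrite /K !trmx_mul trmxK -trmx_mul stab_skew mulNmx mulmxN mulmxA.
have Kq : K *m q0 = 0.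
  by rewrite /K -!mulmxA stab_q // !mulmx0.
have [A [a [b [c [AT JK]]]]] := parabolic_split KT Kq.
have gY : stab g *m g = g *m (diag3 A + Xn a b c).
  rewrite -JK /K; move: (stab g) gV' => W gV'.
  by rewrite !mulmxA -(mulmxA g J5) -(mulmxA g (J5 *m g^T)) gV' mul1mx.
have trA : - 2 * (A 1 ord0 ^+ 2 + A ord0 (inord 2) ^+ 2 + A (inord 2) 1 ^+ 2) = - 2.
  rewrite -(trace_split a b c AT) -(stab_trace g).
  set Y := diag3 A + Xn a b c in gY *.
  have -> : Y *m Y = (J5 *m g^T *m J5) *m (stab g *m stab g *m g).
    by rewrite -(mulmxA _ _ g) gY !mulmxA -(mulmxA _ _ g) gY !mulmxA gV mul1mx.
  by rewrite mxtrace_mulC -(mulmxA (stab g *m stab g)) gV' mulmx1.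
have [M SM AM] := rotation_axis AT (ltac:(move: trA; clear; lra)).
by exists M, a, b, c; rewrite -AM.
Qed.

End PointStabilizer.

(** * Multiplication by coordinates of sections that vanish near the base point *)

Section ChartMultiplication.
Context {R : realType} {d : nat} (sigma : 'M[R]_3 -> 'M[R[i]]_d) (lambda : R[i]).
Notation rho := (P_rep sigma lambda).
Notation sec := (sections SO41 rho).
Implicit Types (f : sec) (g : 'M[R]_5).

(* The inequality defines a neighbourhood of the base point of S^3. *)
Definition away (r : R) f := forall g, SO41 g -> `|height g| < r * `|lightc ord_max g| -> f g = 0.

Lemma P_rep_q qA : rho qA -> exists2 k : R, 0 < k & qA.1 *m qvec = k *: (qvec : 'cV[R]_5).
Proof.
move=> [M [t [n [_ nn -> _]]]]; exists (expR t); first exact: expR_gt0.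
by rewrite -!mulmxA (Nplus_q nn) mexpH0_q -scalemxAr diag1g1_q.
Qed.

(** P rescales the base vector and [chart] is homogeneous of degree 0 in g q, hence a function on
    S^3. Multiplying by it preserves equivariance. *)
Lemma chart_P i g qA : rho qA -> chart i (g *m qA.1) = chart i g.
Proof.
move=> /P_rep_q[k k0 E]; have k1 : k != 0 by rewrite gt_eqF.
rewrite /chart /height /lightc -mulmxA E -scalemxAr; move: (g *m qvec) => y.
by rewrite !mxE -mulrBr invfM mulrACA divff // mul1r.
Qed.

Lemma continuous_gap (r : R) : continuous (fun x : 'M[R]_5 => r * `|lightc ord_max x| - `|height x|).
Proof.
move=> x; have FF : Filter (nbhs x) by exact: nbhs_filter.
have c1 := cvg_norm (@continuous_lightc R ord_max x).
have c2 := cvg_norm (@continuous_height R x).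
exact: (cvgB (cvgM (cvg_cst r) (c1 FF)) (c2 FF)).
Qed.

Fact chart_section_subproof i r f : 0 < r -> away r f ->
  (fun g => (chart i g)%:C%C *: f g) \in is_section SO41 rho.
Proof.
move=> r0 af; rewrite inE; split.
- by move=> g Kg; rewrite section_out ?scaler0.
(* Where the coordinate has its pole, f vanishes on a whole neighbourhood, so 0 is a smooth local
   extension of the product. *)
- move=> b g Kg; have [h0|h0] := eqVneq (height g) 0.
    exists [set x | `|height x| < r * `|lightc ord_max x|], (fun=> 0); split.
    + rewrite (_ : [set x | _] = 
          (fun x : 'M[R]_5 => r * `|lightc ord_max x| - `|height x|) @^-1` [set y | 0 < y]).
        by apply: open_comp; [move=> x _; exact: continuous_gap|exact: open_gt].
      by apply/funext => x /=; rewrite subr_gt0.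
    + by rewrite /= h0 normr0 mulr_gt0 // normr_gt0; exact: cone_max_neq0.
    + exact: smooth_on_cst.
    + by move=> x Ux Kx; rewrite af // scaler0 part0.
  have [U [F [oU Ug sF uF]]] := section_smooth f b Kg.
  have oV : open [set x : 'M[R]_5 | height x != 0].
    rewrite (_ : [set x | _] = height @^-1` [set y | y != 0]) //.
    apply: open_comp; last exact: open_neq.
    by move=> x _; exact: continuous_height.
  have oW := openI oU oV.
  exists (U `&` [set x | height x != 0]), (fun x => chart i x *: F x); split => //.
    apply: smooth_onZ => //; first by apply: smooth_chart => // x [].
    by apply: smooth_onS sF => x [].
  by move=> x [Ux _] Kx; rewrite partZ -uF.
- by move=> g qA Kg rq; rewrite (chart_P _ _ rq) (section_equi f Kg rq) -scalemxAr.
Qed.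

(** The default value 0 makes this total, so that [Xi r] is defined on all sections and can be
    iterated. *)
Definition chart_mul (r : R) i f : sec :=
  match pselect (0 < r /\ away r f) with
  | left H => Section (chart_section_subproof i H.1 H.2)
  | right _ => 0
  end.

Lemma chart_mulE r i f g : 0 < r -> away r f -> chart_mul r i f g = (chart i g)%:C%C *: f g.
Proof. by move=> r0 af; rewrite /chart_mul; case: pselect => // -[]. Qed.

Lemma away_chart_mul r i f : 0 < r -> away r f -> away r (chart_mul r i f).
Proof. by move=> r0 af g Kg Hg; rewrite chart_mulE // af // scaler0. Qed.

(** The inequality on g is an open condition, so f is zero on a short piece of the curve s |-> c s
    g. *)
Lemma away_left r f X c (oc : one_param SO41 X c) : away r f -> away r (left_section SO41_group oc f).
Proof.
move=> af g Kg Hg; apply: (is_cderive_unique (is_cderive_left SO41_group oc f Kg)).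
move=> b; rewrite part0; have [c0 Kc dc] := oc.
have : is_derive (0 : R) 1 (fun=> 0 : 'cV[R]_d) 0 by exact: is_derive_cst.
apply: near_eq_is_derive.
have cc : (fun s : R => c s *m g) @ (0 : R) --> g.
  have dcg := is_derive_linear (mulmxr g) (dc 0).
  have : differentiable (fun s : R => c s *m g) 0 by apply/derivable1_diffP; case: dcg.
  move=> /differentiable_continuous H; have E : c 0 *m g = g by rewrite c0 mul1mx.
  by rewrite -[X in _ --> X]E; exact: H.
have c1 : (fun s : R => r * `|lightc ord_max (c s *m g)| - `|height (c s *m g)|) @ (0 : R) -->
    r * `|lightc ord_max g| - `|height g|.
  exact: (cvg_comp _ _ cc (@continuous_gap r g)).
have := cvgr_gt _ c1 0; rewrite subr_gt0 => /(_ _ Hg).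
apply: filterS => s; rewrite subr_gt0 /= => Hs.
rewrite af ?part0 //; exact: (matrix_groupM SO41_group).
Qed.

Lemma awayB r f f' : away r f -> away r f' -> away r (f - f').
Proof. by move=> af af' g Kg Hg; rewrite -[(f - f') g]/(f g - f' g) af // af' // subrr. Qed.

End ChartMultiplication.

(** * The operator Xi and the functional f |-> (T f)(1) *)

Section SymmetryBreakingAtBasePoint.
Context {R : realType} {n : nat} (sigma : 'M[R]_3 -> 'M[R[i]]_n.+1) (lambda nu : R[i]) (m : int).
Hypothesis s1 : sigma 1%:M = 1%:M.
Hypothesis sM : {in SO3 &, forall g h, sigma (g *m h) = sigma g *m sigma h}.
Hypothesis sc : forall b, {within SO3, continuous (part b \o sigma)}.
Notation rho := (P_rep sigma lambda).
Notation rho' := (P'_rep m nu).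
Notation sec := (sections SO41 rho).
Implicit Types (f : sec) (g : 'M[R]_5).

Lemma cexp0 : cexp 0 = 1 :> R[i].
Proof. by rewrite /cexp /= expR0 cos0 sin0 mul1r. Qed.

Lemma SO3_1 : SO3 (1%:M : 'M[R]_3).
Proof. by split; [rewrite trmx1 mulmx1|rewrite det1]. Qed.

Lemma diag1g1_1 : diag1g1 1%:M = 1%:M :> 'M[R]_5.
Proof. exact: diag131_1. Qed.

Lemma mexp0H : mexp ((0 : R) *: H_0) = 1%:M.
Proof. by rewrite scale0r mexp0. Qed.

Lemma section_diag1g1 f g h : SO41 g -> SO3 h -> f g = sigma h *m f (g *m diag1g1 h).
Proof.
move=> Kg Sh.
have rq : rho (diag1g1 h, sigma h).
  exists h, 0, 1%:M; split => //=.
  - by rewrite -(nexp0 (Xn 0 0 0)); exact: Nplus_nexp.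
  - by rewrite mexp0H !mulmx1.
  - by rewrite mulr0 cexp0 scale1r.
rewrite (section_equi f Kg rq) /= mulKVmx //.
by have := sigmaV s1 sM Sh => /mulmx1_unit[].
Qed.

Lemma section_nexp f g a b c s : SO41 g -> f (g *m nexp (Xn a b c) s) = f g.
Proof.
move=> Kg.
have rq : rho (nexp (Xn a b c) s, 1%:M).
  exists 1%:M, 0, (nexp (Xn a b c) s); split => //=.
  - exact: SO3_1.
  - exact: Nplus_nexp.
  - by rewrite mexp0H mulmx1 diag1g1_1 mul1mx.
  - by rewrite mulr0 cexp0 scale1r s1.
by rewrite (section_equi f Kg rq) /= invmx1 mul1mx.
Qed.

Definition param1 : one_param SO41 _ _ := one_paramS (@SO31_SO41 R) (one_param_nexp 1 0).
Definition param2 : one_param SO41 _ _ := one_paramS (@SO31_SO41 R) (one_param_nexp 0 1).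
Definition paramZ : one_param SO41 _ _ := one_paramS (@SO31_SO41 R) (@one_param_rot R).

Definition Xi r f : sec := left_section SO41_group param2 (chart_mul r (inord 1) f)
  - left_section SO41_group param1 (chart_mul r (inord 2) f) - left_section SO41_group paramZ f.

Lemma away_Xi r f : 0 < r -> away r f -> away r (Xi r f).
Proof.
by move=> r0 af; apply: awayB; [apply: awayB|]; apply: away_left => //; exact: away_chart_mul.
Qed.

Lemma left_chart_mul r i f g G X c (oc : one_param SO41 X c) : 0 < r -> away r f -> SO41 g -> height g != 0 ->
  (forall (c : R -> 'M[R]_5) V, c 0 = g -> (forall s, SO41 (c s)) -> is_derive (0 : R) 1 c V ->
    is_cderive (f \o c) 0 (G V)) ->
  left_fun (c := c) (chart_mul r i f) g =
    ((lightc i (X *m g) - chart i g * height (X *m g)) / height g)%:C%C *: f g +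
    (chart i g)%:C%C *: G (X *m g).
Proof.
move=> r0 af Kg h0 HG; have [c0 Kc dc] := oc.
apply: (is_cderive_unique (is_cderive_left SO41_group oc _ Kg)).
have cg0 : c 0 *m g = g by rewrite c0 mul1mx.
have dcg : is_derive (0 : R) 1 (fun s => c s *m g) (X *m g).
  by have := is_derive_linear (mulmxr g) (dc 0); rewrite /= c0 mulmx1.
have Kcg s : SO41 (c s *m g) by exact: (matrix_groupM SO41_group).
have h0' : height (c 0 *m g) != 0 by rewrite cg0.
have dch := @is_derive_chart _ i (fun s => c s *m g) 0 _ h0' dcg.
have df := HG (fun s => c s *m g) _ cg0 Kcg dcg.
have := is_cderive_mulmx (is_cderive_scale (1%:M : 'M[R[i]]_n.+1) dch) df.
rewrite /= cg0 -!scalemxAl !mul1mx.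
congr (is_cderive _ _ _); apply/funext => s.
by rewrite -scalemxAl mul1mx chart_mulE.
Qed.

Context {D : 'M[R[i]]_n.+1} (gD : cgroup (fun s => sigma (R3 s)) D).

Lemma gradient_rot f g G M : SO41 g -> SO3 M ->
  (forall (c : R -> 'M[R]_5) V, c 0 = g -> (forall s, SO41 (c s)) -> is_derive (0 : R) 1 c V ->
    is_cderive (f \o c) 0 (G V)) ->
  G (g *m diag3 (M *m Z3 *m M^T)) = - (sigma M *m D *m sigma M^T *m f g).
Proof.
move=> Kg SM HG; have [S0 SD dS] := gD.
have SMt := SO3_tr SM; have MM : M *m M^T = 1%:M by have [/mulmx1C] := SM.
pose c s := g *m diag1g1 (M *m R3 s *m M^T).
have SR s : SO3 (M *m R3 s *m M^T) by apply: SO3M => //; apply: SO3M => //; exact: SO3_R3.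
have c0 : c 0 = g by rewrite /c R3_0 mulmx1 MM diag1g1_1 mulmx1.
have Kc s : SO41 (c s).
  apply: (matrix_groupM SO41_group) => //.
  apply: (@SO41_curve R (fun s => diag1g1 (M *m R3 s *m M^T))).
  - apply: derive_continuous => t; apply: is_derive_diag131.
    apply: (is_derive_linear (mulmxr M^T)); apply: (is_derive_linear (mulmx M)); exact: is_derive_R3.
  - by rewrite R3_0 mulmx1 MM; exact: diag131_1.
  - by move=> t; apply: diag1g1_J; case: (SR t).
have dc : is_derive (0 : R) 1 c (g *m diag3 (M *m Z3 *m M^T)).
  apply: (is_derive_linear (mulmx g)); apply: is_derive_diag131.
  apply: (is_derive_linear (mulmxr M^T)); apply: (is_derive_linear (mulmx M)).
  by have := is_derive_R3 (0 : R); rewrite R3_0 mulmx1.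
have dl := is_cderive_mulr (sigma M^T) (is_cderive_mull (sigma M) (dS 0)).
have := is_cderive_mulmx dl (HG c _ c0 Kc dc).
rewrite /= S0 mul1mx mulmx1 c0 sigmaV // mul1mx => H.
have H0 := is_cderive_cst (f g) 0.
(* Equivariance under M makes this curve constant; its vanishing derivative expresses G through
   D. *)
have E : (fun s => sigma M *m sigma (R3 s) *m sigma M^T *m f (c s)) = (fun=> f g).
  apply/funext => s; rewrite (sigmaM3 sM) //; last exact: SO3_R3.
  by rewrite -section_diag1g1.
rewrite E in H; have := is_cderive_unique H H0 => /eqP.
by rewrite addrC addr_eq0 => /eqP.
Qed.

Lemma gradient_nexp f g G a b c : SO41 g ->
  (forall (c : R -> 'M[R]_5) V, c 0 = g -> (forall s, SO41 (c s)) -> is_derive (0 : R) 1 c V ->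
    is_cderive (f \o c) 0 (G V)) ->
  G (g *m Xn a b c) = 0.
Proof.
move=> Kg HG; have H : is_cderive (f \o (fun s => g *m nexp (Xn a b c) s)) 0 (G (g *m Xn a b c)).
  apply: HG; first by rewrite nexp0 mulmx1.
    by move=> s; apply: (matrix_groupM SO41_group) => //; exact: SO41_nexp.
  apply: (is_derive_linear (mulmx g)); have := @is_derive_nexp R (Xn a b c) 0 (Xn_nilp a b c).
  by rewrite nexp0 mulmx1.
have E : f \o (fun s => g *m nexp (Xn a b c) s) = fun=> f g.
  by apply/funext => s /=; exact: section_nexp.
rewrite E in H; exact: (is_cderive_unique H (is_cderive_cst _ _)).
Qed.

(** M depends on g but not on f, so the same conjugate of D serves for every iterate of [Xi r] at g,
    hence for every polynomial in it. *)
Lemma Xi_conj r g : 0 < r -> SO41 g -> exists2 M, SO3 M &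
  forall f, away r f -> Xi r f g = sigma M *m D *m sigma M^T *m f g.
Proof.
move=> r0 Kg; have [h0|h0] := eqVneq (height g) 0.
  exists 1%:M; first exact: SO3_1.
  have near0 : `|height g| < r * `|lightc ord_max g|.
    by rewrite h0 normr0 mulr_gt0 // normr_gt0; exact: cone_max_neq0.
  by move=> f af; rewrite (away_Xi r0 af Kg near0) (af _ Kg near0) mulmx0.
have [M [a [b [c [SM WM]]]]] := stab_split Kg h0.
exists M => // f af; have [G GL HG] := section_gradient f Kg.
have GD V W : G (V + W) = G V + G W by have := GL 1 V W; rewrite !scale1r.
have G0 : G 0 = 0 by have := GD 0 0; rewrite addr0 => /eqP; rewrite -subr_eq0 opprD addNKr oppr_eq0 => /eqP.
have GZ (t : R) V : G (t *: V) = t%:C%C *: G V by have := GL t V 0; rewrite !addr0 G0 addr0.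
have EW : G (stab g *m g) = - (sigma M *m D *m sigma M^T *m f g).
  by rewrite WM mulmxDr GD (gradient_rot Kg SM HG) (gradient_nexp _ _ _ Kg HG) addr0.
transitivity (- G (stab g *m g)); last by rewrite EW opprK.
have -> : Xi r f g = left_fun (c := nexp (Xn 0 1 0)) (chart_mul r (inord 1) f) g -
   left_fun (c := nexp (Xn 1 0 0)) (chart_mul r (inord 2) f) g - left_fun (c := diagrot) f g by [].
rewrite (left_chart_mul (inord 1) param2 r0 af Kg h0 HG) (left_chart_mul (inord 2) param1 r0 af Kg h0 HG).
rewrite (left_fun_gradient SO41_group paramZ Kg HG).
(* X_2 x_1 and X_1 x_2 vanish, so the Leibniz terms without derivative of f disappear. *)
have [-> _ ->] := lightc_X2 g; have [_ -> ->] := lightc_X1 g.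
rewrite !mulr0 !subr0 !mul0r !scale0r !add0r.
have GN V : G (- V) = - G V by apply/eqP; rewrite -addr_eq0 -GD addNr G0.
have -> : stab g *m g = diag3 Z3 *m g +
    (chart (inord 2) g *: (Xn 1 0 0 *m g) - chart (inord 1) g *: (Xn 0 1 0 *m g)).
  by rewrite /stab Xn_lin !mulmxDl -!scalemxAl scaleNr.
rewrite !GD GN !GZ !opprD opprK.
by rewrite addrC; congr (_ + _); exact: addrC.
Qed.

Lemma iter_Xi r f k : 0 < r -> away r f -> away r (iter k (Xi r) f).
Proof. by move=> r0 af; elim: k => //= k IH; exact: away_Xi. Qed.

Lemma Xi_poly r f (p : {poly R[i]}) g : 0 < r -> away r f -> SO41 g -> exists2 M, SO3 M &
  (\sum_(k < size p) p`_k *: iter k (Xi r) f : sec) g = sigma M *m horner_mx D p *m sigma M^T *m f g.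
Proof.
move=> r0 af Kg; have [M SM HM] := Xi_conj r0 Kg; exists M => //.
have MM : sigma M^T *m sigma M = 1%:M by apply: mulmx1C; exact: sigmaV.
have Hk k : iter k (Xi r) f g = sigma M *m D ^+ k *m sigma M^T *m f g.
  elim: k => [|k IH]; first by rewrite expr0 mulmx1 sigmaV // mul1mx.
  rewrite iterS HM; last exact: iter_Xi.
  rewrite IH !mulmxA -(mulmxA _ (sigma M^T) (sigma M)) MM mulmx1 exprS -(mulmxA (sigma M) D (D ^+ k)).
  by [].
have -> : (\sum_(k < size p) p`_k *: iter k (Xi r) f : sec) g = \sum_(k < size p) p`_k *: iter k (Xi r) f g.
  have : forall s : seq 'I_(size p), (\sum_(k <- s) p`_k *: iter k (Xi r) f : sec) g =
      \sum_(k <- s) p`_k *: iter k (Xi r) f g.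
    by elim=> [|k s IH]; rewrite ?big_nil ?big_cons // -IH.
  exact.
rewrite -[p in RHS]coefK poly_def linear_sum /= mulmx_sumr !mulmx_suml; apply: eq_bigr => k _.
rewrite linearZ /= rmorphXn /= horner_mx_X Hk.
by rewrite -scalemxAr -!scalemxAl.
Qed.

Variable T : {linear sec -> sections SO31 rho'}.
Hypothesis HT : Hom_SO31 rho rho' T.
Notation T1 f := (T f 1%:M).

Lemma SO31_1 : SO31 (1%:M : 'M[R]_5).
Proof. by case: (@SO31_group R). Qed.

(** At the identity left and right translation by N'_+ coincide, and N'_+ acts trivially on the
    fibre: T f is constant along the subgroup. *)
Lemma Hom_nexp a b f (oc : one_param SO41 (Xn a b 0) (nexp (Xn a b 0))) :
  T1 (left_section SO41_group oc f) = 0.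
Proof.
rewrite (Hom_left HT (one_param_nexp a b)); last exact: SO31_1.
apply: (is_cderive_unique (is_cderive_left SO31_group (one_param_nexp a b) (T f) SO31_1)).
have -> : (fun s => T f (nexp (Xn a b 0) s *m 1%:M)) = (fun=> T1 f).
  apply/funext => s; rewrite mulmx1.
  have rq : rho' (nexp (Xn a b 0) s, 1%:M).
    exists 0, 0, (nexp (Xn a b 0) s); split => /=.
    - exact: Nplus_nexp.
    - exact: SO31_nexp.
    - by rewrite mexp0H diagrot0 !mul1mx.
    - by rewrite !mulr0 -[(0 +i* 0)%C]/(0 : R[i]) cexp0 mulr1.
  have := section_equi (T f) SO31_1 rq.
  by rewrite /= mul1mx invmx1 mul1mx.
exact: is_cderive_cst.
Qed.

Lemma is_cderive_cexp :
  is_cderive (fun s => (cexp (0 +i* (m%:~R * s))%C)%:M : 'M[R[i]]_1) 0 (('i%C * m%:~R)%:M).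
Proof.
move=> b; have dm : is_derive (0 : R) 1 (fun s : R => m%:~R * s) m%:~R.
  have := is_deriveZ (m%:~R : R) (@is_derive_id _ R (0 : R) 1).
  by rewrite -[X in is_derive _ _ _ X -> _]/(m%:~R * 1) mulr1.
have dc : is_derive (0 : R) 1 (fun s : R => cos (m%:~R * s)) 0.
  apply: (is_derive_eq (is_derive1_comp (is_derive_cos _) dm)).
  by rewrite mulr0 sin0 oppr0 /GRing.scale /= ?mul0r ?mulr0.
have ds : is_derive (0 : R) 1 (fun s : R => sin (m%:~R * s)) m%:~R.
  apply: (is_derive_eq (is_derive1_comp (is_derive_sin _) dm)).
  by rewrite mulr0 cos0 /GRing.scale /= ?mul1r ?mulr1.
have E : part b \o (fun s => (cexp (0 +i* (m%:~R * s))%C)%:M : 'M[R[i]]_1) =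
  fun s => (if b then sin (m%:~R * s) else cos (m%:~R * s)) *: 1%:M.
  apply/funext => s; apply/matrixP => i j; rewrite /cexp /= expR0 mul1r !mxE (ord1 i) (ord1 j) eqxx !mulr1n mulr1.
  by case: b.
have imE : 'i%C * m%:~R = (0 +i* m%:~R)%C :> R[i].
  rewrite -[m%:~R in LHS](rmorph_int (real_complex R)) /=.
  by apply/eqP; rewrite eq_complex /=; apply/andP; split; apply/eqP; ring.
have -> : part b ('i%C * m%:~R)%:M = (if b then m%:~R else 0) *: 1%:M :> 'M[R]_1.
  by apply/matrixP => i j; rewrite imE !mxE (ord1 i) (ord1 j) eqxx !mulr1n mulr1; case: (b).
rewrite E; case: b {E} => /=.
  have [d1 E1] := ds; have dif : differentiable (fun s : R => sin (m%:~R * s)) 0 by apply/derivable1_diffP.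
  apply: DeriveDef; first by apply/derivable1_diffP; exact: differentiable_scale.
  by rewrite (derive_scale (F := fun=> 1%:M)) // E1 derive_cst scaler0 add0r.
have [d1 E1] := dc; have dif : differentiable (fun s : R => cos (m%:~R * s)) 0 by apply/derivable1_diffP.
apply: DeriveDef; first by apply/derivable1_diffP; exact: differentiable_scale.
by rewrite (derive_scale (F := fun=> 1%:M)) // E1 derive_cst scaler0 add0r.
Qed.

(** Equivariance involves the inverse of the character, whence the sign: T f at the rotation by s is
    e^(-i m s) times its value at 1. *)
Lemma Hom_rot f : T1 (left_section SO41_group paramZ f) = - (('i%C * m%:~R) *: T1 f).
Proof.
rewrite (Hom_left HT (@one_param_rot R)); last exact: SO31_1.
have H := is_cderive_mulmx is_cderive_cexp (is_cderive_left SO31_group (@one_param_rot R) (T f) SO31_1).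
have E : (fun s => (cexp (0 +i* (m%:~R * s))%C)%:M *m T f (diagrot s *m 1%:M)) = (fun=> T1 f).
  apply/funext => s; rewrite mulmx1.
  have rq : rho' (diagrot s, (cexp (0 +i* (m%:~R * s))%C)%:M).
    exists s, 0, 1%:M; split => /=.
    - by rewrite -(nexp0 (Xn 0 0 0)); exact: Nplus_nexp.
    - exact: SO31_1.
    - by rewrite mexp0H !mulmx1.
    - by rewrite mulr0 cexp0 mulr1.
  have := section_equi (T f) SO31_1 rq; rewrite /= mul1mx => ->.
  rewrite mulKVmx // unitmxE det_scalar1 unitfE.
  rewrite /cexp /= expR0 mul1r; apply/eqP => -[cm sm].
  have := cos2Dsin2 (m%:~R * s); rewrite cm sm !expr0n /= addr0 => /esym/eqP.
  by rewrite oner_eq0.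
rewrite E /= diagrot0 !mulmx1 in H.
have := is_cderive_unique H (is_cderive_cst (T1 f) 0).
rewrite mulr0 -[(0 +i* 0)%C]/(0 : R[i]) cexp0 mul1mx mul_scalar_mx => /eqP.
by rewrite addrC addr_eq0 => /eqP.
Qed.

Lemma Hom_Xi r f : T1 (Xi r f) = ('i%C * m%:~R) *: T1 f.
Proof.
rewrite /Xi !linearB /=.
transitivity (T1 (left_section SO41_group param2 (chart_mul r (inord 1) f))
  - T1 (left_section SO41_group param1 (chart_mul r (inord 2) f)) - T1 (left_section SO41_group paramZ f)) => //.
have E2 := Hom_nexp (chart_mul r (inord 1) f) param2.
have E1 := Hom_nexp (chart_mul r (inord 2) f) param1.
by rewrite E1 E2 Hom_rot subrr sub0r opprK.
Qed.

Lemma Hom_away r f : 0 < r -> away r f -> ~~ eigenvalue D ('i%C * m%:~R) -> T1 f = 0.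
Proof.
move=> r0 af; rewrite eigenvalue_root_char => rootP.
set p := char_poly D in rootP.
have F0 : (\sum_(k < size p) p`_k *: iter k (Xi r) f : sec) = 0.
  apply/val_inj/funext => g /=; have [Kg|Kg] := pselect (SO41 g); last by rewrite section_out.
  have [M _ ->] := Xi_poly p r0 af Kg.
  by rewrite Cayley_Hamilton mulmx0 !mul0mx.
have Tk k : T1 (iter k (Xi r) f) = ('i%C * m%:~R) ^+ k *: T1 f.
  by elim: k => [|k IH] /=; [rewrite expr0 scale1r|rewrite Hom_Xi IH scalerA exprS].
have : T1 (\sum_(k < size p) p`_k *: iter k (Xi r) f : sec) = p.['i%C * m%:~R] *: T1 f.
  rewrite horner_coef scaler_suml.
  have : forall s : seq 'I_(size p), T1 (\sum_(k <- s) p`_k *: iter k (Xi r) f : sec) =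
      \sum_(k <- s) (p`_k * ('i%C * m%:~R) ^+ k) *: T1 f.
    elim=> [|k s IH]; first by rewrite !big_nil linear0.
    by rewrite !big_cons linearP -IH -scalerA -Tk.
  exact.
rewrite F0 linear0 => /esym/eqP; rewrite scaler_eq0 => /orP[|/eqP //].
by move=> H; move: rootP; rewrite /root H.
Qed.

End SymmetryBreakingAtBasePoint.

(** * Neighbourhoods of the base point, and the sphere S^2 *)

Section Support.
Context {R : realType}.
Notation q0 := (qvec : 'cV[R]_5).
Implicit Types g u : 'M[R]_5.

Definition direction (w : 'cV[R]_5) : 'cV[R]_4 :=
  \col_(i < 4) (w (widen_ord (leqnSn 4) i) 0 / w ord_max 0).

Lemma directionZ k w : k != 0 -> direction (k *: w) = direction w.
Proof.
by move=> k0; apply/matrixP => i j; rewrite !mxE invfM mulrACA divff // mul1r.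
Qed.

Lemma continuous_direction g (w : 'cV[R]_5) : (g *m w) ord_max 0 != 0 ->
  {for w, continuous (fun w => direction (g *m w))}.
Proof.
move=> w0; have c i : {for w, continuous (fun w : 'cV[R]_5 => (g *m w) i 0)}.
  have c1 : (fun w : 'cV[R]_5 => g *m w) @ w --> g *m w by exact: mulmx_continuous.
  exact: (cvg_comp _ _ c1 (@coord_continuous _ _ _ _ _ _)).
apply: (@cvg_mx_entries R _ (nbhs w) (nbhs_filter w)) => i j; rewrite [direction _]/direction mxE.
rewrite (_ : (fun x => _) = fun x : 'cV[R]_5 => (g *m x) (widen_ord (leqnSn 4) i) 0 / (g *m x) ord_max 0).
  by apply: cvgM; [exact: c|apply: cvgV => //; exact: c].
by apply/funext => x; rewrite mxE.
Qed.

Lemma near_base (e : R) : 0 < e -> exists2 r, 0 < r & forall u, SO41 u ->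
  `|height u| < r * `|lightc ord_max u| -> `|q0 - (lightc ord_max u)^-1 *: (u *m q0)| <= e.
Proof.
(* Normalize y_4 to 1. The bound e controls 1 - y_0. The bound e^2 / 2 controls the middle
   coordinates, whose squares sum to 1 - y_0^2 <= 2 (1 - y_0) < 2 r <= e^2. *)
move=> e0; pose r := Num.min e (e ^+ 2 / 2).
have r0 : 0 < r by rewrite lt_min e0 divr_gt0 // exprn_gt0.
have re : r <= e by rewrite ge_min lexx.
have re2 : 2 * r <= e ^+ 2.
  have : r <= e ^+ 2 / 2 by rewrite ge_min lexx orbT.
  by lra.
exists r => // u Ku; have y0 := cone_max_neq0 Ku; have := cone_point Ku.
rewrite Q41_sum /height /lightc; move: (u *m q0) y0 => y y0.
set a := y ord0 0; set b := y (inord 1) 0; set c := y (inord 2) 0; set d := y (inord 3) 0.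
set h := y ord_max 0 in y0 * => Q.
have E1 : (a / h) ^+ 2 + (b / h) ^+ 2 + (c / h) ^+ 2 + (d / h) ^+ 2 = 1.
  have -> : (a / h) ^+ 2 + (b / h) ^+ 2 + (c / h) ^+ 2 + (d / h) ^+ 2 =
      (a ^+ 2 + b ^+ 2 + c ^+ 2 + d ^+ 2) / h ^+ 2 by field.
  by rewrite (_ : _ + d ^+ 2 = h ^+ 2) ?divff ?expf_neq0 //; lra.
have bound t : t ^+ 2 <= e ^+ 2 -> `|t| <= e.
  by move=> te; rewrite -ler_sqr ?nnegrE ?normr_ge0 ?(ltW e0) // real_normK ?num_real.
have -> : h - a = (1 - a / h) * h by field.
rewrite normrM ltr_pM2r ?normr_gt0 // => /ltr_normlP[ar1 ar2].
apply: mx_norm_le; first exact: ltW.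
have := sqr_ge0 (1 - a / h); have := sqr_ge0 (b / h); have := sqr_ge0 (c / h); have := sqr_ge0 (d / h).
move=> d2 c2 b2 a2.
rewrite qvecE => i j; rewrite (ord1 j) !mxE mulrC.
move: i; apply: ord5P; rewrite /= ?inordK //= ?sub0r ?normrN -/a -/b -/c -/d -/h.
- by apply/ler_normlP; split; lra.
- by apply: bound; lra.
- by apply: bound; lra.
- by apply: bound; lra.
- by rewrite divff // subrr normr0 ltW.
Qed.

Lemma closed_S2 : closed (S2 : set 'cV[R]_4).
Proof.
have c i : continuous (fun y : 'cV[R]_4 => y i 0) by exact: coord_continuous.
have cs (y : 'cV[R]_4) : (fun y : 'cV[R]_4 => \sum_(i < 4) y i 0 ^+ 2) @ nbhs y --> \sum_(i < 4) y i 0 ^+ 2.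
  apply: cvg_big => [|i _]; first exact: add_continuous.
  exact: (cvgM (c i y) (c i y)).
rewrite (_ : S2 = (fun y : 'cV[R]_4 => \sum_(i < 4) y i 0 ^+ 2) @^-1` [set 1] `&`
  (fun y : 'cV[R]_4 => y ord_max 0) @^-1` [set 0]) //.
apply: closedI; apply: closed_comp; try exact: closed_eq.
  by move=> y _; exact: cs.
by move=> y _; exact: c.
Qed.

Lemma sphere_pt_S2 g : SO31 g -> S2 (sphere_pt g).
Proof.
move=> [Kg ge]; have y0 := cone_max_neq0 Kg; have Q := cone_point Kg.
(* g preserves the form and fixes e_3, so the product of e_3 with g q is that of e_3 with q, namely
   0. *)
have y3 : (g *m q0) (inord 3) 0 = 0.
  have E : ((delta_mx (inord 3) 0 : 'cV[R]_5)^T *m J5 *m (g *m q0)) 0 0 = 0.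
    rewrite -{1}ge trmx_mul !mulmxA -(mulmxA _ g^T) -(mulmxA _ (g^T *m J5)) SO41_J //.
    rewrite trmx_delta -!rowE qvecE !(mxE, sum5) /= ?inordK //=; ring.
  move: E; rewrite trmx_delta -rowE; move: (g *m q0) => y.
  by rewrite !(mxE, sum5) /= ?inordK //= => <-; ring.
rewrite -[sphere_pt g]/(direction (g *m q0)); move: (g *m q0) y0 Q y3 => y y0.
rewrite Q41_sum => Q y3; split.
  under eq_bigr do rewrite mxE exprMn exprVn.
  rewrite -mulr_suml; apply: canLR (mulfK _) _; first by rewrite expf_neq0.
  rewrite mul1r !big_ord_recl big_ord0.
  have W (i : 'I_4) (j : 'I_5) : i = j :> nat -> y (widen_ord (leqnSn 4) i) 0 = y j 0.
    by move=> ij; congr (y _ _); exact: val_inj.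
  rewrite (W ord0 ord0) // (W (lift ord0 ord0) (inord 1)) /= ?inordK //.
  rewrite (W (lift ord0 (lift ord0 ord0)) (inord 2)) /= ?inordK //.
  rewrite (W (lift ord0 (lift ord0 (lift ord0 ord0))) (inord 3)) /= ?inordK //.
  by lra.
rewrite mxE (_ : widen_ord _ _ = inord 3); first by rewrite y3 mul0r.
by apply: val_inj; rewrite /= inordK.
Qed.

End Support.

(** * From the base point to all of S^2 *)

Section Main.
Context {R : realType} {n : nat} (sigma : 'M[R]_3 -> 'M[R[i]]_n.+1) (lambda nu : R[i]) (m : int).
Hypothesis s1 : sigma 1%:M = 1%:M.
Hypothesis sM : {in SO3 &, forall g h, sigma (g *m h) = sigma g *m sigma h}.
Hypothesis sc : forall b, {within SO3, continuous (part b \o sigma)}.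
Hypothesis nm : (n.+1 <= `|m|%N.*2)%N.
Notation rho := (P_rep sigma lambda).
Notation rho' := (P'_rep m nu).

(** The right side is closed, so it is enough to treat points where T f is nonzero; such a point is
    moved to o by an element of G'. *)
Lemma Hom_supp (T : {linear sections SO41 rho -> sections SO31 rho'}) f :
  Hom_SO31 rho rho' T -> supp (T f) `<=` supp f `&` S2.
Proof.
move=> HT; have [D gD /(_ m nm) mD] := so3_generator s1 sM sc.
have cl : closed (supp f `&` S2) by apply: closedI; [exact: closed_closure|exact: closed_S2].
rewrite ((closure_id _).1 cl); apply: closure_subset => _ [g /= Tfg <-].
have Kg : SO31 g by apply: contrapT => Kg; apply: Tfg; exact: section_out.
split; last exact: sphere_pt_S2.
(* Suppose that f vanishes over the neighbourhood B of the point; then T f must vanish at g. *)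
move=> B nB; apply: contrapT => AB; apply: Tfg.
have y0 := cone_max_neq0 (SO31_sub Kg).
have /nbhs_ballP[e /= e0 eB] : \forall w \near (qvec : 'cV[R]_5), B (direction (g *m w)).
  exact: (continuous_direction y0).
(* Half of the radius again, to pass from a weak to a strict inequality. *)
have [r r0 rP] := near_base (divr_gt0 e0 (ltr0Sn R 1)).
have KV : SO31 (invmx g) by exact: (matrix_groupV SO31_group).
(* f' u = f (g u) vanishes for u over a neighbourhood of o, and (T f')(1) = (T f)(g). *)
pose f' := ltrans SO41_group (SO31_sub KV) f.
have af : away r f'.
  move=> u Ku /(rP u Ku) Hu; rewrite /f' /= invmxK; apply: contrapT => fu; apply: AB.
  have yu := cone_max_neq0 Ku.
  exists (sphere_pt (g *m u)); split; first by exists (g *m u).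
  have -> : sphere_pt (g *m u) = direction (g *m ((lightc ord_max u)^-1 *: (u *m qvec))).
    rewrite -scalemxAr directionZ ?invr_eq0 // mulmxA //.
  apply: eB; rewrite -ball_normE /=; apply: le_lt_trans Hu _.
  by rewrite ltr_pdivrMr // ltr_pMr // ltr1n.
have := Hom_away s1 sM gD HT r0 af mD.
by rewrite (HT.2 _ KV f) /= invmxK mulmx1.
Qed.

End Main.

Theorem theorem1p6 (R : realType) (lambda nu : R[i]) (N : nat) (m : int)
    (sigma : 'M[R]_3 -> 'M[R[i]]_(N.*2.+1)) :
  SO3_irrep sigma -> N%:Z < `|m| ->
  Hom_SO31 (P_rep sigma lambda) (P'_rep m nu) =
  Diff_SO31 (P_rep sigma lambda) (P'_rep m nu).
Proof.
move=> [s1 sM sc _] Nm; rewrite eqEsubset; split=> [T HT|T []//].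
split=> // f; apply: (Hom_supp s1 sM sc _ HT).
(* The dimension condition 2 N + 1 <= 2 |m| is N < |m|. *)
by rewrite ltn_double -ltz_nat abszE.
Qed.
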